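(* Let $k\in\{0,1,2\}$. (a) The relation $\equiv^k$ on $S_n$ is a refinement of shifted dual equivalence on the reverses of permutations: if $\pi\equiv^k\pi'$ in $S_n$, then $\mathrm{rev}(\pi)$ and $\mathrm{rev}(\pi')$ are shifted dual equivalent. In particular, every function in $\{f^{(h)}\}$ is a sum, with nonnegative integer coefficients, of functions in $\{\omega(f): f\in\{f^{(k)}\}\}$. (b) The relation $\equiv^k$ on $S_n$ is a refinement of the relation given by shifted dual equivalence on the flips of permutations: if $\pi\equiv^k\pi'$ in $S_n$, then $\mathrm{flip}(\pi)$ and $\mathrm{flip}(\pi')$ are shifted dual equivalent.
   Context: Permutations are in one-line notation. $\mathrm{ID}(\pi)$ is the set of $i\in[n-1]$ such that $i$ occurs to the right of $i+1$. $\mathrm{rev}(\pi)$ is $\pi$ read from right to left; $\mathrm{flip}(\pi)$ is obtained from $\mathrm{rev}(\pi)$ by replacing each value $v$ by $n+1-v$. For $D\subseteq[n-1]$, $F_D=\sum x_{j_1}\cdots x_{j_n}$ over $j_1\le\cdots\le j_n$ such that $j_k=j_{k+1}$ implies $k\notin D$. $\omega$ is the linear involution on quasisymmetric functions sending $F_D$ to $F_{[n-1]\setminus D}$. Shifted dual equivalence. For $n=4$, $h_1$ swaps the values $x$ and $y$ when the permutation has one of the forms $1x2y$, $x12y$, $1x4y$, $x14y$, $4x1y$, $x41y$, $4x3y$, $x43y$ ($\{x,y\}$ being the two remaining values of $\{1,2,3,4\}$ in either order), and is the identity otherwise. For $n>4$ and $1\le i\le n-3$, $h_i$ fixes all values outside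 $I=[i,i+3]$ and permutes the values in $I$ so that $\mathrm{fl}(h_i(\pi)|_I)=h_1(\mathrm{fl}(\pi|_I))$, where $\pi|_I$ is the subword of values in $I$ and $\mathrm{fl}$ replaces a word by the permutation in the same relative order. For $n\le3$ the action is trivial. Two permutations are shifted dual equivalent if connected by a sequence of $h_i$'s. $\{f^{(h)}\}$ is the set of functions $\sum_{\pi\in\mathcal C}F_{\mathrm{ID}(\pi)}$ with $\mathcal C$ a single shifted dual equivalence class of permutations. Standard Young tableaux. Diagrams are in French notation (left-justified rows numbered bottom to top). $\mathrm{SYT}(\lambda)$: fillings of $\lambda\vdash n$ by $1,\dots,n$ (each once) increasing left to right along rows and bottom to top up columns; $\mathrm{SYT}(n)=\bigcup_{\lambda\vdash n}\mathrm{SYT}(\lambda)$. The superstandard tableau $U_\lambda$ has bottom row $1,\dots,\lambda_1$, second row $\lambda_1+1,\dots,\lambda_1+\lambda_2$, etc. $\mathrm{rw}(T)$ reads each row left to right, top row first; cells are ordered by this reading order; $\mathrm{ID}(T)=\mathrm{ID}(\mathrm{rw}(T))$. Writing $\mathrm{ID}(T)\cup\{n\}=\{b_1<\dots<b_m\}$, $b_0=0$, the $r$-th run of $T$ is the set of cells with entries in $(b_{r-1},b_r]$, and $\beta_r(T)=b_r-b_{r-1}$. $T$ is determined by the sequence of cell sets of its runs (entries increase in reading order within a run). The first $r$ runs form the tableau of entries $\le b_r$. The maps $\mathrm{slink},\mathrm{slink}_*$ on $\mathrm{SYT}(\lambda)$. Let $j$ be minimal such that the first $j$ runs of $T$ do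 not form a superstandard tableau. If no such $j$ exists, both maps fix $T$. Otherwise: (1) $\mathrm{slink}(T)$ has the same runs as $T$ except runs $j-1$ and $j$: among the cells of runs $j-1$ and $j$ of $T$ strictly below row $j$, the first $\beta_j(T)-1$ in reading order form the new $(j-1)$-th run, and the remaining ones together with the cells of run $j$ in row $j$ form the new $j$-th run. (2) Let $\mu$ be the shape of the first $j$ runs of $T$ and let $i\ge1$ be minimal with $\mu_{i+1}\le\beta_j(T)+i-j$. $\mathrm{slink}_*(T)$ has the same runs as $T$ except runs $i$ and $j$: among the cells of runs $i$ and $j$ of $T$ strictly below row $i+1$, the first $\beta_j(T)+i-j$ in reading order form the new $i$-th run, and the remaining ones together with the cells of run $j$ in rows $\ge i+1$ form the new $j$-th run. Restricted dual equivalence. $d_i$ acts on a permutation by: $\ldots i\ldots i-1\ldots i+1\ldots\leftrightarrow\ldots i+1\ldots i-1\ldots i\ldots$ and $\ldots i\ldots i+1\ldots i-1\ldots\leftrightarrow\ldots i-1\ldots i+1\ldots i\ldots$ (all else fixed), and as the identity if $i$ is between $i-1$ and $i+1$; it acts on $\mathrm{SYT}(\lambda)$ through $\mathrm{rw}$. For $T\in\mathrm{SYT}(n)$ and $i\in[2,n-2]$, $d_i^R(T)=T$ if $i+1\in\mathrm{ID}(T)\cap\mathrm{ID}(d_i(T))$, and $d_i^R(T)=d_i(T)$ otherwise. Relations. $\equiv^0$, $\equiv^1$, $\equiv^2$ on $\mathrm{SYT}(n)$ are the equivalence relations generated by $T\sim\mathrm{slink}_*(T)$, $T\sim\mathrm{slink}(T)$,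 and $T\sim d_i^R(T)$ (all $i\in[2,n-2]$), respectively. On $S_n$, with $(P,Q)$ the RSK insertion and recording tableaux, $\pi\equiv^k\pi'$ means $P(\pi)\equiv^kP(\pi')$ and $Q(\pi)=Q(\pi')$. $\{f^{(k)}\}$ is the set of functions $\sum_{T\in\mathcal C}F_{\mathrm{ID}(T)}$ with $\mathcal C$ a single $\equiv^k$ class of standard Young tableaux. *)

(* Defs.v *)
From HB Require Import structures.
From Stdlib Require Export Relation_Operators.
From mathcomp Require Export all_boot all_order all_fingroup all_algebra.
From mathcomp Require Export finmap multiset.
From mathcomp Require Export boolp classical_sets functions.

Set Implicit Arguments.
Unset Strict Implicit.
Unset Printing Implicit Defensive.

Import GRing.Theory.

Local Open Scope nat_scope.

(* One-line notation, with values 1, ..., n. *)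
Definition word (n : nat) (p : 'S_n) : seq nat :=
  [seq (val (p i)).+1 | i <- enum 'I_n].

Definition perm_word (n : nat) (w : seq nat) : bool := perm_eq w (iota 1 n).

Definition flip (n : nat) (w : seq nat) : seq nat := [seq n.+1 - v | v <- rev w].

Definition inv_des (w : seq nat) (i : nat) : bool := index i.+1 w < index i w.

(* Subsets of [n-1] are sets of ordinals: i : 'I_n.-1 stands for the
   element i+1 of [n-1]. *)
Definition ID (n : nat) (w : seq nat) : {set 'I_n.-1} :=
  [set i : 'I_n.-1 | inv_des w i.+1].

(* Formal power series with integer coefficients in countably many commuting
   variables: a monomial is the finite multiset of the indices of its
   variables, and a series is its coefficient function. *)
Definition qseries : Type := {mset nat}%mset -> int.

(* A monomial of degree n is x_{j_1} ... x_{j_n} for exactly one weakly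
   increasing j, namely its sorted multiset of indices, so all coefficients of
   F_D are 0 or 1. *)
Definition F (n : nat) (D : {set 'I_n.-1}) : qseries := fun m =>
  let j := sort leq (enum_mset m) in
  ((size j == n) &&
   [forall k : 'I_n.-1, (nth 0 j k == nth 0 j k.+1) ==> (k \notin D)])%:R%R.

Definition Fcomb (n : nat) (c : {set 'I_n.-1} -> int) : qseries :=
  (\sum_(D : {set 'I_n.-1}) F D *~ c D)%R.

(* A monomial at which the coefficient of F_D is 1 exactly when D is a subset
   of E. *)
Definition mon_seq (n : nat) (E : {set 'I_n.-1}) : seq nat :=
  [seq #|[set k in E | k < i]| | i <- iota 0 n].

Lemma mon_seq_sorted n (E : {set 'I_n.-1}) : sorted leq (mon_seq E).
Proof.
rewrite sorted_map; apply: sub_sorted (iota_sorted 0 n) => i j /= le_ij.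
by apply/subset_leq_card/fintype.subsetP => k; rewrite !inE => /andP[-> /leq_trans->].
Qed.

Lemma F_mon n (D E : {set 'I_n.-1}) :
  F D (seq_mset (mon_seq E)) = (D \subset E)%:R%R.
Proof.
have sE : sort leq (enum_mset (seq_mset (mon_seq E))) = mon_seq E.
  apply: (sorted_eq leq_trans anti_leq).
  - exact: (sort_sorted leq_total).
  - exact: mon_seq_sorted.
  - by rewrite perm_sort perm_eq_seq_mset.
rewrite /F sE size_map size_iota eqxx /=; congr (_%:R%R); congr nat_of_bool.
have ltk (k : 'I_n.-1) : k.+1 < n by rewrite -ltn_predRL ltn_ord.
have step (k : 'I_n.-1) :
    (nth 0 (mon_seq E) k == nth 0 (mon_seq E) k.+1) = (k \notin E).
  rewrite !(nth_map 0) ?size_iota ?(ltnW (ltk k)) // !nth_iota ?(ltnW (ltk k)) //.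
  rewrite !add0n; set A := [set _ in E | _ < k]; set B := [set _ in E | _ < k.+1].
  have [kE|kE] := boolP (k \in E); last first.
    suff -> : A = B by rewrite eqxx.
    apply/setP => i; rewrite !inE ltnS [i <= k]leq_eqVlt.
    case: (eqVneq (val i) k) => [/ord_inj->|_] //=.
    by rewrite (negPf kE).
  have -> : B = (k |: A)%SET.
    apply/setP => i; rewrite !inE ltnS [i <= k]leq_eqVlt -val_eqE /=.
    by case: (eqVneq (val i) k) => [/ord_inj->|_] /=; rewrite ?kE.
  by rewrite cardsU1 !inE ltnn andbF /= add1n (ltn_eqF (ltnSn _)).
apply/forallP/fintype.subsetP => [H k kD|H k].
  by apply: contraTT kD => kE; apply: (implyP (H k)); rewrite step.
by rewrite step; apply/implyP; apply: contraNN; exact: H.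
Qed.

Lemma Fcomb_mon n (c : {set 'I_n.-1} -> int) (E : {set 'I_n.-1}) :
  Fcomb c (seq_mset (mon_seq E)) =
  (\sum_(D : {set 'I_n.-1} | D \subset E) c D)%R.
Proof.
have mulzE (f : qseries) (z : int) m : ((f *~ z) m = f m *~ z)%R.
  have mulnE k : ((f *+ k) m = f m *+ k)%R.
    by elim: k => // k IH; rewrite !mulrS -IH.
  by case: z => k; [exact: mulnE | congr (- _)%R; exact: mulnE].
rewrite /Fcomb fct_sumE [RHS]big_mkcond; apply: eq_bigr => D _.
by rewrite mulzE F_mon; case: ifP => _; rewrite ?mul0rz // intz.
Qed.

Lemma Fcomb_inj n (c c' : {set 'I_n.-1} -> int) : Fcomb c = Fcomb c' -> c =1 c'.
Proof.
move=> ecc' D; have [m] := ubnP #|D|; elim: m => // m IH in D *.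
rewrite ltnS => leDm; have := congr1 (@^~ (seq_mset (mon_seq D))) ecc'.
rewrite /= !Fcomb_mon (bigD1 D) //= [RHS](bigD1 D) //=.
rewrite (eq_bigr c'); first exact: addIr.
move=> E /andP[sED neED]; apply: IH; apply: leq_trans leDm; apply: proper_card.
by rewrite finset.properEneq neED.
Qed.

(* The degree n part of omega; the coefficients c are unique by Fcomb_inj.
   The value off the span of the F_D is a dummy. *)
Definition omega (n : nat) (f : qseries) : qseries :=
  match pselect (exists c : {set 'I_n.-1} -> int, f = Fcomb c) with
  | left fP => (\sum_(D : {set 'I_n.-1}) F (~: D) *~ projT1 (cid fP) D)%R
  | right _ => 0%R
  end.

Lemma omega_Fcomb n (c : {set 'I_n.-1} -> int) :
  omega n (Fcomb c) = (\sum_(D : {set 'I_n.-1}) F (~: D) *~ c D)%R.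
Proof.
rewrite /omega; case: pselect => [cP|[]]; last by exists c.
case: (cid cP) => c' /= /Fcomb_inj ecc'.
by apply: eq_bigr => D _; rewrite ecc'.
Qed.

Lemma omega_F n (D : {set 'I_n.-1}) : omega n (F D) = F (~: D).
Proof.
have -> : F D = Fcomb (fun E => (E == D)%:R%R).
  rewrite /Fcomb (bigD1 D) //= eqxx mulr1z big1 ?addr0 // => E /negPf->.
  exact: mulr0z.
rewrite omega_Fcomb (bigD1 D) //= eqxx mulr1z big1 ?addr0 // => E /negPf->.
exact: mulr0z.
Qed.

Definition nat_comb (X : set qseries) (f : qseries) : Prop :=
  exists (m : nat) (g : 'I_m -> qseries) (c : 'I_m -> nat),
    (forall i, X (g i)) /\ f = (\sum_(i < m) g i *+ c i)%R.

Definition fl (w : seq nat) : seq nat :=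
  [seq (count (fun y => y < x) w).+1 | x <- w].

(* The two tests are the forms with the fixed letters in positions 1, 3 and
   2, 3 respectively; they exclude each other. *)
Definition h1 (w : seq nat) : seq nat :=
  let S := [:: (1, 2); (1, 4); (4, 1); (4, 3)] in
  match w with
  | [:: a; b; c; d] =>
      if (a, c) \in S then [:: a; d; c; b]
      else if (b, c) \in S then [:: d; b; c; a]
      else w
  | _ => w
  end.

Definition h (i : nat) (w : seq nat) : seq nat :=
  let u := [seq v <- w | i <= v <= i + 3] in
  let u' := [seq (i + k).-1 | k <- h1 (fl u)] in
  [seq if v \in u then nth 0 u' (index v u) else v | v <- w].

Definition h_step (n : nat) (u v : seq nat) : Prop :=
  perm_word n u /\ exists i, [/\ 1 <= i, i <= n - 3 & v = h i u].

Definition shifted_dual_equiv (n : nat) : seq nat -> seq nat -> Prop :=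
  clos_refl_sym_trans _ (h_step n).

Definition fh (n : nat) : set qseries := fun f =>
  exists (p : 'S_n) (C : {set 'S_n}),
    (forall q, q \in C <-> shifted_dual_equiv n (word p) (word q)) /\
    f = (\sum_(q in C) F (ID n (word q)))%R.

(* Tableaux are lists of rows, bottom row first. Cells are pairs
   (row, column), both counted from 1. *)
Notation tableau := (seq (seq nat)).
Notation cell := (nat * nat)%type.

Definition is_syt (n : nat) (T : tableau) : bool :=
  [&& perm_eq (flatten T) (iota 1 n),
      [::] \notin T,
      sorted geq (shape T),
      all (sorted ltn) T &
      all (fun i => all (fun c => nth 0 (nth [::] T i) c <
                                  nth 0 (nth [::] T i.+1) c)
                        (iota 0 (size (nth [::] T i.+1))))
          (iota 0 (size T).-1)].

Definition superstandard (la : seq nat) : tableau := reshape la (iota 1 (sumn la)).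

Definition rw (T : tableau) : seq nat := flatten (rev T).

Definition entry (T : tableau) (x : cell) : nat :=
  nth 0 (nth [::] T x.1.-1) x.2.-1.

Definition cells (la : seq nat) : seq cell :=
  [seq (i, c) | i <- rev (iota 1 (size la)), c <- iota 1 (nth 0 la i.-1)].

(* breaks T is b_0 < b_1 < ... < b_m. *)
Definition breaks (T : tableau) : seq nat :=
  let n := size (rw T) in
  0 :: [seq b <- iota 1 n | inv_des (rw T) b || (b == n)].

Definition nruns (T : tableau) : nat := (size (breaks T)).-1.

Definition brk (T : tableau) (r : nat) : nat := nth 0 (breaks T) r.

Definition beta (T : tableau) (r : nat) : nat := brk T r - brk T r.-1.

Definition run (T : tableau) (r : nat) : seq cell :=
  [seq x <- cells (shape T) | brk T r.-1 < entry T x <= brk T r].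

Definition restr (T : tableau) (b : nat) : tableau :=
  [seq R <- [seq [seq x <- R | x <= b] | R <- T] | R != [::]].

Definition first_runs (T : tableau) (r : nat) : tableau := restr T (brk T r).

(* The filling of shape la with the given runs, each listed in reading order. *)
Definition of_runs (la : seq nat) (rs : seq (seq cell)) : tableau :=
  [seq [seq (index (i, c) (flatten rs)).+1 | c <- iota 1 (nth 0 la i.-1)]
     | i <- iota 1 (size la)].

Definition not_super (T : tableau) (r : nat) : bool :=
  first_runs T r != superstandard (shape (first_runs T r)).

(* The minimal j such that the first j runs are not superstandard; it exceeds
   nruns T when there is none. *)
Definition bad_run (T : tableau) : nat :=
  (find (not_super T) (iota 1 (nruns T))).+1.

(* Replace runs i and j: among their cells strictly below row t, the first q
   form run i; the others, together with the cells of run j whose row satisfies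
   up, form run j. *)
Definition relink (T : tableau) (i j t q : nat) (up : pred nat) : tableau :=
  let la := shape T in
  let low := [seq x <- cells la | ((x \in run T i) || (x \in run T j)) && (x.1 < t)] in
  let run_i := take q low in
  let run_j := [seq x <- cells la | (x \in drop q low) ||
                                    ((x \in run T j) && up x.1)] in
  of_runs la [seq if r == i then run_i else if r == j then run_j else run T r
                | r <- iota 1 (nruns T)].

Definition slink (T : tableau) : tableau :=
  let j := bad_run T in
  if j <= nruns T then relink T j.-1 j j (beta T j - 1) (fun r => r == j) else T.

(* The inequality mu_{i+1} <= beta_j + i - j is stated without subtraction;
   it holds for i = size mu + j, so the search for i succeeds. *)
Definition slink_star_row (T : tableau) (j : nat) : nat :=
  let mu := shape (first_runs T j) in
  (find (fun i => nth 0 mu i + j <= beta T j + i) (iota 1 (size mu + j))).+1.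

Definition slink_star (T : tableau) : tableau :=
  let j := bad_run T in
  if j <= nruns T then
    let i := slink_star_row T j in
    relink T i j i.+1 (beta T j + i - j) (fun r => i.+1 <= r)
  else T.

Definition between (w : seq nat) (a b c : nat) : bool :=
  (index a w < index b w < index c w) || (index c w < index b w < index a w).

Definition swap (a b v : nat) : nat :=
  if v == a then b else if v == b then a else v.

(* The permutation of values by which d_i acts on w. *)
Definition d_val (i : nat) (w : seq nat) : nat -> nat :=
  if between w i i.-1 i.+1 then swap i i.+1
  else if between w i i.+1 i.-1 then swap i.-1 i
  else id.

Definition d (i : nat) (T : tableau) : tableau :=
  [seq [seq d_val i (rw T) v | v <- R] | R <- T].

Definition dR (i : nat) (T : tableau) : tableau :=
  if inv_des (rw T) i.+1 && inv_des (rw (d i T)) i.+1 then T else d i T.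

Definition tab_step (k : 'I_3) (n : nat) (T T' : tableau) : Prop :=
  [/\ is_syt n T, is_syt n T' &
      match val k with
      | 0 => T' = slink_star T
      | 1 => T' = slink T
      | _ => exists i, [/\ 2 <= i, i <= n - 2 & T' = dR i T]
      end].

Definition tab_equiv (k : 'I_3) (n : nat) : tableau -> tableau -> Prop :=
  clos_refl_sym_trans _ (tab_step k n).

Definition fk (k : 'I_3) (n : nat) : set qseries := fun f =>
  exists (T : tableau) (C : seq tableau),
    [/\ is_syt n T, uniq C, (forall T', T' \in C <-> tab_equiv k n T T') &
        f = (\sum_(T' <- C) F (ID n (rw T')))%R].

(* Row insertion of x: the new tableau and the (0-based) row of the new cell. *)
Fixpoint row_insert (P : tableau) (x : nat) : tableau * nat :=
  match P with
  | [::] => ([:: [:: x]], 0)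
  | R :: P' =>
      let c := find (fun y => x < y) R in
      if c == size R then (rcons R x :: P', 0)
      else let: (P'', r) := row_insert P' (nth 0 R c) in
           (set_nth 0 R c x :: P'', r.+1)
  end.

Definition RSK_step (PQ : tableau * tableau) (x : nat) : tableau * tableau :=
  let: (P', r) := row_insert PQ.1 x in
  (P', set_nth [::] PQ.2 r (rcons (nth [::] PQ.2 r) (size (rw P')))).

Definition RSK (w : seq nat) : tableau * tableau :=
  foldl RSK_step ([::], [::]) w.

Definition perm_equiv (k : 'I_3) (n : nat) (p q : 'S_n) : Prop :=
  tab_equiv k n (RSK (word p)).1 (RSK (word q)).1 /\
  (RSK (word p)).2 = (RSK (word q)).2.

(* Main.v *)
From mathcomp Require Import zify.
Require Import Defs.

Set Implicit Arguments.
Unset Strict Implicit.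
Unset Printing Implicit Defensive.

Import GRing.Theory.

(* On a window of four values a nontrivial d_i^R is h_(i-1) on the reverse, and
   the defining patterns of h_1 are stable under complement, which gives flips.
   The d_i^R commute with Knuth equivalence and preserve recording tableaux, so
   a chain of d_i^R moves on the reading word of P(pi) lifts to a chain on pi
   with the same recording tableau, and it suffices to connect rw(T) with
   rw(slink T) and rw(slink_* T) by such moves.

   Read through inverses, that is through the list of the cells of 1, 2, ..., n,
   a d_i^R move is a Knuth move of adjacent cells. With R_r the r-th run and X
   the cells of runs i and j in rows at most i, both maps turn
   (take a X) U (drop a X) into (take q X) U (drop q X), where U consists of
   R_(i+1), ..., R_(j-1) followed by the part of run j above row i. Such slides
   of a block U are composed of Knuth moves, by induction on the number of rows
   in U; the inequality defining i in slink_* bounds the width of U by q. *)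

(** * Sliding a block through an increasing sequence *)

(** The restriction in [d_i^R] shapes the slides: a letter may cross another one only if a suitable
    larger letter [t] follows them, so a block can never be pushed to the very end of [X]. Each row
    of the block costs one letter of [X] on its right, and a block of [j - i] rows needs [j - i] of
    them. The value [q = beta_j + i - j] leaves enough room, since [q + (j - i)] is the size of run
    [j], which is at most the size of [X].

    Recording tableaux have two uses. By injectivity of RSK, the end of a lifted chain is the given
    permutation. They are also constant on a class of permutations, so that [P] maps it bijectively
    onto a class of tableaux; this is how the functions f^(k) arise. The reverses of a shifted dual
    equivalence class split into such classes, and reversal complements [ID], as omega does, so all
    coefficients in the sum are 1. *)

Lemma rst_map A B (f : A -> B) (R : A -> A -> Prop) (R' : B -> B -> Prop) :
  (forall x y, R x y -> clos_refl_sym_trans _ R' (f x) (f y)) ->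
  forall x y, clos_refl_sym_trans _ R x y ->
  clos_refl_sym_trans _ R' (f x) (f y).
Proof.
move=> H x y; elim=> {x y} [x y /H //|x|x y _|x y z _ Hxy _].
- exact: rst_refl.
- exact: rst_sym.
- exact: rst_trans Hxy.
Qed.

Section Slides.

Variables (T : eqType) (lt : rel T).

(* A Knuth move on the inverse of a reading word, listed as the sequence of
   the cells of 1, 2, ..., n: if y, z, x, t are the cells of i-1, ..., i+2,
   this is the action of [d_i], and [lt x t] says that [d_i^R] allows it. *)
Definition slide_step (s s' : seq T) : Prop :=
  exists p y z x t q,
    [/\ s = p ++ [:: y; z; x; t] ++ q, s' = p ++ [:: y; x; z; t] ++ q,
        lt x y, lt y z & lt x t].

Definition slides : seq T -> seq T -> Prop := clos_refl_sym_trans _ slide_step.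

Lemma slides_ctx p q s s' : slides s s' -> slides (p ++ s ++ q) (p ++ s' ++ q).
Proof.
apply: (@rst_map _ _ (fun s => p ++ s ++ q)) => u v.
move=> [p' [y [z [x [t [q' [-> -> xy yz xt]]]]]]]; apply: rst_step.
by exists (p ++ p'), y, z, x, t, (q' ++ q); split=> //; rewrite -!catA.
Qed.

(** The letter [y] crosses [X] from right to left. At each jump the letter before the crossed one
    supplies the middle value, and the letter crossed last, at the start [t], satisfies the
    restriction. The leading [x1] is not crossed, for lack of a letter before it. *)
Lemma slides_insert x1 X y t q : pairwise lt (x1 :: X) ->
  all (lt y) (x1 :: X) -> lt y t ->
  slides (x1 :: X ++ y :: t :: q) (x1 :: y :: X ++ t :: q).
Proof.
elim/last_ind: X t q => [|X x IH] t q pX yX yt; first exact: rst_refl.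
move: pX yX; rewrite -rcons_cons pairwise_rcons all_rcons => /andP[Xx pX].
move=> /andP[yx yX]; rewrite !cat_rcons.
apply: rst_trans (IH x (t :: q) pX yX yx); apply: rst_step.
rewrite -!cat_cons; case/lastP e: (x1 :: X) => [//|s l].
move: Xx yX; rewrite e !all_rcons => /andP[lx _] /andP[yl _].
by exists s, l, x, y, t, q; split=> //; rewrite cat_rcons.
Qed.

(** A normal form for a row [Y] placed inside [X]: two positions of [Y] are compared by bringing
    both to it. *)
Fixpoint zig (X Y : seq T) : seq T :=
  match X, Y with
  | x :: X', y :: Y' => x :: y :: zig X' Y'
  | _, [::] => X
  | [::], _ => Y
  end.

Lemma zig_cat A B Y : size Y <= size A -> zig (A ++ B) Y = zig A Y ++ B.
Proof.
elim: A Y => [|x A IH] [|y Y] //=; first by case: B.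
by rewrite ltnS => /IH->.
Qed.

Lemma slides_zig X Y t q : size Y <= size X -> pairwise lt X -> pairwise lt Y ->
  allrel lt Y X -> all (lt^~ t) Y ->
  slides (X ++ Y ++ t :: q) (zig X Y ++ t :: q).
Proof.
elim: Y X => [|y Y IH] [|x X] // sYX pX pY YX Yt; try exact: rst_refl.
have yX : all (lt y) (x :: X) by move: YX; rewrite allrel_consl => /andP[].
(* The restriction for [y] is met by the next letter of [Y], or by [t] when [y] is the last one. *)
have yr : exists t' q', Y ++ t :: q = t' :: q' /\ lt y t'.
  move: pY Yt => /= /andP[yY _] /andP[yt _].
  case: Y yY {IH sYX YX} => [_|y' Y /= /andP[yy' _]]; first by exists t, q.
  by exists y', (Y ++ t :: q).
case: yr => t' [q' [e yt']].
rewrite cat_cons cat_cons e.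
apply: rst_trans (slides_insert q' pX yX yt') _; rewrite -e.
have := @slides_ctx [:: x; y] [::] (X ++ Y ++ t :: q) (zig X Y ++ t :: q).
rewrite !cats0 /=; apply; apply: IH => //.
- by case/andP: pX.
- by case/andP: pY.
- by move: YX; rewrite allrel_consl allrel_consr => /and3P[].
- by case/andP: Yt.
Qed.

(** Of the increasing sequence [X], at least [w] letters stay on the left of the block, to be
    interleaved with a row, and at least [h] on its right, to satisfy the restriction. In the
    applications [w] is the length of the lowest row of [U] and [h] the number of its rows. *)
Definition slidable (U : seq T) (w h : nat) : Prop :=
  forall X, pairwise lt X -> allrel lt U X -> forall a a',
    w <= a -> w <= a' -> a + h <= size X -> a' + h <= size X ->
    slides (take a X ++ U ++ drop a X) (take a' X ++ U ++ drop a' X).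

Lemma slidable_row Y : pairwise lt Y -> slidable Y (size Y) 1.
Proof.
move=> pY X pX YX a a' wa wa' aL a'L.
(* The normal form does not depend on the position [b], because only the first [size Y] letters of
   [X] are interleaved. *)
suff H b : size Y <= b -> b + 1 <= size X ->
    slides (take b X ++ Y ++ drop b X) (zig X Y).
  by apply: rst_trans (H _ wa aL) _; apply: rst_sym; exact: H.
move=> wb bL; have sb : size (take b X) = b by rewrite size_take; case: ltnP; lia.
rewrite -{3}(cat_take_drop b X) zig_cat ?sb //.
move: pX YX; rewrite -{1 2}(cat_take_drop b X) pairwise_cat allrel_catr.
case e: (drop b X) => [|t q].
  by move: (size_drop b X); rewrite e /=; lia.
move=> /and3P[_ pX _] /andP[YX Yt]; apply: slides_zig => //; first by rewrite sb.
by move: Yt; rewrite allrel_consr => /andP[].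
Qed.

(* Slide U to the right until it leaves h letters, slide R ++ C, and slide U
   back. *)
Lemma slidable_wrap R U C w h :
  slidable U w h -> w <= size R -> pairwise lt (R ++ C) -> allrel lt U (R ++ C) ->
  slidable (R ++ U ++ C) (size (R ++ C)) h.+1.
Proof.
move=> GU wR pZ UZ X pX UX a a' wa wa' aL a'L.
set Z := R ++ C in pZ UZ wa wa' *.
have [X0 [X1 [eX sX1]]] : exists X0 X1, X = X0 ++ X1 /\ size X1 = h.
  exists (take (size X - h) X), (drop (size X - h) X).
  by rewrite cat_take_drop size_drop; split=> //; lia.
subst X; rewrite size_cat in aL a'L.
have ZX : allrel lt Z (X0 ++ X1).
  by move: UX; rewrite !allrel_catl => /and3P[-> _ ->].
have UX' : allrel lt U (X0 ++ X1).
  by move: UX; rewrite !allrel_catl => /and3P[_ -> _].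
have dZ b : b <= size X0 -> drop b (X0 ++ X1) = drop b X0 ++ X1.
  move=> bX; rewrite drop_cat; case: ltnP => // Xb.
  by rewrite (_ : b = size X0) ?subnn ?drop0 ?drop_size //; lia.
have tZ b : b <= size X0 -> take b (X0 ++ X1) = take b X0.
  move=> bX; rewrite take_cat; case: ltnP => // Xb.
  by rewrite (_ : b = size X0) ?subnn ?take0 ?cats0 ?take_size //; lia.
(* With [U] parked before the last [h] letters [X1], the letters of [R] and [C] become adjacent and
   can slide as the single row [Z] inside [X0]. The increasing sequence in which [U] moves is
   [R ++ C ++ B ++ X1]. *)
have toM b : b < size X0 ->
    slides (take b (X0 ++ X1) ++ (R ++ U ++ C) ++ drop b (X0 ++ X1))
           ((take b X0 ++ Z ++ drop b X0) ++ U ++ X1).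
  move=> bX; rewrite tZ 1?dZ; try lia.
  set B := drop b X0; set A := take b X0.
  have := @slides_ctx A [::] (R ++ U ++ C ++ B ++ X1) (R ++ C ++ B ++ U ++ X1).
  rewrite !cats0 /Z -!catA; apply.
  have eA : X0 ++ X1 = A ++ B ++ X1 by rewrite catA cat_take_drop.
  have := GU (R ++ C ++ B ++ X1) _ _ (size R) (size (R ++ C ++ B)).
  rewrite {1}catA pairwise_cat pZ.
  move: pX; rewrite eA pairwise_cat => /and3P[_ _ ->].
  move: ZX; rewrite eA allrel_catr => /andP[_ ->].
  move: UX'; rewrite eA [allrel _ _ (_ ++ (_ ++ _))]allrel_catr => /andP[_ UB].
  rewrite [X in allrel lt U X]catA allrel_catr UZ UB.
  rewrite !size_cat sX1 take_size_cat // drop_size_cat //.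
  have e1 : R ++ C ++ B ++ X1 = (R ++ C ++ B) ++ X1 by rewrite -!catA.
  have e2 : size R + (size C + size B) = size (R ++ C ++ B) by rewrite !size_cat.
  rewrite e2 e1 take_size_cat // drop_size_cat // -!catA.
  by apply=> //; rewrite ?size_cat; lia.
apply: rst_trans (toM a _) _; first lia.
apply: rst_sym; apply: rst_trans (toM a' _) _; first lia.
apply: (@slides_ctx [::]); apply: (slidable_row pZ).
- by move: pX; rewrite pairwise_cat => /and3P[].
- by move: ZX; rewrite allrel_catr => /andP[].
- by [].
- by [].
- lia.
- lia.
Qed.

End Slides.

(** * Knuth equivalence and row insertion *)

Variant knuth_step : seq nat -> seq nat -> Prop :=
| Kn1 p q x y z of x < y & y < z :
    knuth_step (p ++ [:: y; x; z] ++ q) (p ++ [:: y; z; x] ++ q)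
| Kn2 p q x y z of x < y & y < z :
    knuth_step (p ++ [:: x; z; y] ++ q) (p ++ [:: z; x; y] ++ q).

Definition knuth : seq nat -> seq nat -> Prop := clos_refl_sym_trans _ knuth_step.

Lemma knuth_step_ctx p q u v : knuth_step u v -> knuth_step (p ++ u ++ q) (p ++ v ++ q).
Proof.
case=> p' q' x y z xy yz; rewrite -!(catA p') -!(catA _ q' q) !(catA p p').
  exact: Kn1.
exact: Kn2.
Qed.

Lemma knuth_ctx p q u v : knuth u v -> knuth (p ++ u ++ q) (p ++ v ++ q).
Proof.
apply: (@rst_map _ _ (fun u => p ++ u ++ q)) => a b ab.
by apply: rst_step; exact: knuth_step_ctx.
Qed.

Lemma knuth_step_perm u v : knuth_step u v -> perm_eq u v.
Proof.
by case=> p q x y z _ _; rewrite perm_cat2l perm_cat2r; apply/seq.permP => a /=; lia.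
Qed.

Lemma knuth_perm u v : knuth u v -> perm_eq u v.
Proof.
elim=> {u v} [u v /knuth_step_perm //|//|u v _|u v w _ uv _ vw].
  by rewrite perm_sym.
exact: perm_trans uv vw.
Qed.

(** Knuth moves permute the letters, so distinctness holds all along a chain, backward steps
    included, and a claim on words with distinct letters can be checked on single moves. *)
Lemma knuth_uniq_ind (Q : seq nat -> seq nat -> Prop) :
  (forall u, Q u u) -> (forall u v, Q u v -> Q v u) ->
  (forall u v w, Q u v -> Q v w -> Q u w) ->
  (forall u v, uniq u -> knuth_step u v -> Q u v) ->
  forall u v, uniq u -> knuth u v -> Q u v.
Proof.
move=> Qr Qs Qt Qk u v uu uv; elim: uv uu => {u v} [u v /Qk H /H //|u _|u v uv IH|].
- exact: Qr.
- by rewrite -(perm_uniq (knuth_perm uv)) => /IH; exact: Qs.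
- move=> u v w uv IH1 _ IH2 uu; apply: Qt (IH1 uu) _; apply: IH2.
  by rewrite -(perm_uniq (knuth_perm uv)).
Qed.

(** * Insertion of a word into one row *)

Definition row_ins (R : seq nat) (x : nat) : seq nat := set_nth 0 R (find (ltn x) R) x.

(** A list of at most one letter, so that the word passed on to the next row is a plain
    concatenation, whether or not a letter is bumped. *)
Definition bump (R : seq nat) (x : nat) : seq nat := take 1 (drop (find (ltn x) R) R).

Definition row_word : seq nat -> seq nat -> seq nat := foldl row_ins.

Fixpoint row_bumped (R w : seq nat) : seq nat :=
  if w is x :: w' then bump R x ++ row_bumped (row_ins R x) w' else [::].

Definition tab_ins (P : tableau) (x : nat) : tableau := (row_insert P x).1.

Definition tab (w : seq nat) : tableau := foldl tab_ins [::] w.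

Lemma RSK_tab w : (RSK w).1 = tab w.
Proof.
elim/last_ind: w => // w x IH; rewrite /tab /RSK !foldl_rcons -/(tab w) -/(RSK w).
by rewrite /RSK_step /tab_ins IH; case: row_insert.
Qed.

Lemma row_word_cat R u v : row_word R (u ++ v) = row_word (row_word R u) v.
Proof. exact: foldl_cat. Qed.

Lemma row_bumped_cat R u v : row_bumped R (u ++ v) = row_bumped R u ++ row_bumped (row_word R u) v.
Proof. by elim: u R => //= x u IH R; rewrite IH catA. Qed.

Lemma row_split R x : sorted ltn R -> x \notin R ->
  exists A B, [/\ R = A ++ B, all (ltn^~ x) A, all (ltn x) B, sorted ltn A & sorted ltn B].
Proof.
rewrite !(sorted_pairwise ltn_trans).
elim: R => [|y R IH] /=; first by exists [::], [::].
move=> /andP[yR sR]; rewrite inE negb_or => /andP[xy xR].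
have [A [B [eR Ax xB sA sB]]] := IH sR xR.
move: yR; rewrite eR all_cat => /andP[yA yB]; case: (ltnP x y) => [lt_xy|le_yx].
  exists [::], (y :: A ++ B); split=> //=; rewrite ?lt_xy ?all_cat ?xB /=.
    by rewrite andbT; apply: sub_all yA => z; exact: ltn_trans.
  rewrite path_min_sorted ?all_cat ?yA // (sorted_pairwise ltn_trans) pairwise_cat.
  move: sA sB; rewrite !(sorted_pairwise ltn_trans) => -> ->; rewrite !andbT.
  by apply/allrelP => a b /(allP Ax) /= ax /(allP xB); exact: ltn_trans.
exists (y :: A), B; split=> //=; first by rewrite Ax andbT; lia.
by rewrite path_min_sorted.
Qed.

Lemma find_ltn_cat A B x : all (ltn^~ x) A -> all (ltn x) B ->
  find (ltn x) (A ++ B) = size A.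
Proof.
move=> Ax xB; rewrite find_cat ifF; last first.
  by apply/hasP => -[a /(allP Ax) /=]; lia.
by case: B xB => [|b B] /=; [rewrite addn0 | case/andP => ->; rewrite addn0].
Qed.

Lemma row_ins_cat A B x : all (ltn^~ x) A -> all (ltn x) B ->
  row_ins (A ++ B) x = A ++ x :: behead B.
Proof.
move=> Ax xB; rewrite /row_ins find_ltn_cat //; elim: A {Ax} => //= [|a A ->] //.
by case: B {xB}.
Qed.

Lemma bump_cat A B x : all (ltn^~ x) A -> all (ltn x) B -> bump (A ++ B) x = take 1 B.
Proof. by move=> Ax xB; rewrite /bump find_ltn_cat // drop_size_cat. Qed.

Lemma row_ins_sorted R x : sorted ltn R -> x \notin R -> sorted ltn (row_ins R x).
Proof.
move=> sR xR; have [A [B [-> Ax xB sA sB]]] := row_split sR xR.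
rewrite row_ins_cat //; move: sA sB; rewrite !(sorted_pairwise ltn_trans) => sA sB.
have [xB' sB'] : all (ltn x) (behead B) /\ pairwise ltn (behead B).
  by case: B xB sB => //= b B /andP[_ ->] /andP[_ ->].
rewrite pairwise_cat /= sA sB' xB' !andbT; apply/allrelP => a b /(allP Ax) /= ax.
by rewrite inE => /orP[/eqP->//|/(allP xB')]; exact: ltn_trans.
Qed.

Lemma row_ins_perm R x : perm_eq (row_ins R x ++ bump R x) (x :: R).
Proof.
rewrite /row_ins /bump; elim: R => [|y R IH] //=; case: ifP => _ /=.
  by rewrite take0 cats1; apply/seq.permP => a /=; rewrite -cats1 count_cat /=; lia.
move: IH; set c := find _ _ => /seq.permP IH; apply/seq.permP => a /=.
by move: (IH a) => /= ->; lia.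
Qed.

Lemma row_perm R w : perm_eq (row_word R w ++ row_bumped R w) (R ++ w).
Proof.
elim: w R => //= x w IH R.
rewrite perm_catCA (permPl (_ : perm_eq _ (bump R x ++ row_ins R x ++ w))); last first.
  by rewrite perm_cat2l.
by rewrite catA perm_sym -cat_rcons perm_cat2r perm_rcons perm_sym perm_catC row_ins_perm.
Qed.

Lemma row_uniq R w : uniq (R ++ w) -> uniq (row_word R w ++ row_bumped R w).
Proof. by rewrite (perm_uniq (row_perm R w)). Qed.

Lemma row_word_sorted R w : sorted ltn R -> uniq (R ++ w) -> sorted ltn (row_word R w).
Proof.
elim/last_ind: w => // w x IH sR; rewrite -rcons_cat rcons_uniq => /andP[xw uw].
rewrite /row_word foldl_rcons; apply: row_ins_sorted; first exact: IH.
apply: contra xw => xw; rewrite -(perm_mem (row_perm R w)) mem_cat.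
by rewrite xw.
Qed.

Definition insb (R : seq nat) (x : nat) := (row_ins R x, bump R x).

Lemma insb_cat A B x : all (ltn^~ x) A -> all (ltn x) B ->
  insb (A ++ B) x = (A ++ x :: behead B, take 1 B).
Proof. by move=> Ax xB; rewrite /insb row_ins_cat ?bump_cat. Qed.

Lemma insb3 R R1 R2 R3 x1 x2 x3 b1 b2 b3 :
  insb R x1 = (R1, b1) -> insb R1 x2 = (R2, b2) -> insb R2 x3 = (R3, b3) ->
  row_word R [:: x1; x2; x3] = R3 /\ row_bumped R [:: x1; x2; x3] = b1 ++ b2 ++ b3.
Proof. by move=> [<- <-] [<- <-] [<- <-]; rewrite /= cats0. Qed.

Ltac leq_lia :=
  repeat match goal with H : ?P |- _ =>
    lazymatch P with
    | is_true (leq _ _) => fail | is_true (ltn _ _) => fail | nat => fail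
    | _ => clear H end end; lia.

Ltac all_lia := rewrite /= ?all_cat /= ?all_cat /=;
  repeat match goal with |- is_true (_ && _) => apply/andP; split end;
  try (match goal with
    | H : is_true (all _ ?A) |- is_true (all _ ?A) =>
        solve [exact: H | apply: (sub_all _ H) => ? /=; leq_lia]
    | |- is_true (leq _ _) => leq_lia end).

(** Once [y] is in the row, [x] acts weakly to its left and [z] to its right, so these two
    insertions commute. If all three letters bump, the bumped words are [b a c] and [b c a] with
    [a <= y < b < c], again a move of the first kind; otherwise they coincide. *)
Lemma knuth_step_row1 R x y z : sorted ltn R -> x < y -> y < z ->
  x \notin R -> y \notin R -> z \notin R ->
  row_word R [:: y; x; z] = row_word R [:: y; z; x] /\
  (row_bumped R [:: y; x; z] = row_bumped R [:: y; z; x] \/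
   knuth_step (row_bumped R [:: y; x; z]) (row_bumped R [:: y; z; x])).
Proof.
move=> sR xy yz xR yR zR.
have [A [B [eR Ay yB sA sB]]] := row_split sR yR.
have xA : x \notin A by apply: contra xR; rewrite eR mem_cat => ->.
have [A0 [A1 [eA A0x xA1 _ _]]] := row_split sA xA.
have sB' : sorted ltn (behead B) by case: (B) sB => //= b B' /path_sorted.
have zB : z \notin behead B.
  by apply: contra zR => /mem_behead zB; rewrite eR mem_cat zB orbT.
have [B1 [B2 [eB B1z zB2 _ _]]] := row_split sB' zB.
have yB' : all (ltn y) (B1 ++ B2).
  by rewrite -eB; case: (B) yB => //= b B' /andP[].
(* The letter bumped by [x]: the first old letter between [x] and [y], or [y] itself when there is
   none. *)
have [a [A' [eA1 xa ay A'z xA']]] : exists a A', [/\ A1 ++ [:: y] = a :: A',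
    x < a, a <= y, all (ltn^~ z) A' & all (ltn x) A'].
  move: Ay; rewrite eA all_cat => /andP[_]; clear eA.
  case: A1 xA1 => [|a A1] /=; first by exists y, [::].
  move=> /andP[xa xA1] /andP[ay A1y]; exists a, (A1 ++ [:: y]).
  by split=> //; all_lia.
move: yB'; rewrite all_cat => /andP[yB1 yB2].
have yB2' : all (ltn y) (behead B2) by case: (B2) yB2 => //= b B2' /andP[].
have s1 : insb R y = (A0 ++ (a :: A') ++ B1 ++ B2, take 1 B).
  by rewrite eR insb_cat // eB eA -eA1 -?catA.
have s2 : insb (A0 ++ (a :: A') ++ B1 ++ B2) x = (A0 ++ x :: A' ++ B1 ++ B2, [:: a]).
  by rewrite insb_cat //= ?take0 //; all_lia.
have s3 : insb (A0 ++ x :: A' ++ B1 ++ B2) z =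
    (A0 ++ x :: A' ++ B1 ++ z :: behead B2, take 1 B2).
  have -> : A0 ++ x :: A' ++ B1 ++ B2 = (A0 ++ x :: A' ++ B1) ++ B2.
    by rewrite -?catA /= -?catA.
  by rewrite insb_cat //; [rewrite -?catA /= -?catA | all_lia].
have t2 : insb (A0 ++ (a :: A') ++ B1 ++ B2) z =
    (A0 ++ (a :: A') ++ B1 ++ z :: behead B2, take 1 B2).
  have -> : A0 ++ (a :: A') ++ B1 ++ B2 = (A0 ++ (a :: A') ++ B1) ++ B2.
    by rewrite -?catA /= -?catA.
  by rewrite insb_cat //; [rewrite -?catA /= -?catA | all_lia].
have t3 : insb (A0 ++ (a :: A') ++ B1 ++ z :: behead B2) x =
    (A0 ++ x :: A' ++ B1 ++ z :: behead B2, [:: a]).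
  by rewrite insb_cat //= ?take0 //; all_lia.
have [-> ->] := insb3 s1 s2 s3; have [-> ->] := insb3 s1 t2 t3.
split=> //; case: B yB eB sB {eR sB' zB s1} => [|b B] /=.
  by move=> _ + _; case: (B1) => //= <-; left.
case/andP=> yb _ eB bB; rewrite take0.
case: B2 zB2 eB {yB2 yB2' s2 s3 t2 t3} => [|c B2] /=; first by left.
rewrite take0 => _ eB.
have bc : b < c.
  move: bB; rewrite eB (path_sortedE ltn_trans) all_cat /=.
  by case/andP=> /and3P[].
by right; apply: (@Kn1 [::] [::] a b c) => //; exact: leq_ltn_trans ay yb.
Qed.

(** The case distinction is whether the row has letters between [x] and [z]. If it has none, both
    compete for the same place, and a move of the second kind can become one of the first kind in
    the opposite direction, whence the third alternative. If it has some, [x] bumps [a], [y] bumps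
    [e] and [z] bumps [c], if anything, in either order of insertion, with [a < e < c]: the kind is
    kept. *)
Lemma knuth_step_row2 R x y z : sorted ltn R -> x < y -> y < z ->
  x \notin R -> y \notin R -> z \notin R ->
  row_word R [:: x; z; y] = row_word R [:: z; x; y] /\
  (row_bumped R [:: x; z; y] = row_bumped R [:: z; x; y] \/
   knuth_step (row_bumped R [:: x; z; y]) (row_bumped R [:: z; x; y]) \/
   knuth_step (row_bumped R [:: z; x; y]) (row_bumped R [:: x; z; y])).
Proof.
move=> sR xy yz xR yR zR.
have [A [B [eR Ax xB sA sB]]] := row_split sR xR.
have zB : z \notin B by apply: contra zR; rewrite eR mem_cat => ->; rewrite orbT.
have [D [C [eB Dz zC sD sC]]] := row_split sB zB; subst B R.
have zC' : all (ltn z) (behead C) by case: (C) zC => //= c C' /andP[].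
move: xB; rewrite all_cat => /andP[xD xC].
have t1 : insb (A ++ D ++ C) z = (A ++ D ++ z :: behead C, take 1 C).
  by rewrite catA insb_cat //; [rewrite -catA | all_lia].
case: D Dz xD sD xR yR zR zB sR sB t1 => [|a D] /= Dz xD sD xR yR zR _ _ _ t1.
  have s1 : insb (A ++ C) x = (A ++ x :: behead C, take 1 C) by rewrite insb_cat.
  have s2 : insb (A ++ x :: behead C) z =
      (A ++ x :: z :: behead (behead C), take 1 (behead C)).
    have -> : A ++ x :: behead C = (A ++ [:: x]) ++ behead C by rewrite -catA.
    by rewrite insb_cat //; [rewrite -catA | all_lia].
  have s3 : insb (A ++ x :: z :: behead (behead C)) y =
      (A ++ x :: y :: behead (behead C), [:: z]).
    have -> : A ++ x :: z :: behead (behead C) = (A ++ [:: x]) ++ z :: behead (behead C).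
      by rewrite -catA.
    rewrite insb_cat //; [by rewrite /= take0 -catA | by all_lia |].
    by all_lia; case: (behead C) zC' => //= c C' /andP[_ H]; all_lia.
  have t2 : insb (A ++ z :: behead C) x = (A ++ x :: behead C, [:: z]).
    by rewrite insb_cat //= ?take0 //; all_lia.
  have t3 : insb (A ++ x :: behead C) y =
      (A ++ x :: y :: behead (behead C), take 1 (behead C)).
    have -> : A ++ x :: behead C = (A ++ [:: x]) ++ behead C by rewrite -catA.
    by rewrite insb_cat //; [rewrite -catA | all_lia | all_lia].
  have /= [-> ->] := insb3 s1 s2 s3; have /= [-> ->] := insb3 t1 t2 t3.
  split=> //; case: C sC zC {xC zC' xR yR zR t1 s1 s2 s3 t2 t3} => [|c [|c' C]] /=.
  - by left.
  - by left.
  - rewrite !take0 => /andP[cc' _] /and3P[zc _ _]; right; right.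
    exact: (@Kn1 [::] [::] z c c').
case/andP: Dz => az Dz; case/andP: xD => xa xD.
have sD' : sorted ltn D by move: sD => /path_sorted.
have yD : y \notin D.
  by apply: contra yR => yD; rewrite mem_cat inE mem_cat yD !orbT.
have [D1 [D2 [eD D1y yD2 _ _]]] := row_split sD' yD; subst D.
(* The letter bumped by [y]: the first one of [D] above [y], or the inserted [z]. *)
have [e [E [eE ae ez yE]]] : exists e E, [/\ D2 ++ [:: z] = e :: E,
    a < e, e <= z & all (ltn y) (e :: E)].
  have aD2 : all (ltn a) D2.
    by move: sD; rewrite (path_sortedE ltn_trans) all_cat => /andP[/andP[]].
  move: Dz; rewrite all_cat => /andP[_]; clear sD sD' xD yD xR yR zR t1.
  case: D2 yD2 aD2 => [|e D2] /=.
    by move=> _ _ _; exists z, [::]; rewrite /= az yz.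
  move=> /andP[ye yD2] /andP[ae aD2] /andP[ez D2z]; exists e, (D2 ++ [:: z]).
  by split=> //; all_lia.
have [Dz1 Dz2] : all (ltn^~ z) D1 /\ all (ltn^~ z) D2.
  by move: Dz; rewrite all_cat => /andP[].
have [xD1 xD2] : all (ltn x) D1 /\ all (ltn x) D2.
  by move: xD; rewrite all_cat => /andP[].
have s1 : insb (A ++ a :: (D1 ++ D2) ++ C) x = (A ++ x :: (D1 ++ D2) ++ C, [:: a]).
  by rewrite insb_cat //= ?take0 //; all_lia.
have s2 : insb (A ++ x :: (D1 ++ D2) ++ C) z =
    (A ++ x :: (D1 ++ D2) ++ z :: behead C, take 1 C).
  have -> : A ++ x :: (D1 ++ D2) ++ C = (A ++ x :: (D1 ++ D2)) ++ C.
    by rewrite -?catA /= -?catA.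
  rewrite insb_cat //; first by rewrite -?catA /= -?catA.
  by all_lia.
have eZ : A ++ x :: (D1 ++ D2) ++ z :: behead C = (A ++ x :: D1) ++ e :: E ++ behead C.
  rewrite -?catA /= -(cat1s z) (catA D2) eE.
  by rewrite -?catA.
have s3 : insb (A ++ x :: (D1 ++ D2) ++ z :: behead C) y =
    (A ++ x :: D1 ++ y :: E ++ behead C, [:: e]).
  rewrite eZ insb_cat //=; first by rewrite -catA take0.
    by all_lia.
  by case/andP: yE => ye yE; all_lia.
have t2 : insb (A ++ a :: (D1 ++ D2) ++ z :: behead C) x =
    (A ++ x :: (D1 ++ D2) ++ z :: behead C, [:: a]).
  by rewrite insb_cat //= ?take0 //; all_lia.
have /= [-> ->] := insb3 s1 s2 s3; have /= [-> ->] := insb3 t1 t2 s3.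
split=> //; case: C zC {sC zC' xC xR yR zR t1 s1 s2 s3 t2 eZ} => [|c C] /=.
  by left.
rewrite take0 => /andP[zc _]; right; left.
by apply: (@Kn2 [::] [::] a e c) => //; exact: leq_ltn_trans ez zc.
Qed.

Lemma knuth_step_row R u v : sorted ltn R -> uniq (R ++ u) -> knuth_step u v ->
  row_word R u = row_word R v /\
  (row_bumped R u = row_bumped R v \/ knuth_step (row_bumped R u) (row_bumped R v) \/
   knuth_step (row_bumped R v) (row_bumped R u)).
Proof.
move=> sR uR uv.
have notin p m q : u = p ++ m ++ q ->
    sorted ltn (row_word R p) /\ {in m, forall a, a \notin row_word R p}.
  move=> eu; move: uR; rewrite eu catA cat_uniq has_cat negb_or.
  case/and3P=> uRp /andP[/hasPn mRp _] _; split; first exact: row_word_sorted.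
  move=> a /mRp; apply: contra => aP.
  by rewrite -(perm_mem (row_perm R p)) mem_cat aP.
suff [p [q [m [m' [eu ev H]]]]] : exists p q m m',
    [/\ u = p ++ m ++ q, v = p ++ m' ++ q &
     row_word (row_word R p) m = row_word (row_word R p) m' /\
     (row_bumped (row_word R p) m = row_bumped (row_word R p) m' \/
      knuth_step (row_bumped (row_word R p) m) (row_bumped (row_word R p) m') \/
      knuth_step (row_bumped (row_word R p) m') (row_bumped (row_word R p) m))].
  case: H => eP H; rewrite eu ev !row_word_cat !row_bumped_cat eP; split=> //.
  case: H => [->|[H|H]]; [by left|right; left|right; right]; exact: knuth_step_ctx.
case: uv notin => p q x y z xy yz /(_ _ _ _ erefl) [sRp Hm];
  exists p, q; do 2 eexists; split; try reflexivity.
  have [|||-> H] := knuth_step_row1 sRp xy yz; rewrite ?Hm ?inE ?eqxx ?orbT //.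
  by split=> //; case: H => ?; [left | right; left].
by apply: knuth_step_row2 => //; rewrite Hm ?inE ?eqxx ?orbT.
Qed.

Lemma rcons_set_nth (T : Type) (x0 : T) s x : set_nth x0 s (size s) x = rcons s x.
Proof. by elim: s => //= y s ->. Qed.

Lemma tab_ins_cons R P x :
  tab_ins (R :: P) x = row_ins R x :: foldl tab_ins P (bump R x).
Proof.
rewrite /tab_ins /= /row_ins /bump; set c := find _ _; have [->|nc] := eqVneq c (size R).
  by rewrite rcons_set_nth drop_size.
have cR : c < size R by rewrite ltn_neqAle nc find_size.
rewrite (drop_nth 0 cR) /= take0 /=.
by case: row_insert.
Qed.

Lemma tab_ins_word_cons R P w :
  foldl tab_ins (R :: P) w = row_word R w :: foldl tab_ins P (row_bumped R w).
Proof. by elim: w R P => //= x w IH R P; rewrite tab_ins_cons IH -foldl_cat. Qed.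

Lemma tab_rec x w : tab (x :: w) = row_word [::] (x :: w) :: tab (row_bumped [::] (x :: w)).
Proof. exact: (tab_ins_word_cons [:: x] [::] w). Qed.

Lemma size_row_bumped x w : size (row_bumped [::] (x :: w)) <= size w.
Proof.
have := perm_size (row_perm [::] (x :: w)); rewrite !size_cat add0n.
suff : 0 < size (row_word [::] (x :: w)) by rewrite /=; lia.
suff H R : 0 < size R -> 0 < size (row_word R w) by exact: (H [:: x]).
by elim: w R => //= y w IH R sR; apply: IH; rewrite /row_ins size_set_nth; lia.
Qed.

(** Both words leave the same first row and pass on words that are equal or one Knuth move apart.
    The induction is on length: at least one letter stays in the first row. *)
Lemma knuth_step_tab u v : uniq u -> knuth_step u v -> tab u = tab v.
Proof.
have [m] := ubnP (size u); elim: m u v => // m IH u v; rewrite ltnS => su uu uv.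
have [eP eB] := knuth_step_row (R := [::]) isT uu uv.
have suv := perm_size (knuth_step_perm uv).
case: u v uu uv su suv eP eB => [|x u] [|y v] // uu uv su suv eP eB.
rewrite !tab_rec eP; congr cons.
have uB : uniq (row_bumped [::] (x :: u)).
  by have := row_uniq (R := [::]) uu; rewrite cat_uniq => /and3P[].
have sx := size_row_bumped x u.
case: eB => [->//|[H|H]]; first by apply: IH H => //; move: su sx => /=; lia.
have := knuth_step_perm H => pB; apply/esym; apply: IH H; last by rewrite (perm_uniq pB).
by rewrite (perm_size pB); move: su sx => /=; lia.
Qed.

Lemma knuth_tab u v : uniq u -> knuth u v -> tab u = tab v.
Proof.
apply: (knuth_uniq_ind (Q := fun u v => tab u = tab v)) => //.
- by move=> a b c -> ->.
- exact: knuth_step_tab.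
Qed.

(** * Tableaux under insertion, and their reading words *)

Definition dominates (R1 R2 : seq nat) : bool :=
  (size R2 <= size R1) && all (fun c => nth 0 R1 c < nth 0 R2 c) (iota 0 (size R2)).

(** The row and column conditions of [is_syt], with no condition on the set of entries, in a form
    suited to recursion on rows; [is_sytE] relates the two. *)
Fixpoint is_tab (P : tableau) : bool :=
  if P is R :: P' then
    [&& R != [::], sorted ltn R, dominates R (head [::] P') & is_tab P']
  else true.

Lemma dominatesP R1 R2 : reflect (forall c, c < size R2 -> c < size R1 /\ nth 0 R1 c < nth 0 R2 c)
  (dominates R1 R2).
Proof.
apply: (iffP andP) => [[s12 /allP H] c cR2|H].
  by split; [lia|apply: H; rewrite mem_iota].
split; last by apply/allP => c; rewrite mem_iota => /H[].
by case e: (size R2) => [//|m]; have [] := H m; lia.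
Qed.

(** The letter [y] leaves column [c1] of the lower row, and the entry above that column, if any,
    exceeds [y]. So [y] lands in a column [c2 <= c1], above [x] or an entry to the left of it. *)
Lemma dominates_row_ins R1 R2 x y : dominates R1 R2 -> bump R1 x = [:: y] ->
  dominates (row_ins R1 x) (row_ins R2 y).
Proof.
move=> /dominatesP D; rewrite /bump /row_ins.
set c1 := find (ltn x) R1; set c2 := find (ltn y) R2.
have [c1R|Rc1] := ltnP c1 (size R1); last by rewrite drop_oversize.
rewrite (drop_nth 0 c1R) /= take0 => -[ey].
have xy : x < y by rewrite -ey; apply: (@nth_find _ 0 (ltn x)); rewrite has_find.
have c2R : c2 <= size R2 := find_size _ _.
have c21 : c2 <= c1.
  rewrite leqNgt; apply/negP => c12.
  have := before_find 0 c12; rewrite -ey /= => /negP; apply.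
  have [] // := D c1; apply: leq_trans c12 _; exact: find_size.
have before i : i < c1 -> nth 0 R1 i < y.
  by move=> /(before_find 0) /=; lia.
apply/dominatesP => i; rewrite !size_set_nth => ic.
split.
  by move: ic; rewrite !leq_max => /orP[|/D[]]; lia.
rewrite !nth_set_nth /=; case: (eqVneq i c1) => [e1|ni1]; case: (eqVneq i c2) => [e2|ni2].
- by [].
- have [_] : c1 < size R1 /\ nth 0 R1 c1 < nth 0 R2 c1 by apply: D; lia.
  by rewrite e1; lia.
- by apply: before; lia.
- have [//] : i < size R1 /\ nth 0 R1 i < nth 0 R2 i by apply: D; lia.
Qed.

Lemma head_tab_ins P x : head [::] (tab_ins P x) = row_ins (head [::] P) x.
Proof. by case: P => [|R P] //; rewrite tab_ins_cons. Qed.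

Lemma is_tab_ins P x : is_tab P -> x \notin flatten P -> uniq (flatten P) ->
  is_tab (tab_ins P x).
Proof.
elim: P x => [|R P IH] x //= /and4P[R0 sR dR tP].
rewrite mem_cat negb_or cat_uniq => /andP[xR xP] /and3P[uR RP uP].
rewrite tab_ins_cons /= (row_ins_sorted sR xR).
have -> /= : row_ins R x != [::].
  by rewrite -size_eq0 /row_ins size_set_nth; lia.
have bR : {subset bump R x <= R}.
  by move=> a; rewrite /bump => /mem_take /mem_drop.
have [e|[y e]] : bump R x = [::] \/ exists y, bump R x = [:: y].
- rewrite /bump; case: (drop _ _) => [|y s]; first by left.
  by right; exists y; rewrite /= take0.
- rewrite e /= tP andbT.
  have -> : row_ins R x = rcons R x.
    rewrite /row_ins.
    suff -> : find (ltn x) R = size R by rewrite rcons_set_nth.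
    apply/eqP; rewrite eqn_leq find_size /= -subn_eq0 -size_drop.
    by move: e; rewrite /bump; case: (drop _ _).
  apply/dominatesP => c /(dominatesP _ _ dR) [cR lt]; rewrite size_rcons nth_rcons cR.
  by split; first lia.
- rewrite e /= head_tab_ins (dominates_row_ins dR e) IH //.
  apply: contra RP => yP; apply/hasP; exists y => //.
  by apply: bR; rewrite e inE.
Qed.

Lemma tab_ins_perm P x : perm_eq (flatten (tab_ins P x)) (x :: flatten P).
Proof.
elim: P x => [|R P IH] x //; rewrite tab_ins_cons /=.
have H : perm_eq (flatten (foldl tab_ins P (bump R x))) (bump R x ++ flatten P).
  rewrite /bump; case: (drop _ _) => [|y s] //=; rewrite take0 /=; exact: IH.
apply: perm_trans (_ : perm_eq _ (row_ins R x ++ bump R x ++ flatten P)) _.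
  by rewrite perm_cat2l.
by rewrite catA -cat_cons perm_cat2r row_ins_perm.
Qed.

Lemma tab_rcons w x : tab (rcons w x) = tab_ins (tab w) x.
Proof. exact: foldl_rcons. Qed.

Lemma tab_perm w : perm_eq (flatten (tab w)) w.
Proof.
elim/last_ind: w => // w x IH; rewrite tab_rcons (permPl (tab_ins_perm _ _)).
by rewrite perm_sym perm_rcons perm_cons perm_sym.
Qed.

Lemma is_tab_tab w : uniq w -> is_tab (tab w).
Proof.
elim/last_ind: w => // w x IH; rewrite rcons_uniq => /andP[xw uw].
rewrite tab_rcons; apply: is_tab_ins; first exact: IH.
  by rewrite (perm_mem (tab_perm w)).
by rewrite (perm_uniq (tab_perm w)).
Qed.

Lemma rw_cons R P : rw (R :: P) = rw P ++ R.
Proof. by rewrite /rw rev_cons -cats1 flatten_cat /= cats0. Qed.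

Lemma rw_perm P : perm_eq (rw P) (flatten P).
Proof. by elim: P => // R P IH; rewrite rw_cons perm_catC perm_cat2l. Qed.

(** The prefix [A] collects the letters already inserted. The next letter of [R1] exceeds them all
    and is smaller than the first remaining letter of [R2], so it replaces exactly that one, or is
    appended when none remains. *)
Lemma insert_row A R1 R2 : allrel ltn A R1 -> sorted ltn R1 -> dominates R1 R2 ->
  row_word (A ++ R2) R1 = A ++ R1 /\ row_bumped (A ++ R2) R1 = R2.
Proof.
elim: R1 A R2 => [|x R1 IH] A R2 Ax sR1 D.
  by case: R2 D => //= y R2 /andP[].
move: Ax; rewrite allrel_consr => /andP[Ax AR1].
have D' : dominates R1 (behead R2).
  apply/dominatesP => c; rewrite size_behead nth_behead => cR2.
  by have [|] := dominatesP _ _ D c.+1; [lia|].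
have [fx eR2] : find (ltn x) (A ++ R2) = size A /\ take 1 R2 ++ behead R2 = R2.
  rewrite find_cat ifF; last by apply/hasP => -[a /(allP Ax) /=]; lia.
  case: R2 D {D'} => [|y R2] D /=; first by rewrite addn0.
  by have [//|_ /= ->] := dominatesP _ _ D 0; rewrite addn0 take0.
have er : row_ins (A ++ R2) x = (rcons A x) ++ behead R2.
  rewrite /row_ins fx cat_rcons; elim: (A) => [|a A' IHA] /=; last by rewrite IHA.
  by case: (R2).
have eb : bump (A ++ R2) x = take 1 R2 by rewrite /bump fx drop_size_cat.
have [||| eP eB] := IH (rcons A x) (behead R2) => //.
- rewrite -cats1 allrel_catl AR1 allrel_consl /= andbT.
  by move: sR1; rewrite /= (path_sortedE ltn_trans) => /andP[].
- exact: path_sorted sR1.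
by rewrite /= er eb eP eB -cat_rcons.
Qed.

Lemma tab_ins_word_row P R : is_tab (R :: P) -> foldl tab_ins P R = R :: P.
Proof.
elim: P R => [|R2 P IH] R /and4P[R0 sR dR tP].
  case: R R0 sR dR => // x R _ sR _.
  rewrite -[LHS]/(foldl tab_ins [:: [:: x]] R) -[[:: x]]/([:: x] ++ [::]) tab_ins_word_cons.
  have [||| -> ->] // := @insert_row [:: x] R [::].
  - by move: sR; rewrite /= (path_sortedE ltn_trans) allrel_consl => /andP[-> _].
  - exact: path_sorted sR.
rewrite tab_ins_word_cons; have [||| -> ->] // := @insert_row [::] R R2.
by rewrite IH.
Qed.

Lemma tab_rw P : is_tab P -> tab (rw P) = P.
Proof.
elim: P => // R P IH tP; rewrite rw_cons /tab foldl_cat -/(tab (rw P)) IH.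
  exact: tab_ins_word_row.
by case/and4P: tP.
Qed.

Lemma knuth_move_left A y r q : sorted ltn (rcons A r) -> r < y ->
  knuth (A ++ y :: r :: q) (y :: A ++ r :: q).
Proof.
elim/last_ind: A r q => [|A a IH] r q sA ry; first exact: rst_refl.
have [sA' ar] : sorted ltn (rcons A a) /\ a < r.
  by move: sA; rewrite -cats1 cat_rcons sorted_cat_cons /= andbT => /andP.
apply: rst_trans (_ : knuth _ (A ++ y :: a :: r :: q)) _.
  by apply: rst_step; rewrite cat_rcons; apply: (@Kn2 A q a r y).
by rewrite cat_rcons; apply: IH => //; lia.
Qed.

Lemma knuth_move_right y B x q : sorted ltn (y :: B) -> x < y ->
  knuth (y :: B ++ x :: q) (y :: x :: B ++ q).
Proof.
elim/last_ind: B q => [|B b IH] q sB xy; first exact: rst_refl.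
move: sB; rewrite -rcons_cons; case/lastP e: (y :: B) => [//|s l] sB.
have lb : l < b.
  by move: sB; rewrite -!cats1 -catA sorted_cat_cons /= andbT => /andP[_].
have sB' : sorted ltn (y :: B).
  by move: sB; rewrite e -cats1; move/cat_sorted2 => [].
have xl : x < l.
  have : l \in y :: B by rewrite e mem_rcons mem_head.
  move: sB'; rewrite (sorted_pairwise ltn_trans) /= => /andP[/allP yB _].
  by rewrite inE => /orP[/eqP->//|/yB]; exact: ltn_trans.
apply: rst_trans (_ : knuth _ (y :: B ++ x :: b :: q)) _.
  rewrite cat_rcons -!cat_cons e; apply: rst_sym; apply: rst_step.
  by rewrite !cat_rcons; exact: Kn1.
by rewrite cat_rcons; exact: IH.
Qed.

(** Write the row as [A ++ y :: B]. By moves of the first kind [x] travels left across [B] up to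
    [y]; then, by moves of the second kind, [y] travels left across [A]. *)
Lemma knuth_row R x y : sorted ltn R -> x \notin R -> bump R x = [:: y] ->
  knuth (R ++ [:: x]) (y :: row_ins R x).
Proof.
move=> sR xR; have [A [B [eR Ax xB sA sB]]] := row_split sR xR.
rewrite eR bump_cat // row_ins_cat //; case: B sB xB eR => // z B sB /= /andP[xz _] eR.
rewrite take0 => -[ezy]; subst z; rewrite -catA /=.
apply: rst_trans (_ : knuth _ (A ++ y :: x :: B)) _.
  have := knuth_ctx A [::] (knuth_move_right [::] sB xz).
  by rewrite !cats0.
apply: knuth_move_left => //; move: sA; rewrite !(sorted_pairwise ltn_trans).
by rewrite pairwise_rcons Ax.
Qed.

Lemma knuth_tab_ins P x : is_tab P -> uniq (flatten P) -> x \notin flatten P ->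
  knuth (rw P ++ [:: x]) (rw (tab_ins P x)).
Proof.
elim: P x => [|R P IH] x; first by move=> *; exact: rst_refl.
move=> /and4P[R0 sR dR tP] /=; rewrite cat_uniq => /and3P[uR RP uP].
rewrite mem_cat negb_or => /andP[xR xP].
rewrite tab_ins_cons !rw_cons -catA.
case e: (bump R x) => [|y s].
  have -> : row_ins R x = rcons R x.
    have [A [B [eR Ax xB sA sB]]] := row_split sR xR.
    rewrite eR row_ins_cat //; move: e; rewrite eR bump_cat //; case: B {sB xB eR} => //= _.
    by rewrite cats0 cats1.
  by rewrite cats1; exact: rst_refl.
have es : s = [::].
  by move: e; rewrite /bump; case: (drop _ _) => //= a t; rewrite take0 => -[].
subst s; apply: rst_trans (_ : knuth _ (rw P ++ (y :: row_ins R x))) _.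
  by have := knuth_ctx (rw P) [::] (knuth_row sR xR e); rewrite !cats0.
rewrite -cat_rcons -cats1; apply: (@knuth_ctx [::]) => /=; apply: IH => //.
apply: contra RP => yP; apply/hasP; exists y => //=.
by have : y \in bump R x by [rewrite e mem_head|]; move=> /mem_take /mem_drop.
Qed.

Lemma knuth_tab_rw w : uniq w -> knuth w (rw (tab w)).
Proof.
elim/last_ind: w => [|w x IH]; first by move=> _; exact: rst_refl.
rewrite rcons_uniq => /andP[xw uw]; rewrite tab_rcons.
apply: rst_trans (_ : knuth _ (rw (tab w) ++ [:: x])) _.
  by rewrite -cats1; apply: (@knuth_ctx [::]); exact: IH.
apply: knuth_tab_ins; first exact: is_tab_tab.
  by rewrite (perm_uniq (tab_perm w)).
by rewrite (perm_mem (tab_perm w)).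
Qed.

(** * Recording tableaux and injectivity of RSK *)

Lemma shape_row_insert P x :
  shape (row_insert P x).1 = incr_nth (shape P) (row_insert P x).2.
Proof.
elim: P x => //= R P IH x; set c := find _ _.
case: eqVneq => [_|nc] /=; first by rewrite size_rcons.
have cR : c < size R by rewrite ltn_neqAle nc find_size.
move: (IH (nth 0 R c)); case: row_insert => P'' r /= ->.
by rewrite size_set_nth; congr cons; lia.
Qed.

Lemma RSK_rcons w x : RSK (rcons w x) =
  let: (P', r) := row_insert (tab w) x in
  (P', set_nth [::] (RSK w).2 r (rcons (nth [::] (RSK w).2 r) (size w).+1)).
Proof.
rewrite /RSK foldl_rcons -/(RSK w) /RSK_step RSK_tab.
case e: row_insert => [P' r]; congr (_, set_nth _ _ _ (rcons _ _)).
have -> : P' = tab_ins (tab w) x by rewrite /tab_ins e.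
rewrite (perm_size (rw_perm _)) (perm_size (tab_ins_perm _ _)) /=.
by rewrite (perm_size (tab_perm w)).
Qed.

Lemma incr_nth_inj v r r' : incr_nth v r = incr_nth v r' -> r = r'.
Proof.
move=> /(congr1 (fun s => nth 0 s r)); rewrite !nth_incr_nth eqxx.
by case: eqVneq => // _; lia.
Qed.

(** The recording tableau remembers only the row of each new cell, and two consecutive shapes
    determine that row. *)
Lemma RSK_Q_shape w w' : size w = size w' ->
  (forall k, shape (tab (take k w)) = shape (tab (take k w'))) ->
  (RSK w).2 = (RSK w').2.
Proof.
elim/last_ind: w w' => [|w x IH] w'; first by case: w'.
case/lastP: w' => [|w' x']; first by rewrite size_rcons.
rewrite !size_rcons => -[sw] H.
have tk k : k <= size w -> take k (rcons w x) = take k w /\ take k (rcons w' x') = take k w'.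
  move=> kw; rewrite -!cats1 !take_cat -sw; case: ltnP => // wk.
  have -> : k = size w by lia.
  by rewrite subnn take0 !cats0 take_size sw take_size.
have Hw k : shape (tab (take k w)) = shape (tab (take k w')).
  have [kw|kw] := leqP k (size w); first by have [<- <-] := tk k kw.
  rewrite !take_oversize -?sw; try exact: ltnW.
  have := H (size w); have [-> ->] := tk _ (leqnn _).
  by rewrite {2}sw !take_size.
have eQ := IH _ sw Hw.
rewrite !RSK_rcons.
have := H (size w).+1; rewrite !take_oversize ?size_rcons -?sw //.
rewrite !tab_rcons /tab_ins !shape_row_insert.
have := Hw (size w); rewrite {2}sw !take_size => ->.
case: (row_insert (tab w) x) => P r; case: (row_insert (tab w') x') => P' r' /=.
by move=> /incr_nth_inj ->; rewrite eQ sw.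
Qed.

Lemma shape_RSK w : shape (RSK w).2 = shape (tab w).
Proof.
elim/last_ind: w => // w x IH; rewrite RSK_rcons tab_rcons /tab_ins.
move: (shape_row_insert (tab w) x); case: row_insert => P r /= ->.
rewrite -IH; elim: r (RSK w).2 {IH} => [|r IHr] [|R Q] //=.
- by rewrite size_rcons.
- by congr cons; elim: (r) => //= r' ->.
- by rewrite IHr.
Qed.

Lemma RSK_Q_lt w : {in flatten (RSK w).2, forall a, a <= size w}.
Proof.
elim/last_ind: w => // w x IH a; rewrite RSK_rcons size_rcons.
case: row_insert => P r /=; elim: r (RSK w).2 IH => [|r IHr] [|R Q] IH /=.
- by rewrite inE => /eqP->.
- rewrite mem_cat mem_rcons inE -orbA => /or3P[/eqP->//|aR|aQ];
  by apply/leqW/IH; rewrite /= mem_cat ?aR ?aQ ?orbT.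
- by elim: (r) => [|r' IHr' //]; rewrite /= inE => /eqP->.
- rewrite mem_cat => /orP[aR|]; first by apply/leqW/IH; rewrite /= mem_cat aR.
  by apply: IHr => b bQ; apply: IH; rewrite /= mem_cat bQ orbT.
Qed.

(** Reverse bumping in one row. If the columns were [c < c1], then [x1] would stand in [R] to the
    right of the bumped letter although it is smaller. *)
Lemma set_row_inj R R1 x x1 : sorted ltn R -> sorted ltn R1 ->
  let c := find (ltn x) R in let c1 := find (ltn x1) R1 in
  c < size R -> c1 < size R1 -> nth 0 R c = nth 0 R1 c1 ->
  set_nth 0 R c x = set_nth 0 R1 c1 x1 -> R = R1 /\ x = x1.
Proof.
move=> sR sR1 c c1 cR cR1 ey eS.
have xy : x < nth 0 R c by apply: (@nth_find _ 0 (ltn x)); rewrite has_find.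
have xy1 : x1 < nth 0 R1 c1 by apply: (@nth_find _ 0 (ltn x1)); rewrite has_find.
have sz : size R = size R1.
  by move/(congr1 size): eS; rewrite !size_set_nth; lia.
have nS i : nth 0 (set_nth 0 R c x) i = nth 0 (set_nth 0 R1 c1 x1) i by rewrite eS.
have ecc : c = c1.
  case: (ltngtP c c1) => // lt; [have := nS c1|have := nS c];
    rewrite !nth_set_nth /= eqxx ifN; try lia.
  - have := sorted_ltn_nth ltn_trans 0 sR c c1; rewrite !inE.
    by move=> /(_ cR); rewrite sz => /(_ cR1 lt); lia.
  - have := sorted_ltn_nth ltn_trans 0 sR1 c1 c; rewrite !inE.
    by move=> /(_ cR1); rewrite -sz => /(_ cR lt); lia.
split; last by have := nS c; rewrite !nth_set_nth /= ecc eqxx.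
apply: (@eq_from_nth _ 0) => // i _; have := nS i; rewrite !nth_set_nth /= -ecc.
by case: eqVneq => [->|//]; rewrite ey ecc.
Qed.

Lemma row_insert_inj P P1 x x1 : is_tab P -> is_tab P1 ->
  row_insert P x = row_insert P1 x1 -> P = P1 /\ x = x1.
Proof.
elim: P P1 x x1 => [|R P IH] [|R1 P1] x x1 //=; first by move=> _ _ [].
- move=> _ /and4P[R0 _ _ _]; case: eqVneq => _.
    by case=> e; case: R1 R0 e => // a [].
  by case: row_insert.
- move=> /and4P[R0 _ _ _] _; case: eqVneq => _.
    by case=> e; case: R R0 e => // a [].
  by case: row_insert.
move=> /and4P[_ sR _ tP] /and4P[_ sR1 _ tP1].
case: eqVneq => c; case: eqVneq => c1.
- by case=> /rcons_inj [-> ->] ->.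
- by case: row_insert.
- by case: row_insert.
case e: row_insert => [Q r]; case e1: row_insert => [Q1 r1] [eS eQ er].
have [eP ey] := IH _ _ _ tP tP1 (etrans e (esym (etrans e1 (congr2 pair (esym eQ) (esym er))))).
have := @set_row_inj _ _ _ _ sR sR1 _ _ ey eS.
rewrite !ltn_neqAle c c1 !find_size => /(_ isT isT) [-> ->].
by rewrite eP.
Qed.

Lemma RSK_inj w w' : uniq w -> uniq w' -> RSK w = RSK w' -> w = w'.
Proof.
elim/last_ind: w w' => [|w x IH] w' uw uw' eR.
  have := perm_size (tab_perm w'); rewrite -RSK_tab -eR /=.
  by case: (w').
case/lastP: w' uw' eR => [|w' x'] uw' eR.
  have := perm_size (tab_perm (rcons w x)); rewrite -RSK_tab eR /=.
  by rewrite size_rcons.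
have sw : size w = size w'.
  have := perm_size (tab_perm (rcons w x)); rewrite -RSK_tab eR RSK_tab.
  by rewrite (perm_size (tab_perm _)) !size_rcons => -[].
move: uw uw' eR; rewrite !rcons_uniq => /andP[_ uw] /andP[_ uw'].
have eQ0 := (shape_RSK w, shape_RSK w'); have lt := (@RSK_Q_lt w, @RSK_Q_lt w').
move: eQ0 lt; have tw := is_tab_tab uw; have tw' := is_tab_tab uw'.
rewrite !RSK_rcons -sw; case: (RSK w) (RSK_tab w) (IH w' uw uw') => P Q /= ->.
case: (RSK w') (RSK_tab w') => P' Q' /= -> IHw.
case e: row_insert => [P1 r]; case e': row_insert => [P1' r'] [sQ sQ'] [ltQ ltQ'].
case=> eP eQ.
have nin s k : {in flatten s, forall a, a <= size w} -> (size w).+1 \notin nth [::] s k.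
  move=> H; apply/negP => a; have [ks|ks] := ltnP k (size s); last first.
    by rewrite nth_default in a.
  have /H : (size w).+1 \in flatten s by apply/flattenP; exists (nth [::] s k); rewrite ?mem_nth.
  by rewrite ltnn.
have nQ i : nth [::] (set_nth [::] Q r (rcons (nth [::] Q r) (size w).+1)) i =
  nth [::] (set_nth [::] Q' r' (rcons (nth [::] Q' r') (size w).+1)) i by rewrite eQ.
(* The row of the last new cell is recognised by its entry, which exceeds all earlier entries of the
   recording tableau. *)
have er : r = r'.
  have := nQ r; rewrite !nth_set_nth /= eqxx; case: eqVneq => // _ H.
  by have := nin Q' r ltQ'; rewrite -H mem_rcons mem_head.
have [eT ex] : tab w = tab w' /\ x = x'.
  by apply: row_insert_inj => //; rewrite e e' eP er.
rewrite ex IHw //; congr pair => //; apply: (@eq_from_nth _ [::]).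
  by rewrite -(size_map size Q) -(size_map size Q') -/(shape _) -/(shape _) sQ sQ' eT.
move=> i _; have := nQ i; rewrite !nth_set_nth /= -er; case: eqVneq => [->|//].
by case/rcons_inj.
Qed.

(** * Restricted dual equivalence on words *)

Definition d_word (i : nat) (w : seq nat) : seq nat := map (d_val i w) w.

Definition dR_word (i : nat) (w : seq nat) : seq nat :=
  if inv_des w i.+1 && inv_des (d_word i w) i.+1 then w else d_word i w.

Lemma index_at (T : eqType) (p q : seq T) x :
  uniq (p ++ x :: q) -> index x (p ++ x :: q) = size p.
Proof.
rewrite cat_uniq /= negb_or => /and3P[_ /andP[xp _] _].
by rewrite index_cat (negPf xp) /= eqxx addn0.
Qed.

Lemma index_transpose (p : seq nat) x z q a b : uniq (p ++ x :: z :: q) ->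
  (a, b) != (x, z) -> (a, b) != (z, x) ->
  (index a (p ++ x :: z :: q) < index b (p ++ x :: z :: q)) =
  (index a (p ++ z :: x :: q) < index b (p ++ z :: x :: q)).
Proof.
rewrite cat_uniq /= inE => /and3P[_ _ /andP[]]; rewrite negb_or => /andP[xz _] _.
rewrite !xpair_eqE !index_cat /=.
case: (boolP (a \in p)) => [|_]; case: (boolP (b \in p)) => [|_]; rewrite -?index_mem => //.
- by move=> ia _ _; rewrite !(leq_trans ia (leq_addr _ _)).
- by move=> ib _ _; rewrite !ltnNge !(leq_trans (ltnW ib) (leq_addr _ _)).
rewrite !ltn_add2l (eq_sym x a) (eq_sym x b) (eq_sym z a) (eq_sym z b).
case: (eqVneq a x) => [->|ax]; case: (eqVneq b x) => [->|bx];
  rewrite ?(negPf xz) //=; case: eqVneq => [az|az] //=; case: eqVneq => [bz|bz] //=.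
Qed.

Definition same_order (u v : seq nat) (a b : nat) : Prop :=
  (index a u < index b u) = (index a v < index b v).

(** A Knuth move reverses a single pair [x], [z], and the third letter has a value strictly between
    them. Hence no two consecutive values are reversed, which makes inverse descents Knuth
    invariant. *)
Lemma knuth_step_index u v : uniq u -> knuth_step u v -> exists x z, x.+1 < z /\
  forall a b, (a, b) != (x, z) -> (a, b) != (z, x) -> same_order u v a b.
Proof.
move=> uu uv; case: uv uu => p q x y z xy yz uu; exists x, z; split; try lia.
  move: uu; rewrite -!(cat_rcons y) => uu a b H1 H2.
  exact: index_transpose.
by move=> a b H1 H2; apply: index_transpose.
Qed.

Lemma knuth_inv_des u v i : uniq u -> knuth u v -> inv_des u i = inv_des v i.
Proof.
apply: (knuth_uniq_ind (Q := fun u v => inv_des u i = inv_des v i)) => //.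
- by move=> ? ? ? -> ->.
- move=> {}u {}v uu uv; have [x [z [xz H]]] := knuth_step_index uu uv.
  by apply: H; apply/eqP => -[]; lia.
Qed.

Lemma swapK a b : involutive (swap a b).
Proof.
move=> v; rewrite /swap; case: (eqVneq v a) => [->|va].
  by case: (eqVneq b a) => [->|]; rewrite ?eqxx.
case: (eqVneq v b) => [->|vb]; first by rewrite eqxx.
by rewrite (negPf va) (negPf vb).
Qed.

Lemma swap_lt a x y : x < y -> (x, y) != (a, a.+1) -> swap a a.+1 x < swap a a.+1 y.
Proof. by rewrite xpair_eqE /swap; repeat case: ifP => /eqP ?; lia. Qed.

Lemma betweenC w a b c : between w a b c = between w c b a.
Proof. by rewrite /between orbC. Qed.

Lemma adjacent_between p a b q c : uniq (p ++ a :: b :: q) ->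
  between (p ++ a :: b :: q) a c b = false.
Proof.
move=> uw; rewrite /between (index_at uw); move: uw.
by rewrite -cat_rcons => uw; rewrite (index_at uw) size_rcons; lia.
Qed.

(** Exchanging the values [a] and [a+1] could spoil the move only if both take part in it. They
    would then be adjacent letters of [u] or of [v], with no room for [c]. *)
Lemma knuth_step_swap u v a c : uniq u -> knuth_step u v ->
  between u a c a.+1 -> between v a c a.+1 ->
  knuth_step (map (swap a a.+1) u) (map (swap a a.+1) v).
Proof.
move=> uu uv; have uv' := uu; rewrite (perm_uniq (knuth_step_perm uv)) in uv'.
case: uv uu uv' => p q x y z xy yz uu uv bu bv; rewrite !map_cat /=.
- apply: Kn1; apply: swap_lt => //; apply/eqP => -[e1 e2]; subst.
    by move: bu; rewrite betweenC /= adjacent_between.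
  by move: bv; rewrite /= adjacent_between.
- apply: Kn2; apply: swap_lt => //; apply/eqP => -[e1 e2]; subst.
    by move: bv; rewrite /= -(cat_rcons z) adjacent_between // cat_rcons.
  by move: bu; rewrite betweenC /= -(cat_rcons x) adjacent_between // cat_rcons.
Qed.

Lemma d_val_order i u v :
  (forall a b, i.-1 <= a <= i.+1 -> i.-1 <= b <= i.+1 -> same_order u v a b) ->
  d_val i u = d_val i v.
Proof. by move=> H; rewrite /d_val /between !H //; lia. Qed.

Variant d_val_spec (i : nat) (w : seq nat) : (nat -> nat) -> Type :=
| DUp of between w i i.-1 i.+1 : d_val_spec i w (swap i i.+1)
| DDown of between w i i.+1 i.-1 : d_val_spec i w (swap i.-1 i)
| DId of ~~ between w i i.-1 i.+1 & ~~ between w i i.+1 i.-1 : d_val_spec i w id.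

Lemma d_valP i w : d_val_spec i w (d_val i w).
Proof.
rewrite /d_val; case: ifPn => [|h1]; first exact: DUp.
by case: ifPn => [|h2]; [exact: DDown | exact: DId].
Qed.

Lemma between3 p a b c q : uniq (p ++ [:: a; b; c] ++ q) ->
  between (p ++ [:: a; b; c] ++ q) a b c.
Proof.
move=> uw; rewrite /between /= in uw *; rewrite (index_at uw); move: uw.
rewrite -!(cat_rcons a) => uw; rewrite (index_at uw); move: uw.
by rewrite -!(cat_rcons b) => uw; rewrite (index_at uw) !size_rcons; lia.
Qed.

Lemma map_swap_id a b s : a \notin s -> b \notin s -> map (swap a b) s = s.
Proof.
move=> na nb; rewrite -[RHS]map_id; apply/eq_in_map => x xs; rewrite /swap.
rewrite ifN; last by apply: contraNneq na => <-.
by rewrite ifN //; apply: contraNneq nb => <-.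
Qed.

Lemma map_swap_ctx a b p m q : uniq (p ++ m ++ q) -> a \in m -> b \in m ->
  map (swap a b) (p ++ m ++ q) = p ++ map (swap a b) m ++ q.
Proof.
rewrite !cat_uniq has_cat negb_or => /and3P[_ /andP[/hasPn pm _] /and3P[_ /hasPn mq _]] am bm.
rewrite !map_cat map_swap_id; [|exact: pm..].
rewrite (@map_swap_id _ _ q) //; apply/negP => /mq /negP; exact.
Qed.

(** A move that does not reverse [i-1] and [i+1] keeps the relative order of [i-1], [i], [i+1], so
    [d_i] exchanges the same two values in both words. *)
Lemma knuth_step_d_far i u v x z : 0 < i -> uniq u -> knuth_step u v -> x.+1 < z ->
  (forall a b, (a, b) != (x, z) -> (a, b) != (z, x) -> same_order u v a b) ->
  (x, z) != (i.-1, i.+1) -> knuth (d_word i u) (d_word i v).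
Proof.
move=> i0 uu uv xz H ne.
have {}H a b : i.-1 <= a <= i.+1 -> i.-1 <= b <= i.+1 -> same_order u v a b.
  by move=> ha hb; apply: H; apply: contra ne => /eqP[e1 e2]; apply/eqP; congr pair; lia.
have bE a b c : i.-1 <= a <= i.+1 -> i.-1 <= b <= i.+1 -> i.-1 <= c <= i.+1 ->
    between u a b c = between v a b c.
  by move=> ha hb hc; rewrite /between !H.
rewrite /d_word -(d_val_order H); apply: rst_step; case: d_valP => [b|b|_ _].
- by apply: (@knuth_step_swap u v i i.-1) => //; rewrite -bE //; lia.
- rewrite -{2 4}(prednK i0); apply: (@knuth_step_swap u v i.-1 i.+1) => //.
    by rewrite prednK // betweenC.
  by rewrite prednK // betweenC -bE //; lia.
- by rewrite !map_id.
Qed.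

(** In the remaining case the move is made on the letters [i-1], [i], [i+1] themselves, in adjacent
    places. Then [d_i] exchanges different pairs in the two words and turns a move of one kind into
    a move of the other kind. *)
Lemma knuth_step_d i u v : 0 < i -> uniq u -> knuth_step u v -> knuth (d_word i u) (d_word i v).
Proof.
case: i => // j j0 uu uv.
have nj : ((j == j.+1) = false) * ((j == j.+2) = false) * ((j.+1 == j) = false) *
    ((j.+1 == j.+2) = false) * ((j.+2 == j) = false) * ((j.+2 == j.+1) = false).
  by do !split; apply/negbTE/eqP; lia.
have uv' := uu; rewrite (perm_uniq (knuth_step_perm uv)) in uv'.
have uv0 := uv.
case: uv uu uv' uv0 => p q x y z xy yz uu uv' uv.
  have [[ex ez]|ne] := eqVneq (x, z) (j, j.+2).
    have ey : y = j.+1 by lia.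
    subst x y z; apply: rst_sym; apply: rst_step; rewrite /d_word /d_val /=.
    rewrite (between3 uu) adjacent_between // (between3 uv').
    rewrite !(map_swap_ctx (m := [:: j.+1; _; _])) ?inE ?eqxx ?orbT //=.
    by rewrite /swap !eqxx !nj; exact: Kn2.
  apply: (knuth_step_d_far _ _ _ _ _ ne) => //; first lia.
  move: uu; rewrite -!(cat_rcons y) => uu a b H1 H2.
  exact: index_transpose.
have [[ex ez]|ne] := eqVneq (x, z) (j, j.+2).
  have ey : y = j.+1 by lia.
  subst x y z; apply: rst_sym; apply: rst_step; rewrite /d_word /d_val /=.
  have -> : between (p ++ [:: j; j.+2; j.+1] ++ q) j.+1 j j.+2 = false.
    rewrite betweenC -(cat_rcons j); apply: adjacent_between.
    by rewrite cat_rcons.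
  rewrite (betweenC (p ++ [:: j, j.+2, j.+1 & q]) j.+1 j.+2 j) (between3 uu).
  rewrite (betweenC _ j.+1 j j.+2) (between3 uv') /=.
  rewrite (map_swap_ctx (m := [:: j; j.+2; j.+1])) ?inE ?eqxx ?orbT //=.
  rewrite (map_swap_ctx (m := [:: j.+2; j; j.+1])) ?inE ?eqxx ?orbT //=.
  by rewrite /swap !eqxx !nj; exact: Kn1.
apply: (knuth_step_d_far _ _ _ _ _ ne) => //; first lia.
by move=> a b H1 H2; apply: index_transpose.
Qed.

Lemma d_val_invol i w : involutive (d_val i w).
Proof. by case: d_valP => *; [exact: swapK | exact: swapK |]. Qed.

Lemma d_val_inj i w : injective (d_val i w).
Proof. exact: inv_inj (d_val_invol i w). Qed.

Lemma index_d_word i w v : index v (d_word i w) = index (d_val i w v) w.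
Proof. by rewrite -{1}(d_val_invol i w v) /d_word (index_map (@d_val_inj i w)). Qed.

Lemma d_word_uniq i w : uniq (d_word i w) = uniq w.
Proof. exact: (map_inj_uniq (@d_val_inj i w)). Qed.

Lemma d_val_d_word i w : 0 < i -> d_val i (d_word i w) = d_val i w.
Proof.
case: i => // j _; rewrite /d_val /between !index_d_word /=.
have nj : ((j == j.+1) = false) * ((j == j.+2) = false) * ((j.+1 == j) = false) *
    ((j.+1 == j.+2) = false) * ((j.+2 == j) = false) * ((j.+2 == j.+1) = false).
  by do !split; apply/negbTE/eqP; lia.
case: d_valP; rewrite /between /= /swap ?eqxx ?nj.
- by move=> b; rewrite orbC b.
- move=> b; have -> : (index j w < index j.+1 w < index j.+2 w)
      || (index j.+2 w < index j.+1 w < index j w) = false by lia.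
  by rewrite orbC b ifF //; lia.
- by move=> /negPf -> /negPf ->.
Qed.

Lemma d_wordK i w : 0 < i -> d_word i (d_word i w) = w.
Proof.
move=> i0; rewrite {1}/d_word d_val_d_word // /d_word -map_comp -[RHS]map_id.
by apply: eq_map => x /=; rewrite d_val_invol.
Qed.

(** The condition under which [d_i^R] fixes a word is symmetric in the word and its image under
    [d_i]. *)
Lemma dR_wordK i w : 0 < i -> dR_word i (dR_word i w) = w.
Proof.
move=> i0; rewrite {2}/dR_word; case: ifP => c; first by rewrite /dR_word c.
by rewrite /dR_word d_wordK // andbC c.
Qed.

Lemma knuth_d_word i u v : 0 < i -> uniq u -> knuth u v -> knuth (d_word i u) (d_word i v).
Proof.
move=> i0; apply: (knuth_uniq_ind (Q := fun u v => knuth (d_word i u) (d_word i v))).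
- by move=> ?; exact: rst_refl.
- by move=> ? ?; exact: rst_sym.
- by move=> ? ? ? H; exact: rst_trans H.
- by move=> ? ?; exact: knuth_step_d.
Qed.

Lemma knuth_dR_word i u v : 0 < i -> uniq u -> knuth u v -> knuth (dR_word i u) (dR_word i v).
Proof.
move=> i0 uu uv; rewrite /dR_word (knuth_inv_des _ uu uv).
rewrite (knuth_inv_des i.+1 (_ : uniq (d_word i u)) (knuth_d_word i0 uu uv)) ?d_word_uniq //.
by case: ifP => // _; exact: knuth_d_word.
Qed.

Lemma d_word_perm i w : 0 < i -> {subset [:: i.-1; i; i.+1] <= w} -> uniq w ->
  perm_eq (d_word i w) w.
Proof.
move=> i0 iw uw; apply: uniq_perm; rewrite ?d_word_uniq // => x.
rewrite -{1}(d_val_invol i w x) mem_map; last exact: d_val_inj.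
have [i1 [i2 i3]] : i.-1 \in w /\ i \in w /\ i.+1 \in w.
  by split; [|split]; apply: iw; rewrite !inE eqxx ?orbT.
by case: d_valP => // _; rewrite /swap; case: eqVneq => [->|_];
  rewrite ?i1 ?i2 ?i3 //; case: eqVneq => [->|_]; rewrite ?i1 ?i2 ?i3.
Qed.

(* Under this condition a and a+1 are not in adjacent cells of a tableau with
   reading word w, so exchanging them yields a tableau. *)
Definition separated (a : nat) (w : seq nat) : Prop :=
  a \in w -> a.+1 \in w ->
  exists2 c, c.+1 == a \/ c == a.+2 & between w a c a.+1.

Lemma index_sorted R x y : sorted ltn R -> x \in R -> y \in R ->
  (index x R < index y R) = (x < y).
Proof.
move=> sR xR yR; have H u v : u \in R -> v \in R -> index u R < index v R -> u < v.
  move=> uR vR lt; rewrite -{1}(nth_index 0 uR) -(nth_index 0 vR).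
  by apply: (sorted_ltn_nth ltn_trans 0 sR); rewrite ?inE ?index_mem.
case: (ltngtP (index x R) (index y R)) => [/H->//|/H H'|e].
  by have := H' yR xR; lia.
by rewrite -(nth_index 0 xR) -(nth_index 0 yR) e ltnn.
Qed.

Lemma sorted_swap a R : sorted ltn R -> ~ (a \in R /\ a.+1 \in R) ->
  sorted ltn (map (swap a a.+1) R).
Proof.
move=> sR naR; rewrite !(sorted_pairwise ltn_trans) pairwise_map in sR *.
apply/(pairwiseP 0) => i j iR jR ij /=; apply: swap_lt; first exact: (pairwiseP 0 sR).
by apply/eqP => -[e1 e2]; apply: naR; split; [rewrite -e1 | rewrite -e2]; apply: mem_nth.
Qed.

(** Increase could fail only if [a+1] were the right or upper neighbour of [a]. Within a row neither
    [a-1] nor [a+2] can stand between them; within a column, such a letter between them in reading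
    order forces a second copy of [a] or [a+1] in a neighbouring cell. *)
Lemma is_tab_swap a P : is_tab P -> uniq (rw P) -> separated a (rw P) ->
  is_tab (map (map (swap a a.+1)) P).
Proof.
elim: P => // R P IH /= /and4P[R0 sR dR tP]; rewrite rw_cons => uP sep.
have R0' : map (swap a a.+1) R != [::] by case: (R) R0.
have idxl x : x \in rw P -> index x (rw P ++ R) = index x (rw P) by move=> xP; rewrite index_cat xP.
have idxr x : x \notin rw P -> index x (rw P ++ R) = size (rw P) + index x R.
  by move=> /negPf xP; rewrite index_cat xP.
have RnP x : x \in R -> x \notin rw P.
  by move: uP; rewrite cat_uniq => /and3P[_ /hasPn H _] /H.
have sepP : separated a (rw P).
  move=> aP a1P; have [||c ec] := sep; rewrite ?mem_cat ?aP ?a1P //.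
  rewrite /between !(idxl a) // (idxl a.+1) // => bc; exists c => //.
  suff cP : c \in rw P by rewrite /between -(idxl c).
  apply/negPn/negP => /idxr ecR; move: bc; rewrite ecR.
  have ia : index a (rw P) < size (rw P) by rewrite index_mem.
  have ia1 : index a.+1 (rw P) < size (rw P) by rewrite index_mem.
  by move: ia ia1; clear; lia.
have uP' : uniq (rw P) by move: uP; rewrite cat_uniq => /and3P[].
rewrite R0' (IH tP uP' sepP) andbT /=.
have aR : ~ (a \in R /\ a.+1 \in R).
  case=> aR a1R; have [||c ec] := sep; rewrite ?mem_cat ?aR ?a1R ?orbT //.
  rewrite /between !(idxr a) ?RnP // (idxr a.+1) ?RnP //.
  have [cP|/idxr ecR] := boolP (c \in rw P).
    have ic : index c (rw P) < size (rw P) by rewrite index_mem.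
    by rewrite idxl //; move: ic; clear; lia.
  rewrite ecR !ltn_add2l.
  have [cR|cR] := boolP (c \in R).
    by rewrite !index_sorted //; clear; lia.
  have ia : index a R < size R by rewrite index_mem.
  have ia1 : index a.+1 R < size R by rewrite index_mem.
  have ic : index c R = size R := memNindex cR.
  by rewrite ic; move: ia ia1; clear; lia.
rewrite sorted_swap //=.
have eh : head [::] (map (map (swap a a.+1)) P) = map (swap a a.+1) (head [::] P).
  by case: (P).
rewrite eh; apply/dominatesP => c; rewrite !size_map => cR2.
have [cR lt] := dominatesP _ _ dR c cR2.
split=> //; rewrite !(nth_map 0) //; apply: swap_lt => //; apply/eqP => -[ea ea1].
case: P dR tP uP sep cR2 lt ea1 {IH idxl idxr RnP sepP uP' eh} => [|R2 P] //=.
rewrite rw_cons => dR /and4P[_ sR2 _ _] uP sep cR2 lt ea1.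
set L := rw P in uP sep.
have a1R2 : a.+1 \in R2 by rewrite -ea1 mem_nth.
have aR' : a \in R by rewrite -ea mem_nth.
have ia : index a R = c by rewrite -ea index_uniq //; move: uP; rewrite cat_uniq => /and3P[].
have uR2 : uniq R2 by move: uP; rewrite !cat_uniq => /and3P[/and3P[]].
have ia1 : index a.+1 R2 = c by rewrite -ea1 index_uniq.
have [nL nR2] : (forall x, x \in R2 -> x \notin L) /\ (forall x, x \in R -> x \notin L ++ R2).
  move: uP; rewrite cat_uniq cat_uniq => /and3P[/and3P[_ /hasPn H _] /hasPn H' _].
  by split.
have [||e ee] := sep; rewrite ?mem_cat ?aR' ?a1R2 ?orbT //.
rewrite /between !index_cat.
rewrite (negPf (nR2 _ aR')) ia (mem_cat a.+1) a1R2 orbT (negPf (nL _ a1R2)) ia1 mem_cat.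
have [eL|eL] /= := boolP (e \in L).
  have ie : index e L < size L by rewrite index_mem.
  by rewrite size_cat; move: ie; clear; lia.
have [eR2|eR2] /= := boolP (e \in R2).
  rewrite size_cat => be.
  have ce : c < index e R2 by move: be; clear; lia.
  have eE : e = a.+2.
    have lt' : a.+1 < e by rewrite -(index_sorted sR2) // ia1.
    by case: ee => /eqP // ee; move: lt'; rewrite -ee; clear; lia.
  have k2 : index e R2 < size R2 by rewrite index_mem.
  have [c1R lt1] := dominatesP _ _ dR c.+1 (leq_ltn_trans ce k2).
  (* This entry lies strictly between [a] on its left and an entry at most [a+2] above it. *)
  have : nth 0 R c.+1 = a.+1.
    have l1 : nth 0 R c < nth 0 R c.+1.
      by apply: (sorted_ltn_nth ltn_trans 0 sR); rewrite ?inE.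
    rewrite ea in l1.
    have l2 : nth 0 R2 c.+1 <= a.+2.
      have := sorted_leq_nth leq_trans leqnn 0 (sub_sorted (@ltnW) sR2) c.+1 (index e R2).
      by rewrite !inE k2 (leq_ltn_trans ce k2) nth_index // {2}eE => /(_ isT isT ce).
    by leq_lia.
  by move=> eR; apply: aR; rewrite aR' -eR mem_nth.
rewrite size_cat => be.
have ce : index e R < c by move: be; clear; lia.
have eR : e \in R by rewrite -index_mem; apply: ltn_trans ce cR.
have eE : e.+1 = a.
  have lt' : e < a by rewrite -(index_sorted sR) // ia.
  by case: ee => /eqP // ee; move: lt'; rewrite ee; clear; lia.
have [_ lt1] := dominatesP _ _ dR (index e R) (ltn_trans ce cR2).
(* This entry lies strictly between [e = a-1] below it and [a+1] on its right, so [a] would occur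
   twice. *)
have : nth 0 R2 (index e R) = a.
  have l1 : nth 0 R2 (index e R) < nth 0 R2 c.
    by apply: (sorted_ltn_nth ltn_trans 0 sR2); rewrite ?inE // (ltn_trans ce).
  by move: lt1 l1; rewrite nth_index // ea1 -eE; clear; lia.
move=> eR'; have := nR2 _ aR'; rewrite mem_cat -{2}eR' mem_nth ?orbT //.
exact: ltn_trans ce cR2.
Qed.

Lemma rw_map f P : rw (map (map f) P) = map f (rw P).
Proof. by rewrite /rw -map_rev map_flatten. Qed.

Lemma shape_map (f : nat -> nat) P : shape (map (map f) P) = shape P.
Proof. by rewrite /shape -map_comp; apply: eq_map => R /=; rewrite size_map. Qed.

Lemma is_tab_d i P : 0 < i -> is_tab P -> uniq (rw P) -> is_tab (d i P).
Proof.
move=> i0 tP uP; rewrite /d; case: d_valP => [b|b|_ _].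
- by apply: is_tab_swap => // _ _; exists i.-1 => //; left; rewrite prednK.
- rewrite -{2}(prednK i0); apply: is_tab_swap => // _ _; exists i.+1; first by right; lia.
  by rewrite prednK // betweenC.
- by rewrite (eq_map (map_id (T := nat))) map_id.
Qed.

(** The word [d_i w] is Knuth equivalent to [d_i] applied to the reading word of [tab w], and by
    [is_tab_d] the latter is the reading word of a tableau. *)
Lemma tab_d_word i w : 0 < i -> uniq w -> tab (d_word i w) = d i (tab w).
Proof.
move=> i0 uw; have uP : uniq (rw (tab w)) by rewrite -(perm_uniq (knuth_perm (knuth_tab_rw uw))).
rewrite (knuth_tab _ (knuth_d_word i0 uw (knuth_tab_rw uw))) ?d_word_uniq //.
rewrite -[RHS]tab_rw; last by apply: is_tab_d => //; exact: is_tab_tab.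
by rewrite /d rw_map.
Qed.

Lemma row_insert_mono f P x : {in x :: flatten P &, {mono f : a b / a < b}} ->
  row_insert (map (map f) P) (f x) =
  (map (map f) (row_insert P x).1, (row_insert P x).2).
Proof.
elim: P x => //= R P IH x fm.
have -> : find [eta ltn (f x)] (map f R) = find (ltn x) R.
  rewrite find_map; apply: eq_in_find => y yR /=.
  by apply: fm; rewrite !inE ?eqxx // mem_cat yR orbT.
rewrite size_map; set c := find _ _; case: eqVneq => [_|nc] /=; first by rewrite map_rcons.
have cR : c < size R by rewrite ltn_neqAle nc find_size.
rewrite (nth_map 0) // IH; last first.
  move=> a b; rewrite !inE => ha hb; apply: fm; rewrite !inE mem_cat.
    by case/orP: ha => [/eqP->|->]; rewrite ?mem_nth ?orbT.
  by case/orP: hb => [/eqP->|->]; rewrite ?mem_nth ?orbT.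
case: row_insert => P' r /=; congr (_ :: _, _).
apply: (@eq_from_nth _ 0) => [|i]; rewrite !(size_set_nth, size_map) //.
move=> ic; rewrite [RHS](nth_map 0) ?size_set_nth // !nth_set_nth /=.
case: eqVneq => // _; rewrite (nth_map 0) //; move: ic cR; clear; lia.
Qed.

Lemma tab_mono f w : {in w &, {mono f : a b / a < b}} ->
  tab (map f w) = map (map f) (tab w).
Proof.
elim/last_ind: w => // w x IH fm; rewrite map_rcons !tab_rcons IH; last first.
  by move=> a b aw bw; apply: fm; rewrite mem_rcons inE ?aw ?bw orbT.
rewrite /tab_ins row_insert_mono // => a b.
rewrite !inE !(perm_mem (tab_perm w)) => ha hb.
by apply: fm; rewrite mem_rcons inE.
Qed.

Lemma index_take (k : nat) (w : seq nat) x : x \in take k w -> index x (take k w) = index x w.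
Proof. by move=> xk; rewrite -[in RHS](cat_take_drop k w) index_cat xk. Qed.

Lemma take_index_lt (k : nat) (w : seq nat) x y : x \in w -> index x w < index y w ->
  y \in take k w -> x \in take k w.
Proof.
move=> xw lt yk; rewrite in_take // (ltn_trans lt) // -in_take //.
exact: mem_take yk.
Qed.

(** If the prefix contains [i-1], [i] and [i+1], then [d_i] acts on the prefix and keeps the shape.
    Otherwise it cannot contain both exchanged values, because the third letter stands between them,
    and on the prefix the exchange preserves the relative order. *)
Lemma shape_take_d_word i w k : 0 < i -> uniq w -> {subset [:: i.-1; i; i.+1] <= w} ->
  shape (tab (take k (d_word i w))) = shape (tab (take k w)).
Proof.
move=> i0 uw iw; rewrite /d_word -map_take.
have uk : uniq (take k w) by exact: take_uniq.
have [[x0 x1 x2]|nx] := pselect ([/\ i.-1 \in take k w, i \in take k w & i.+1 \in take k w]).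
  have <- : d_val i (take k w) = d_val i w by rewrite /d_val /between !index_take.
  by rewrite -/(d_word i (take k w)) tab_d_word // shape_map.
have swapM a c : c \in w -> between w a c a.+1 ->
    ~ [/\ a \in take k w, a.+1 \in take k w & c \in take k w] ->
    shape (tab (map (swap a a.+1) (take k w))) = shape (tab (take k w)).
  move=> cw b na; rewrite tab_mono ?shape_map // => x y xk yk.
  have {}na : ~ (a \in take k w /\ a.+1 \in take k w).
    move=> [a0 a1]; apply: na; split=> //.
    case/orP: b => /andP[b1 b2]; [exact: take_index_lt b2 a1 | exact: take_index_lt b2 a0].
  have H u v : u \in take k w -> v \in take k w -> u < v -> swap a a.+1 u < swap a a.+1 v.
    by move=> uk' vk lt; apply: swap_lt => //; apply/eqP => -[e1 e2]; apply: na; subst.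
  case: (ltngtP x y) => [/H->//|/H lt|->]; last by rewrite ltnn.
  by apply/negbTE; rewrite -leqNgt ltnW // lt.
case: d_valP => [b|b|_ _]; last by rewrite map_id.
- apply: (swapM i i.-1) => //; first by apply: iw; rewrite inE eqxx.
  by case=> h1 h2 h3; apply: nx.
- rewrite -{2}(prednK i0); apply: (swapM i.-1 i.+1).
  + by apply: iw; rewrite !inE eqxx !orbT.
  + by rewrite prednK // betweenC.
  by rewrite prednK // => -[h1 h2 h3]; apply: nx.
Qed.

Lemma RSK_d_word i w : 0 < i -> uniq w -> {subset [:: i.-1; i; i.+1] <= w} ->
  (RSK (d_word i w)).2 = (RSK w).2.
Proof.
move=> i0 uw iw; apply: RSK_Q_shape; first by rewrite size_map.
by move=> k; exact: shape_take_d_word.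
Qed.

Lemma RSK_dR_word i w : 0 < i -> uniq w -> {subset [:: i.-1; i; i.+1] <= w} ->
  (RSK (dR_word i w)).2 = (RSK w).2.
Proof. by move=> i0 uw iw; rewrite /dR_word; case: ifP => // _; exact: RSK_d_word. Qed.

(** * Lifting chains along Knuth equivalence *)

Definition dR_step (n : nat) (w w' : seq nat) : Prop :=
  perm_word n w /\ exists i, [/\ 2 <= i, i <= n - 2 & w' = dR_word i w].

Definition dR_equiv (n : nat) : seq nat -> seq nat -> Prop :=
  clos_refl_sym_trans _ (dR_step n).

Lemma perm_word_uniq n w : perm_word n w -> uniq w.
Proof. by move/perm_uniq->; exact: iota_uniq. Qed.

Lemma perm_word_mem n w x : perm_word n w -> (x \in w) = (0 < x <= n).
Proof. by move/perm_mem->; rewrite mem_iota; lia. Qed.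

Lemma perm_word_window n w i : perm_word n w -> 2 <= i -> i <= n - 2 ->
  {subset [:: i.-1; i; i.+1] <= w}.
Proof.
by move=> pw i2 iN x; rewrite (perm_word_mem _ pw) !inE => /or3P[] /eqP->; lia.
Qed.

Lemma dR_word_perm n i w : perm_word n w -> 2 <= i -> i <= n - 2 -> perm_word n (dR_word i w).
Proof.
move=> pw i2 iN; rewrite /dR_word; case: ifP => // _; apply: perm_trans (pw).
apply: d_word_perm; [lia | exact: perm_word_window pw i2 iN | exact: perm_word_uniq pw].
Qed.

(** The same indices [i], applied to [p], give the lifted chain. A backward step lifts to a forward
    one since [d_i^R] is an involution; proving the claim in both directions at once takes care of
    symmetry. *)
Lemma dR_equiv_lift n w w' : dR_equiv n w w' -> forall p, perm_word n p -> knuth w p ->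
  exists p', [/\ perm_word n p', knuth w' p', dR_equiv n p p' & (RSK p').2 = (RSK p).2].
Proof.
have step i w0 p : 2 <= i -> i <= n - 2 -> perm_word n p -> knuth w0 p ->
    [/\ perm_word n (dR_word i p), knuth (dR_word i w0) (dR_word i p), dR_equiv n p (dR_word i p)
      & (RSK (dR_word i p)).2 = (RSK p).2].
  move=> i2 iN pp wp; split.
  - exact: dR_word_perm.
  - apply: knuth_dR_word (wp); first by lia.
    by rewrite (perm_uniq (knuth_perm wp)); exact: perm_word_uniq pp.
  - by apply: rst_step; split=> //; exists i.
  - apply: RSK_dR_word; [lia | exact: perm_word_uniq pp | exact: perm_word_window pp i2 iN].
set L := fun w w' => forall p, perm_word n p -> knuth w p -> exists p',
  [/\ perm_word n p', knuth w' p', dR_equiv n p p' & (RSK p').2 = (RSK p).2].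
move=> ww'; suff [] : L w w' /\ L w' w by [].
elim: ww' => {w w'} [w w' [pw [i [i2 iN ->]]]|w|w w' _ [IH1 IH2]|w1 w2 w3 _ [IH1 IH1']
  _ [IH2 IH2']].
- split=> p pp wp; exists (dR_word i p); first exact: step.
  by rewrite -[w in knuth w](@dR_wordK i); [exact: step | lia].
- by split=> p pp wp; exists p; split=> //; exact: rst_refl.
- by [].
- have trans u1 u2 u3 : L u1 u2 -> L u2 u3 -> L u1 u3.
    move=> H1 H2 p pp wp; have [p1 [pp1 wp1 e1 q1]] := H1 p pp wp.
    have [p2 [pp2 wp2 e2 q2]] := H2 p1 pp1 wp1.
    by exists p2; split=> //; [exact: rst_trans e1 e2 | rewrite q2].
  by split; [exact: trans IH1 IH2 | exact: trans IH2' IH1'].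
Qed.

(** * Windows of four values *)

Lemma index_filter_lt (T : eqType) (P : pred T) (w : seq T) a b : P a -> P b ->
  (index a (filter P w) < index b (filter P w)) = (index a w < index b w).
Proof.
move=> Pa Pb; elim: w => //= c w IH; case: ifPn => [_|nc] /=.
  by case: (c == a); case: (c == b).
by rewrite !ifN // ?ltnS //; apply: contraNneq nc => ->.
Qed.

Definition window (m : nat) (w : seq nat) : seq nat := [seq v <- w | m <= v <= m + 3].

Lemma mem_window m w x : (x \in window m w) = (m <= x <= m + 3) && (x \in w).
Proof. exact: mem_filter. Qed.

Lemma window_shift n m w : perm_word n w -> 0 < m -> m + 3 <= n ->
  exists2 s, s \in permutations (iota 0 4) & window m w = map (addn m) s.
Proof.
move=> pw m0 mn.
have ew : map (addn m) (map (subn^~ m) (window m w)) = window m w.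
  rewrite -map_comp map_id_in // => x; rewrite mem_window => /andP[/andP[mx _] _] /=.
  exact: subnKC.
exists (map (subn^~ m) (window m w)) => //.
rewrite mem_permutations; apply: (@perm_map_inj _ _ (addn m)); first exact: addnI.
rewrite ew -iotaDl addn0; apply: uniq_perm.
- by apply: filter_uniq; exact: perm_word_uniq pw.
- exact: iota_uniq.
by move=> x; rewrite mem_window (perm_word_mem _ pw) mem_iota; lia.
Qed.

Lemma window_rev m w : window m (rev w) = rev (window m w).
Proof. exact: filter_rev. Qed.

Lemma fl_shift m s : fl (map (addn m) s) = fl s.
Proof.
rewrite /fl -map_comp; apply: eq_map => x /=; congr S; rewrite count_map.
by apply: eq_count => y /=; rewrite ltn_add2l.
Qed.

Lemma h_window m v s : window m v = map (addn m) s ->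
  h m v = [seq if m <= x <= m + 3 then (m + nth 0 (h1 (fl s)) (index (x - m) s)).-1 else x
          | x <- v].
Proof.
move=> ew; rewrite /h -/(window m v) ew fl_shift; apply/eq_in_map => x xv.
have <- : (x \in map (addn m) s) = (m <= x <= m + 3).
  by rewrite -ew mem_filter xv andbT.
case: ifP => // /mapP[y ys ->].
rewrite index_map; last exact: addnI.
rewrite addKn; have [lt|ge] := ltnP (index y s) (size (h1 (fl s))).
  by rewrite (nth_map 0).
have sz : size (h1 (fl s)) = size s.
  rewrite -[RHS](size_map (fun x => (count (fun y => y < x) s).+1)) -/(fl s).
  case: (fl s) => [|a [|b [|c [|e [|]]]]] //=.
  by case: ifP => // _; case: ifP.
by move: ge; rewrite sz leqNgt index_mem ys.
Qed.

(* [d_1^R] on a window, with values shifted to 0, ..., 3. *)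
Definition dR4 (s : seq nat) : nat -> nat :=
  if inv_des s 2 && inv_des (d_word 1 s) 2 then id else d_val 1 s.

Lemma d_val_shift m s a :
  d_val m.+1 (map (addn m) s) (m + a) = m + d_val 1 s a.
Proof.
have e b : index (m + b) (map (addn m) s) = index b s by rewrite index_map //; exact: addnI.
have e0 := e 0; have e1 := e 1; have e2 := e 2.
rewrite addn0 in e0; rewrite addn1 in e1; rewrite addn2 in e2.
rewrite /d_val /between /= e0 e1 e2.
case: ifP => _; first by rewrite /swap; repeat case: ifP => /eqP ?; lia.
by case: ifP => _ //; rewrite /swap; repeat case: ifP => /eqP ?; lia.
Qed.

Lemma d_val1_bound s a : a <= 3 -> d_val 1 s a <= 3.
Proof. by case: d_valP => // _ a3; rewrite /swap; repeat case: ifP => //. Qed.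

Lemma dR_word_window m w s : window m w = map (addn m) s ->
  dR_word m.+1 w = [seq if m <= x <= m + 3 then m + dR4 s (x - m) else x | x <- w].
Proof.
move=> ew.
have ord a b : a <= 3 -> b <= 3 -> (index (m + a) w < index (m + b) w) = (index a s < index b s).
  move=> a3 b3; rewrite -(index_filter_lt (P := fun v => m <= v <= m + 3)); try lia.
  by rewrite -/(window m w) ew !index_map //; exact: addnI.
have eD x : d_val m.+1 w x = if m <= x <= m + 3 then m + d_val 1 s (x - m) else x.
  case: ifPn => [/andP[mx xm]|nx].
    rewrite -d_val_shift subnKC // -ew; congr (_ x); apply: d_val_order => a b ha hb.
    by rewrite /same_order index_filter_lt //; lia.
  by case: d_valP => // _; rewrite /swap; repeat case: ifP => /eqP ?; lia.
have dE a : a <= 3 -> d_val m.+1 w (m + a) = m + d_val 1 s a.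
  by move=> a3; rewrite eD addKn ifT //; lia.
rewrite /dR_word /dR4 /inv_des !index_d_word.
rewrite -[m.+3]addn3 -[m.+2]addn2 !dE // !ord ?d_val1_bound //.
case: ifP => _; last by apply/eq_map => x; exact: eD.
by rewrite map_id_in // => x _; case: ifP => // /andP[mx _]; rewrite subnKC.
Qed.

(* [h1] also acts on some words that [d_1^R] fixes, whence the disjunction. *)
Lemma h1_dR4 : all (fun s => (map (dR4 s) (iota 0 4) == iota 0 4) || all (fun a =>
   (nth 0 (h1 (fl (rev s))) (index a (rev s)) == (dR4 s a).+1) &&
   (let t := map (subn 3) (rev s) in
    nth 0 (h1 (fl t)) (index (3 - a) t) == (3 - dR4 s a).+1)) (iota 0 4))
  (permutations (iota 0 4)).
Proof. by vm_compute. Qed.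

(** Reduction to the finite check on four letters. Under [v -> n+1-v] the window [i-1, ..., i+2]
    becomes [n-i-1, ..., n-i+2], whence the index [n - i.+1]. *)
Lemma h_dR_word n i w : perm_word n w -> 2 <= i -> i <= n - 2 ->
  dR_word i w = w \/
  h i.-1 (rev w) = rev (dR_word i w) /\ h (n - i.+1) (flip n w) = flip n (dR_word i w).
Proof.
case: i => [|[|m']] // pw _; set m := m'.+1 => mn.
have [|s sP ew] := @window_shift n m w pw isT; first lia.
case/orP: (allP h1_dR4 s sP) => [/eqP e|H0].
  left; rewrite (dR_word_window ew) map_id_in // => x _; case: ifP => // /andP[mx xm].
  have /eq_in_map/(_ (x - m)) : map (dR4 s) (iota 0 4) = map id (iota 0 4) by rewrite e map_id.
  by rewrite mem_iota => ->; lia.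
right; have H a : a <= 3 ->
    nth 0 (h1 (fl (rev s))) (index a (rev s)) = (dR4 s a).+1 /\
    nth 0 (h1 (fl (map (subn 3) (rev s)))) (index (3 - a) (map (subn 3) (rev s))) =
      (3 - dR4 s a).+1.
  move=> a3; have := allP H0 a; rewrite mem_iota.
  by move=> /(_ a3) /andP[/eqP-> /eqP->].
rewrite (dR_word_window ew); split.
  rewrite (@h_window m _ (rev s)); last by rewrite window_rev ew map_rev.
  rewrite -map_rev; apply: eq_map => x; case: ifP => // /andP[mx xm].
  by have [|-> _] := H (x - m); lia.
have s3 : {in s, forall a, a <= 3}.
  by move=> a; move: sP; rewrite mem_permutations => /perm_mem ->; rewrite mem_iota.
have ef : window (n - m.+2) (flip n w) = map (addn (n - m.+2)) (map (subn 3) (rev s)).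
  rewrite /window /flip filter_map -map_comp.
  rewrite (@eq_in_filter _ _ (fun v => m <= v <= m + 3)); last first.
    by move=> x; rewrite mem_rev (perm_word_mem _ pw) /=; lia.
  rewrite -/(window m (rev w)) window_rev ew -map_rev -map_comp; apply/eq_in_map => a.
  by rewrite mem_rev => /s3 /=; lia.
rewrite (h_window ef) /flip -map_rev -!map_comp; apply/eq_in_map => x.
rewrite mem_rev (perm_word_mem _ pw) => /andP[x0 xn] /=.
have -> : (n - m.+2 <= n.+1 - x <= n - m.+2 + 3) = (m <= x <= m + 3) by lia.
case: ifP => // /andP[mx xm].
have -> : n.+1 - x - (n - m.+2) = 3 - (x - m) by lia.
have [|_ ->] := H (x - m); first lia.
have d3 : dR4 s (x - m) <= 3.
  by rewrite /dR4; case: ifP => _; [lia | apply: d_val1_bound; lia].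
by lia.
Qed.

Lemma dR_equiv_sde n w w' : dR_equiv n w w' ->
  shifted_dual_equiv n (rev w) (rev w') /\ shifted_dual_equiv n (flip n w) (flip n w').
Proof.
move=> ww'; split; move: w w' ww'.
  apply: (rst_map (f := rev)) => w w' [pw [i [i2 iN ->]]].
  have [->|[<- _]] := h_dR_word pw i2 iN; first exact: rst_refl.
  apply: rst_step; split; last by exists i.-1; split=> //; lia.
  by rewrite /perm_word perm_rev.
apply: (rst_map (f := flip n)) => w w' [pw [i [i2 iN ->]]].
have [->|[_ <-]] := h_dR_word pw i2 iN; first exact: rst_refl.
apply: rst_step.
split; last by exists (n - i.+1); split=> //; lia.
rewrite /perm_word /flip; apply: uniq_perm; rewrite ?iota_uniq //.
  rewrite map_inj_in_uniq ?rev_uniq; first exact: perm_word_uniq pw.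
  by move=> a b; rewrite !mem_rev !(perm_word_mem _ pw); lia.
move=> x; rewrite mem_iota; apply/mapP/idP => [[y]|xn].
  by rewrite mem_rev (perm_word_mem _ pw) => ? ->; lia.
by exists (n.+1 - x); rewrite ?mem_rev ?(perm_word_mem _ pw); lia.
Qed.

(** * Sliding runs *)

Definition reading_lt (x y : cell) : bool := (y.1 < x.1) || ((x.1 == y.1) && (x.2 < y.2)).

Lemma reading_lt_trans : transitive reading_lt.
Proof. by move=> [a b] [c e] [f g]; rewrite /reading_lt /=; lia. Qed.

Lemma reading_lt_irr : irreflexive reading_lt.
Proof. by move=> [a b]; rewrite /reading_lt /=; lia. Qed.

Lemma reading_sorted_eq (s t : seq cell) : pairwise reading_lt s -> pairwise reading_lt t ->
  s =i t -> s = t.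
Proof.
rewrite -!(sorted_pairwise reading_lt_trans).
exact: (irr_sorted_eq reading_lt_trans reading_lt_irr).
Qed.

(* In the intended instance the runs before the j-th are initial segments of rows
   1, ..., j-1, and run j is a horizontal strip on top of them. *)
Section RunSlides.

Variables (run : nat -> seq cell) (j : nat).

Definition row_of_last r := [seq x <- run j | x.1 == r].
Definition upper i := [seq x <- run j | i < x.1].
Definition lower i := [seq x <- run j | x.1 <= i].
Definition mid i := flatten [seq run r | r <- iota i.+1 (j.-1 - i)].
(** The length of row [r] in the shape of the first [j] runs, as [width_shape] shows; in row [j]
    only the last run contributes. *)
Definition width r := (if r < j then size (run r) else 0) + size (row_of_last r).

Hypothesis run_sorted : forall r, pairwise reading_lt (run r).
Hypothesis run_row : forall r x, 0 < r < j -> x \in run r -> x.1 = r.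
Hypothesis last_row : forall x, x \in run j -> x.1 <= j.
Hypothesis run_before : forall r x y, 0 < r < j -> x \in run r -> y \in row_of_last r ->
  reading_lt x y.
Hypothesis width_le : forall r, 0 < r < j -> width r.+1 <= size (run r).

Lemma upperS i : upper i = upper i.+1 ++ row_of_last i.+1.
Proof.
apply: reading_sorted_eq; rewrite ?pairwise_cat ?pairwise_filter ?andbT //=.
  by apply/allrelP => x y; rewrite !mem_filter /reading_lt => /andP[xi _] /andP[/eqP-> _]; lia.
by move=> [a b]; rewrite mem_cat !mem_filter -andb_orl /=; congr (_ && _); lia.
Qed.

Lemma upper_lower i : upper i ++ lower i = run j.
Proof.
apply: reading_sorted_eq; rewrite ?pairwise_cat ?pairwise_filter ?andbT //=.
  by apply/allrelP => x y; rewrite !mem_filter /reading_lt => /andP[xi _] /andP[yi _]; lia.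
by move=> [a b]; rewrite mem_cat !mem_filter -andb_orl /=; case: (_ \in run j); lia.
Qed.

Lemma upper_last : 0 < j -> upper j.-1 = row_of_last j.
Proof. by move=> j0; apply: eq_in_filter => -[a b] /last_row /=; lia. Qed.

(** By induction from the top: the cells of run [j] above row [i+1] are at most as many as row [i+2]
    is long, hence at most as many as run [i+1], and the cells of run [j] in row [i+1] complete the
    count. *)
Lemma size_upper i : 0 < i < j -> size (upper i) <= width i.+1.
Proof.
move=> ij; have [k ek] : exists k, j = i.+1 + k by exists (j - i.+1); lia.
elim: k i ij ek => [|k IH] i ij ek.
  have -> : i = j.-1 by lia.
  by rewrite upper_last /width ?prednK ?ltnn //; lia.
rewrite upperS size_cat /width ifT; last by lia.
rewrite leq_add2r; apply: leq_trans (IH _ _ _) _; try lia.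
by apply: width_le; lia.
Qed.

Lemma row_sorted r : 0 < r < j -> pairwise reading_lt (run r ++ row_of_last r).
Proof.
move=> rj; rewrite pairwise_cat run_sorted pairwise_filter // !andbT.
by apply/allrelP => x y xr yr; exact: run_before xr yr.
Qed.

Lemma mem_mid i x : x \in mid i -> exists r, i < r < j /\ x \in run r.
Proof.
by case/flattenP => s /mapP[r]; rewrite mem_iota => ri -> xr; exists r; split=> //; lia.
Qed.

Lemma midS i : i.+1 < j -> mid i = run i.+1 ++ mid i.+1.
Proof. by move=> ij; rewrite /mid; have -> : j.-1 - i = (j.-1 - i.+1).+1 by lia. Qed.

Lemma mid_rows i x : x \in mid i ++ upper i -> 0 < i -> i < x.1.
Proof.
rewrite mem_cat mem_filter => /orP[/mem_mid[r [ri xr]]|/andP[//]] i0.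
by rewrite (run_row _ xr); lia.
Qed.

(** Downward induction on [i]. The block for [i] is the block for [i+1] wrapped into row [i+1]: run
    [i+1] stands before it, the cells of run [j] in that row after it. For [i = j-1] the block is a
    single row. *)
Lemma mid_slidable i : 0 < i < j -> slidable reading_lt (mid i ++ upper i) (width i.+1) (j - i).
Proof.
move=> ij; have [k ek] : exists k, j = i.+1 + k by exists (j - i.+1); lia.
elim: k i ij ek => [|k IH] i ij ek.
  have ei : i = j.-1 by lia.
  have -> : mid i = [::] by rewrite /mid ei subnn.
  have -> : j - i = 1 by lia.
  have -> : width i.+1 = size (upper i).
    by rewrite {2}ei upper_last /width ?ei ?prednK ?ltnn //; lia.
  by rewrite cat0s; apply: slidable_row; exact: pairwise_filter.
have ij' : 0 < i.+1 < j by lia.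
rewrite midS; last by lia.
rewrite upperS.
have -> : j - i = (j - i.+1).+1 by lia.
have -> : width i.+1 = size (run i.+1 ++ row_of_last i.+1).
  by rewrite /width ifT ?size_cat //; lia.
have -> : (run i.+1 ++ mid i.+1) ++ upper i.+1 ++ row_of_last i.+1 =
  run i.+1 ++ (mid i.+1 ++ upper i.+1) ++ row_of_last i.+1 by rewrite -!catA.
apply: (slidable_wrap (IH i.+1 ij' _)) => //.
- lia.
- exact: width_le.
- exact: row_sorted.
apply/allrelP => x y /mid_rows /(_ isT) xi; rewrite mem_cat => yi.
rewrite /reading_lt; suff -> : y.1 = i.+1 by rewrite xi.
by case/orP: yi => [/run_row->|]; rewrite ?mem_filter // => /andP[/eqP].
Qed.

Lemma run_lower_sorted i : 0 < i < j -> pairwise reading_lt (run i ++ lower i).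
Proof.
move=> ij; rewrite pairwise_cat run_sorted pairwise_filter // !andbT.
apply/allrelP => x y xi; rewrite mem_filter => /andP[yi yj].
case: (eqVneq y.1 i) => [ey|ne].
  by apply: run_before xi _ => //; rewrite mem_filter ey eqxx.
by rewrite /reading_lt (run_row ij xi) ltn_neqAle ne yi.
Qed.

(** The block moves from position [size (run i)], where run [j] is still whole, to position [q].
    Both leave [j - i] letters on the right: [q + (j - i) = size (run j) <= size (run i) + size
    (lower i)], and [j - i = size (run j) - q <= size (lower i)] because
    [size (upper i) <= width i.+1 <= q]. *)
Lemma runs_slide i q : 0 < i < j -> width i.+1 <= q -> q + j = size (run j) + i ->
  slides reading_lt (run i ++ mid i ++ run j)
    (take q (run i ++ lower i) ++ mid i ++ upper i ++ drop q (run i ++ lower i)).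
Proof.
move=> ij wq eq; have su := size_upper ij; have wi := width_le ij.
have sz : size (upper i) + size (lower i) = size (run j) by rewrite -size_cat upper_lower.
have := @mid_slidable i ij (run i ++ lower i) (run_lower_sorted ij) _ (size (run i)) q.
rewrite (@take_size_cat _ (size (run i))) // (@drop_size_cat _ (size (run i))) //.
rewrite -!catA upper_lower size_cat.
have l1 : size (run i) + (j - i) <= size (run i) + size (lower i) by lia.
have l2 : q + (j - i) <= size (run i) + size (lower i) by lia.
have l3 : width i.+1 <= size (run i) by [].
apply=> //.
apply/allrelP => x y xU yX; have xi : i < x.1 by apply: mid_rows xU _; lia.
rewrite /reading_lt; suff yi : y.1 <= i by rewrite (leq_ltn_trans yi xi).
by move: yX; rewrite mem_cat => /orP[/run_row->//|]; rewrite mem_filter => /andP[].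
Qed.

End RunSlides.

(** * From slides of cells to moves on reading words *)

Lemma rst_map_in A B (P : A -> Prop) (f : A -> B) R R' :
  (forall x y, R x y -> P x <-> P y) ->
  (forall x y, P x -> R x y -> clos_refl_sym_trans _ R' (f x) (f y)) ->
  forall x y, clos_refl_sym_trans _ R x y -> P x ->
  clos_refl_sym_trans _ R' (f x) (f y).
Proof.
move=> HP H x y xy Px; suff [] : P y /\ clos_refl_sym_trans _ R' (f x) (f y) by [].
suff : (P x <-> P y) /\ (P x -> clos_refl_sym_trans _ R' (f x) (f y)).
  by case=> iP Hf; split; [exact/iP | exact: Hf].
elim: xy {Px} => {x y} [x y xy|x|x y _ [i IH]|x y z _ [i1 IH1] _ [i2 IH2]].
- by split; [exact: HP | move=> Px; exact: H].
- by split=> // _; exact: rst_refl.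
- by split=> [|Py]; [exact: iff_sym | apply/rst_sym/IH/i].
- by split=> [|Px]; [exact: iff_trans i1 i2 | apply: rst_trans (IH1 Px) _; apply/IH2/i1].
Qed.

Lemma index_map_in (T1 T2 : eqType) (f : T1 -> T2) (s : seq T1) x :
  {in s &, injective f} -> x \in s -> index (f x) (map f s) = index x s.
Proof.
elim: s => //= y s IH fi; rewrite inE => /orP[/eqP->|xs]; first by rewrite !eqxx.
have [<-|ne] := eqVneq y x; first by rewrite eqxx.
rewrite ifN; first by rewrite IH // => a b as_ bs; apply: fi; rewrite inE ?as_ ?bs orbT.
by apply: contraNneq ne => /fi ->; rewrite // inE ?eqxx ?xs ?orbT.
Qed.

(** With [C] the cells in reading order and [s] the cells of [1, 2, ...] in this order, this is the
    reading word of the filling. *)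
Definition inv_word (T : eqType) (C s : seq T) : seq nat := [seq (index x s).+1 | x <- C].

Section InvWord.

Variables (T : eqType) (C : seq T) (x0 : T).
Hypothesis uC : uniq C.

Lemma index_inv_word s x : perm_eq s C -> x \in C ->
  index (index x s).+1 (inv_word C s) = index x C.
Proof.
move=> sC xC; apply: (index_map_in (f := fun x => (index x s).+1)) => // a b aC bC.
move=> [/(index_inj x0)].
by apply; rewrite (perm_mem sC).
Qed.

Lemma perm_inv_word s : perm_eq s C -> perm_word (size C) (inv_word C s).
Proof.
move=> sC; have us : uniq s by rewrite (perm_uniq sC).
apply: uniq_perm; [|exact: iota_uniq|].
  rewrite map_inj_in_uniq // => a b aC bC [].
  by apply: (index_inj x0); rewrite (perm_mem sC).
move=> k; rewrite mem_iota add1n ltnS; apply/mapP/idP => [[x xC ->]|].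
  by rewrite -(perm_size sC) index_mem (perm_mem sC).
case: k => // k /= ks; exists (nth x0 s k).
  by rewrite -(perm_mem sC) mem_nth // (perm_size sC).
by rewrite index_uniq // (perm_size sC).
Qed.

(** The four cells carry the entries [k+1, ..., k+4] with [k = size p], so the index is [i = k+2]
    and [i <= n-2] holds. The hypothesis [lt x t] means that [i+1] is not an inverse descent of the
    first word, so [d_i^R] acts as [d_i]. *)
Lemma slide_step_dR_word (lt : rel T) s s' : transitive lt -> sorted lt C -> irreflexive lt ->
  perm_eq s C -> slide_step lt s s' -> dR_step (size C) (inv_word C s) (inv_word C s').
Proof.
move=> tr sortC irr sC [p [y [z [x [t [q [es es' xy yz xt]]]]]]].
split; first exact: perm_inv_word.
have us : uniq s by rewrite (perm_uniq sC).
have ltC a b : a \in C -> b \in C -> lt a b -> index a C < index b C.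
  move=> aC bC ab; case: (ltngtP (index a C) (index b C)) => // [lt_ba|e].
    have := tr _ _ _ ab (sorted_ltn_index tr sortC b a bC aC lt_ba).
    by rewrite irr.
  by move: ab; rewrite (index_inj x0 aC bC e) irr.
have inC a : a \in [:: y; z; x; t] -> a \in C.
  by move=> am; rewrite -(perm_mem sC) es !mem_cat am orbT.
have [yC zC xC tC] : [/\ y \in C, z \in C, x \in C & t \in C].
  by split; apply: inC; rewrite !inE eqxx ?orbT.
have lxy := ltC _ _ xC yC xy; have lyz := ltC _ _ yC zC yz; have lxt := ltC _ _ xC tC xt.
set w := inv_word C s; set k := size p.
have iy : index y s = k by rewrite es index_at // -es.
have iz : index z s = k.+1.
  by rewrite es -cat_rcons index_at ?size_rcons // cat_rcons -es.
have ix : index x s = k.+2.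
  by rewrite es -2!cat_rcons index_at ?size_rcons // !cat_rcons -es.
have it : index t s = k.+3.
  by rewrite es -3!cat_rcons index_at ?size_rcons // !cat_rcons -es.
have Iy : index k.+1 w = index y C by rewrite -iy index_inv_word.
have Iz : index k.+2 w = index z C by rewrite -iz index_inv_word.
have Ix : index k.+3 w = index x C by rewrite -ix index_inv_word.
have It : index k.+4 w = index t C by rewrite -it index_inv_word.
have sz : size s = k + 4 + size q by rewrite es !size_cat /= -/k; clear; lia.
have eD : d_val k.+2 w = swap k.+2 k.+3.
  by rewrite /d_val /between /= Ix Iy Iz lxy lyz orbT.
exists k.+2; split=> //; first by rewrite -(perm_size sC) sz; clear; lia.
have -> : dR_word k.+2 w = d_word k.+2 w.
  rewrite /dR_word ifF //; apply/negbTE; rewrite negb_and; apply/orP; left.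
  by rewrite /inv_des Ix It -leqNgt ltnW.
rewrite /d_word eD /w /inv_word -map_comp; apply/eq_in_map => c cC /=.
have us' : uniq s'.
  suff e : perm_eq s' s by rewrite (perm_uniq e).
  by rewrite es es' perm_cat2l; apply/seq.permP => a /=; clear; lia.
have cs : c \in s by rewrite (perm_mem sC).
have [->|cz] := eqVneq c z.
  rewrite iz /swap eqxx es' -2!cat_rcons index_at ?size_rcons //.
  by rewrite !cat_rcons -es'.
have [->|cx] := eqVneq c x.
  rewrite ix /swap (gtn_eqF (ltnSn k.+2)) ?eqxx.
  by rewrite es' -cat_rcons index_at ?size_rcons // cat_rcons -es'.
have -> : index c s' = index c s.
  rewrite es es' !index_cat /= !(eq_sym _ c) (negPf cz) (negPf cx).
  by rewrite !inE (negPf cz) (negPf cx).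
rewrite /swap !ifN //; rewrite eqSS.
  have xs : x \in s by rewrite (perm_mem sC).
  by rewrite -ix; apply: contraNneq cx => /(index_inj x0 cs xs) ->.
have zs : z \in s by rewrite (perm_mem sC).
by rewrite -iz; apply: contraNneq cz => /(index_inj x0 cs zs) ->.
Qed.

Lemma slides_dR_equiv (lt : rel T) s s' : transitive lt -> sorted lt C -> irreflexive lt ->
  perm_eq s C -> slides lt s s' -> dR_equiv (size C) (inv_word C s) (inv_word C s').
Proof.
move=> tr sortC irr sC ss'.
apply: (rst_map_in (P := fun s => perm_eq s C) (f := inv_word C) _ _ ss') => // u v.
  move=> [p [y [z [x [t [q [-> -> _ _ _]]]]]]].
  suff /permPl -> : perm_eq (p ++ [:: y; z; x; t] ++ q) (p ++ [:: y; x; z; t] ++ q) by [].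
  by rewrite perm_cat2l; apply/seq.permP => a /=; clear; lia.
by move=> uC' uv; apply: rst_step; exact: slide_step_dR_word uv.
Qed.

End InvWord.

Lemma mem_cells la x : (x \in cells la) =
  [&& 0 < x.1, x.1 <= size la, 0 < x.2 & x.2 <= nth 0 la x.1.-1].
Proof.
apply/allpairsPdep/idP => [[i [c [+ + ->]]] /=|/and4P[h1 h2 h3 h4]].
  by rewrite mem_rev !mem_iota; lia.
by exists x.1, x.2; rewrite mem_rev !mem_iota -surjective_pairing; split=> //; lia.
Qed.

Lemma cells_sorted la : pairwise reading_lt (cells la).
Proof.
rewrite /cells; have : pairwise gtn (rev (iota 1 (size la))).
  by rewrite -(sorted_pairwise (rev_trans ltn_trans)) rev_sorted iota_ltn_sorted.
elim: (rev _) => //= i s IH /andP[is_ /IH ps]; rewrite pairwise_cat ps andbT.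
apply/andP; split.
  apply/allrelP => x y /mapP[c _ ->] /allpairsPdep[i' [c' [i's _ ->]]].
  by have := allP is_ _ i's; rewrite /reading_lt /= => ->.
rewrite pairwise_map; apply: sub_pairwise (_ : pairwise ltn _) => [a b|].
  by rewrite /= /reading_lt /= eqxx => ->; rewrite orbT.
by rewrite -(sorted_pairwise ltn_trans) iota_ltn_sorted.
Qed.

Lemma cells_uniq la : uniq (cells la).
Proof.
have := cells_sorted la; rewrite -(sorted_pairwise reading_lt_trans).
exact: sorted_uniq reading_lt_trans reading_lt_irr _.
Qed.

Lemma rw_fill la (g : cell -> nat) :
  rw [seq [seq g (i, c) | c <- iota 1 (nth 0 la i.-1)] | i <- iota 1 (size la)] =
  map g (cells la).
Proof.
rewrite /rw /cells -map_rev; elim: (rev _) => //= i s IH.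
by rewrite map_cat IH -map_comp.
Qed.

Lemma fill_entry (T : tableau) :
  T = [seq [seq entry T (i, c) | c <- iota 1 (nth 0 (shape T) i.-1)]
      | i <- iota 1 (size (shape T))].
Proof.
rewrite size_map; apply: (@eq_from_nth _ [::]); rewrite ?size_map ?size_iota // => i iT.
rewrite (nth_map 0) ?size_iota // nth_iota //= add0n (nth_map [::]) //.
apply: (@eq_from_nth _ 0); rewrite ?size_map ?size_iota // => c cR.
by rewrite (nth_map 0) ?size_iota // nth_iota.
Qed.

Lemma rw_entry T : rw T = map (entry T) (cells (shape T)).
Proof. by rewrite {1}(fill_entry T) rw_fill. Qed.

Lemma rw_of_runs la rs : rw (of_runs la rs) = inv_word (cells la) (flatten rs).
Proof. exact: rw_fill. Qed.

(** * Cells and runs of a standard tableau *)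

Section Syt.

Variables (n : nat) (T : tableau).
Hypothesis hT : is_syt n T.

Let C := cells (shape T).
Let w := rw T.

Lemma syt_perm_word : perm_word n w.
Proof. by case/and5P: hT => pT _ _ _ _; apply: perm_trans (rw_perm T) pT. Qed.

Lemma syt_uniq : uniq w.
Proof. exact: perm_word_uniq syt_perm_word. Qed.

Lemma syt_size : size C = n.
Proof.
by rewrite -[RHS](size_iota 1 n) -(perm_size syt_perm_word) /w rw_entry size_map.
Qed.

Lemma syt_mem v : (v \in w) = (0 < v <= n).
Proof. exact: perm_word_mem syt_perm_word. Qed.

Definition cellof (v : nat) : cell := nth (0, 0) C (index v w).

Definition rowof (v : nat) : nat := (cellof v).1.

Lemma index_w v : 0 < v <= n -> index v w < size C.
Proof. by rewrite -syt_mem -index_mem /w rw_entry size_map. Qed.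

Lemma cellof_in v : 0 < v <= n -> cellof v \in C.
Proof. by move=> vn; rewrite mem_nth // index_w. Qed.

Lemma entry_cellof v : 0 < v <= n -> entry T (cellof v) = v.
Proof.
move=> vn; rewrite /cellof -(nth_map (0, 0) 0 (entry T)) ?index_w //.
by rewrite -rw_entry nth_index ?syt_mem.
Qed.

Lemma entry_range x : x \in C -> 0 < entry T x <= n.
Proof. by move=> xC; rewrite -syt_mem /w rw_entry map_f. Qed.

Lemma entry_inj : {in C &, injective (entry T)}.
Proof.
have := syt_uniq; rewrite /w rw_entry => uw x y xC yC e.
rewrite -(nth_index (0, 0) xC) -(nth_index (0, 0) yC).
have ix : index x C < size (map (entry T) C) by rewrite size_map index_mem.
have iy : index y C < size (map (entry T) C) by rewrite size_map index_mem.
suff -> : index x C = index y C by [].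
apply/eqP; rewrite -(nth_uniq 0 ix iy uw).
rewrite !(nth_map (0, 0)) ?index_mem // !nth_index // e.
by [].
Qed.

Lemma cellof_entry x : x \in C -> cellof (entry T x) = x.
Proof.
move=> xC; apply: entry_inj => //; first exact: cellof_in (entry_range xC).
by rewrite entry_cellof // entry_range.
Qed.

Lemma reading_lt_index u v : 0 < u <= n -> 0 < v <= n ->
  (index u w < index v w) = reading_lt (cellof u) (cellof v).
Proof.
have sC : sorted reading_lt C by rewrite (sorted_pairwise reading_lt_trans); exact: cells_sorted.
move=> un vn; have H a b : 0 < a <= n -> 0 < b <= n -> index a w < index b w ->
    reading_lt (cellof a) (cellof b).
  move=> an bn lt; apply: (sorted_ltn_nth reading_lt_trans (0, 0) sC) => //;
  by rewrite inE index_w.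
case: ltngtP => [/H->//|/H H'|e].
  apply/esym/negbTE/negP => lt; have := reading_lt_trans lt (H' vn un).
  by rewrite reading_lt_irr.
by rewrite /cellof e reading_lt_irr.
Qed.

Lemma entry_row x y : x \in C -> y \in C -> x.1 = y.1 -> x.2 < y.2 -> entry T x < entry T y.
Proof.
case: x => r c; case: y => r' c'; rewrite !mem_cells /= => /and4P[h1 h2 h3 h4].
move=> /and4P[_ _ h5 h6] e lt; subst r'; rewrite /entry /=.
case/and5P: hT => _ _ _ /allP sR _.
have rT : r.-1 < size T by move: h2; rewrite size_map; lia.
rewrite (nth_map [::]) // in h4; rewrite (nth_map [::]) // in h6.
have l2 : c'.-1 < size (nth [::] T r.-1) by rewrite prednK.
have l1 : c.-1 < c'.-1 by rewrite -ltnS !prednK.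
apply: (sorted_ltn_nth ltn_trans 0 (sR _ (mem_nth [::] rT))); rewrite ?inE //.
exact: ltn_trans l2.
Qed.

Lemma entry_below x : x \in C -> 1 < x.1 ->
  (x.1.-1, x.2) \in C /\ entry T (x.1.-1, x.2) < entry T x.
Proof.
case: x => r c; rewrite !mem_cells /= => /and4P[h1 h2 h3 h4] r1.
case/and5P: hT => _ _ sT _ /allP cT; rewrite size_map in h2.
have [k ek] : exists k, r = k.+2 by exists r.-2; lia.
subst r; rewrite /= in h4 *.
have le : nth 0 (shape T) k.+1 <= nth 0 (shape T) k.
  have gtr : transitive geq by move=> a b c' ab bc; exact: leq_trans bc ab.
  apply: (sorted_leq_nth gtr leqnn 0 sT); rewrite ?inE ?size_map //; lia.
split; first by rewrite size_map; apply/andP; split; lia.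
rewrite (nth_map [::]) // in h4.
have := cT k; rewrite mem_iota => /(_ _)/allP /(_ c.-1); rewrite mem_iota; apply; lia.
Qed.

Lemma rowof_nondes v : 0 < v < n -> ~~ inv_des w v -> rowof v.+1 <= rowof v.
Proof.
move=> vn; rewrite /inv_des reading_lt_index; [|lia|lia].
by rewrite /reading_lt negb_or -leqNgt => /andP[].
Qed.

Lemma rowof_des v : 0 < v < n -> inv_des w v -> rowof v < rowof v.+1.
Proof.
move=> vn; rewrite /inv_des reading_lt_index; [|lia|lia].
rewrite /reading_lt => /orP[//|/andP[/eqP e lt]].
have v0 : 0 < v <= n by lia.
have v1 : 0 < v.+1 <= n by lia.
have := entry_row (cellof_in v1) (cellof_in v0) e lt.
by rewrite !entry_cellof // ltnNge leqnSn.
Qed.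

Lemma rowof1 : 0 < n -> rowof 1 = 1.
Proof.
move=> n0; have n1 : 0 < 1 <= n by lia.
have := cellof_in n1; rewrite mem_cells => /and4P[r1 _ _ _].
apply/eqP; rewrite eqn_leq r1 andbT leqNgt; apply/negP => lt.
have [c1 lt'] := entry_below (cellof_in n1) lt.
by have := entry_range c1; move: lt'; rewrite entry_cellof //; lia.
Qed.

Lemma rowof_below v : 0 < v <= n -> 1 < rowof v -> exists2 u, 0 < u < v & (rowof u).+1 = rowof v.
Proof.
move=> vn lt; have [c1 lt'] := entry_below (cellof_in vn) lt.
exists (entry T ((cellof v).1.-1, (cellof v).2)).
  by move: lt'; rewrite entry_cellof // => ->; case/andP: (entry_range c1) => ->.
by rewrite /rowof cellof_entry //= prednK // ltnW.
Qed.

End Syt.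

Lemma sorted_map_iota (T : Type) (e : rel T) (f : nat -> T) a m :
  (forall v, a < v < a + m -> e (f v) (f v.+1)) -> sorted e (map f (iota a.+1 m)).
Proof.
case: m => // m; elim: m a => //= m IH a H; rewrite H; last by lia.
by apply: IH => v va; apply: H; lia.
Qed.

Section Runs.

Variables (n : nat) (T : tableau).
Hypothesis hT : is_syt n T.

Let C := cells (shape T).
Let w := rw T.
Let b := brk T.
Let cell_of := cellof T.

Lemma size_w : size w = n.
Proof. by rewrite (perm_size (syt_perm_word hT)) size_iota. Qed.

Lemma brk_sorted : sorted ltn (breaks T).
Proof.
rewrite /breaks /= (path_sortedE ltn_trans) sorted_filter ?iota_ltn_sorted ?andbT //.
  by apply/allP => v; rewrite mem_filter mem_iota => /andP[_] /andP[].
exact: ltn_trans.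
Qed.

Lemma size_breaks : size (breaks T) = (nruns T).+1.
Proof. by []. Qed.

Lemma brk_ltn r s : r < s -> s <= nruns T -> b r < b s.
Proof.
move=> rs sn; apply: (sorted_ltn_nth ltn_trans 0 brk_sorted) => //; rewrite inE size_breaks ltnS //.
exact: leq_trans (ltnW rs) sn.
Qed.

Lemma brk_leq r s : r <= s -> s <= nruns T -> b r <= b s.
Proof. by rewrite leq_eqVlt => /orP[/eqP->//|rs] sn; apply/ltnW/brk_ltn. Qed.

Lemma mem_breaks v : (v \in breaks T) = (v == 0) || ((0 < v <= n) && (inv_des w v || (v == n))).
Proof.
by rewrite inE mem_filter mem_iota -/w size_w add1n ltnS [X in _ || X]andbC.
Qed.

Lemma brk_range r : 0 < r <= nruns T -> 0 < b r <= n.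
Proof.
move=> /andP[r0 rn]; have b0 : 0 < b r by exact: (brk_ltn r0 rn).
have : b r \in breaks T by rewrite mem_nth.
by rewrite mem_breaks eqn0Ngt b0 => /= /andP[].
Qed.

Lemma brk_le_n r : r <= nruns T -> b r <= n.
Proof. by case: r => // r rn; case/andP: (brk_range (r := r.+1) rn). Qed.

Lemma brk_des r : 0 < r < nruns T -> inv_des w (b r).
Proof.
move=> /andP[r0 rn]; have b0 : 0 < b r by exact: (brk_ltn r0 (ltnW rn)).
have : b r \in breaks T by rewrite mem_nth // size_breaks ltnS ltnW.
rewrite mem_breaks eqn0Ngt b0 => /= /andP[_ /orP[//|/eqP e]].
by have := leq_trans (brk_ltn (ltnSn r) rn) (brk_le_n rn); rewrite e ltnn.
Qed.

Lemma run_nondes r v : r < nruns T -> b r < v < b r.+1 -> ~~ inv_des w v.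
Proof.
move=> rn /andP[v1 v2]; apply/negP => dv.
have : v \in breaks T.
  rewrite mem_breaks dv /= andbT; apply/orP; right.
  by rewrite (leq_ltn_trans _ v1) //= ltnW // (leq_trans v2) // brk_le_n.
move=> /(nthP 0)[s sn ev]; rewrite -ev in v1 v2.
have [le|lt] := leqP s r.
  by have := leq_trans v1 (brk_leq le (ltnW rn)); rewrite ltnn.
by have := leq_trans v2 (brk_leq lt sn); rewrite ltnn.
Qed.

Lemma brk_last : 0 < n -> b (nruns T) = n.
Proof.
move=> n0; have : n \in breaks T by rewrite mem_breaks n0 leqnn eqxx orbT /= orbT.
move=> /(nthP 0)[s sn es]; apply/eqP; rewrite eqn_leq brk_le_n //=.
by rewrite -es; apply: (brk_leq (r := s)).
Qed.

Definition in_run r v := b r.-1 < v <= b r.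

Lemma in_run_exists k v : k <= nruns T -> 0 < v <= b k ->
  exists2 r, 0 < r <= k & in_run r v.
Proof.
elim: k => [|k IH] knuth_step /andP[v0 vk]; first by rewrite leqNgt v0 in vk.
have [le|lt] := leqP v (b k).
  have [||r rk vr] := IH; rewrite ?v0 ?(ltnW knuth_step) //; exists r => //.
  by case/andP: rk => -> /leqW.
by exists k.+1; rewrite ?leqnn // /in_run lt vk.
Qed.

Lemma in_run_range r v : 0 < r <= nruns T -> in_run r v -> 0 < v <= n.
Proof.
move=> /andP[r0 rn] /andP[v1 v2]; rewrite (leq_ltn_trans _ v1) //=.
exact: leq_trans v2 (brk_le_n rn).
Qed.

Lemma run_pairwise r : pairwise reading_lt (run T r).
Proof. exact/pairwise_filter/cells_sorted. Qed.

Lemma run_mem r x : (x \in run T r) = (x \in C) && in_run r (entry T x).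
Proof. by rewrite mem_filter andbC. Qed.

Lemma run_cellof r v : 0 < r <= nruns T -> in_run r v -> cell_of v \in run T r.
Proof.
move=> rn vr; have vn := in_run_range rn vr.
by rewrite run_mem (cellof_in hT vn) (entry_cellof hT vn).
Qed.

Lemma runP r x : 0 < r <= nruns T -> x \in run T r -> exists2 v, in_run r v & x = cell_of v.
Proof.
move=> rn; rewrite run_mem => /andP[xC xr]; exists (entry T x) => //.
by rewrite /cell_of (cellof_entry hT).
Qed.

(** There is no inverse descent strictly inside a run, so consecutive entries follow each other in
    reading order. Hence the concatenated runs, each in reading order, list the cells of
    [1, ..., n]. *)
Lemma run_map r : 0 < r <= nruns T ->
  run T r = map cell_of (iota (b r.-1).+1 (b r - b r.-1)).
Proof.
case: r => // r /= rn; have lb := brk_ltn (ltnSn r) rn.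
apply: reading_sorted_eq; first exact: run_pairwise.
  rewrite -(sorted_pairwise reading_lt_trans); apply: sorted_map_iota => v.
  rewrite subnKC ?(ltnW lb) // => vb.
  have vn : 0 < v < n.
    case/andP: vb => v1 v2; rewrite (leq_ltn_trans _ v1) //=.
    exact: leq_trans v2 (brk_le_n rn).
  have [vn1 vn2] : 0 < v <= n /\ 0 < v.+1 <= n by clear -vn; lia.
  have := run_nondes rn vb; rewrite /inv_des (reading_lt_index hT) //.
  move=> nlt; have ne : cell_of v != cell_of v.+1.
    apply/eqP => /(congr1 (entry T)); rewrite !(entry_cellof hT) // => /eqP.
    by rewrite (ltn_eqF (ltnSn v)).
  move: nlt ne; rewrite -/cell_of; case: (cell_of v) (cell_of v.+1) => [x y] [x' y'].
  by rewrite /reading_lt xpair_eqE /=; clear; lia.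
move=> x; apply/idP/mapP => [/(runP (r := r.+1) rn)[v vr ->]|[v]].
  by exists v => //; rewrite mem_iota addSn ltnS subnKC // ltnW.
rewrite mem_iota addSn ltnS subnKC ?(ltnW lb) // => vr ->.
exact: run_cellof.
Qed.

Lemma size_run r : 0 < r <= nruns T -> size (run T r) = beta T r.
Proof. by move=> rn; rewrite run_map // size_map size_iota. Qed.

Lemma flatten_runs k : k <= nruns T ->
  flatten [seq run T r | r <- iota 1 k] = map cell_of (iota 1 (b k)).
Proof.
elim: k => // k IH knuth_step.
have -> : iota 1 k.+1 = iota 1 k ++ [:: k.+1] by rewrite -(addn1 k) iotaD add1n addn1.
rewrite map_cat flatten_cat IH; last exact: ltnW.
rewrite /= cats0 run_map //= -map_cat.
by rewrite -(add1n (b k)) -iotaD subnKC // ltnW // brk_ltn.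
Qed.

Lemma flatten_all_runs : flatten [seq run T r | r <- iota 1 (nruns T)] = map cell_of (iota 1 n).
Proof.
rewrite flatten_runs //; case: (posnP n) => [n0|n0]; last by rewrite brk_last.
by have := brk_le_n (leqnn (nruns T)); rewrite n0 leqn0 => /eqP->.
Qed.

Lemma runs_perm : perm_eq (flatten [seq run T r | r <- iota 1 (nruns T)]) C.
Proof.
rewrite flatten_all_runs; apply: uniq_perm; last 1 first.
- move=> x; apply/mapP/idP => [[v]|xC].
    by rewrite mem_iota add1n ltnS => vn ->; exact: (cellof_in hT vn).
  exists (entry T x); last by rewrite /cell_of (cellof_entry hT).
  by rewrite mem_iota add1n ltnS (entry_range hT).
- rewrite map_inj_in_uniq ?iota_uniq // => u v.
  rewrite !mem_iota !add1n !ltnS => un vn /(congr1 (entry T)).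
  by rewrite !(entry_cellof hT).
- exact: cells_uniq.
Qed.

Lemma rw_runs : rw T = inv_word C (flatten [seq run T r | r <- iota 1 (nruns T)]).
Proof.
rewrite rw_entry; apply/eq_in_map => x xC; rewrite flatten_all_runs.
have en := entry_range hT xC.
rewrite -{2}(cellof_entry hT xC) (index_map_in (f := cell_of)).
- case/andP: en; case: (entry T x) => // v _ vn; congr S.
  by rewrite -[LHS](index_uniq 0 (_ : v < size (iota 1 n)) (iota_uniq 1 n))
    ?nth_iota ?size_iota.
- move=> u v; rewrite !mem_iota !add1n !ltnS => un vn /(congr1 (entry T)).
  by rewrite !(entry_cellof hT).
- by rewrite mem_iota add1n ltnS.
Qed.

End Runs.

(** * Superstandard initial runs *)

Definition lexlt (x y : cell) : bool := (x.1 < y.1) || ((x.1 == y.1) && (x.2 < y.2)).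

Lemma lexlt_trans : transitive lexlt.
Proof. by move=> [a b] [c e] [f g]; rewrite /lexlt /=; lia. Qed.

Lemma flatten_entry T : flatten T =
  map (entry T) [seq (i, c) | i <- iota 1 (size (shape T)), c <- iota 1 (nth 0 (shape T) i.-1)].
Proof.
rewrite {1}(fill_entry T); elim: (iota 1 _) => //= i s IH.
by rewrite map_cat -map_comp IH.
Qed.

Lemma lex_cells_sorted la :
  pairwise lexlt [seq (i, c) | i <- iota 1 (size la), c <- iota 1 (nth 0 la i.-1)].
Proof.
have : pairwise ltn (iota 1 (size la)).
  by rewrite -(sorted_pairwise ltn_trans) iota_ltn_sorted.
elim: (iota 1 (size la)) => //= i s IH /andP[is_ /IH ps]; rewrite pairwise_cat ps andbT.
apply/andP; split.
  apply/allrelP => x y /mapP[c _ ->] /allpairsPdep[i' [c' [i's _ ->]]].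
  by have := allP is_ _ i's; rewrite /lexlt /= => ->.
rewrite pairwise_map; apply: sub_pairwise (_ : pairwise ltn _) => [a b|].
  by rewrite /= /lexlt /= eqxx => ->; rewrite orbT.
by rewrite -(sorted_pairwise ltn_trans) iota_ltn_sorted.
Qed.

Lemma flatten_restr T b : flatten (restr T b) = [seq x <- flatten T | x <= b].
Proof.
rewrite filter_flatten /restr; elim: T => //= R T IH; case: ifPn => [_|/negPn/eqP e] /=.
  by rewrite IH.
by rewrite IH e.
Qed.

(** Applied to a restricted tableau, whose empty rows all lie on top, so that deleting them does not
    renumber the others. *)
Lemma nth_filter_prefix (L : seq (seq nat)) i :
  (forall k, nth [::] L k = [::] -> nth [::] L k.+1 = [::]) ->
  nth [::] [seq R <- L | R != [::]] i = nth [::] L i.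
Proof.
elim: L i => //= R L IH i H; case: ifPn => [R0|/negPn/eqP R0].
  by case: i => //= i; apply: IH => k; exact: (H k.+1).
have all0 k : nth [::] L k = [::].
  by elim: k => [|k]; [exact: (H 0) | exact: (H k.+1)].
have -> : [seq R <- L | R != [::]] = [::].
  apply/eqP; rewrite -(negbK (_ == _)) -has_filter; apply/hasPn => S /(nthP [::])[k _ <-].
  by rewrite all0.
by rewrite nth_nil; case: i => //= i; rewrite all0.
Qed.

Section Super.

Variables (n : nat) (T : tableau).
Hypothesis hT : is_syt n T.

Let C := cells (shape T).
Let w := rw T.
Let b := brk T.
Let row := rowof T.

Definition rows_mono m := forall v, 0 < v -> v < m -> row v <= row v.+1.

Lemma rows_monoP m u v : rows_mono m -> 0 < u -> u <= v -> v <= m -> row u <= row v.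
Proof.
move=> H u0; elim: v => [|v IH]; first by rewrite leqn0 => /eqP e; rewrite e in u0.
rewrite leq_eqVlt => /orP[/eqP->//|uv] vm.
by apply: leq_trans (IH uv (ltnW vm)) (H _ _ vm); exact: leq_trans u0 uv.
Qed.

Lemma lex_cell x : (x \in [seq (i, c) | i <- iota 1 (size (shape T)),
    c <- iota 1 (nth 0 (shape T) i.-1)]) = (x \in C).
Proof.
apply/allpairsPdep/allpairsPdep => -[i [c [h1 h2 ->]]]; exists i, c; split=> //.
  by rewrite mem_rev.
by rewrite mem_rev in h1.
Qed.

Lemma row_entry x : x \in C -> row (entry T x) = x.1.
Proof. by move=> xC; rewrite /row /rowof (cellof_entry hT). Qed.

Lemma filter_sorted m : rows_mono m -> sorted ltn [seq x <- flatten T | x <= m].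
Proof.
move=> mono; rewrite (sorted_pairwise ltn_trans) flatten_entry filter_map pairwise_map.
set L := [seq x <- _ | _].
have LC x : x \in L -> x \in C /\ entry T x <= m.
  by rewrite mem_filter lex_cell => /andP[].
have : pairwise lexlt L by apply/pairwise_filter/lex_cells_sorted.
elim: L LC => //= x L IH LC /andP[xL pL]; rewrite IH ?andbT //; last first.
  by move=> y yL; apply: LC; rewrite inE yL orbT.
have [xC xm] := LC x (mem_head _ _).
apply/allP => y yL; have := allP xL y yL; have [yC ym] := LC y (mem_behead (s := x :: L) yL).
rewrite /= => lex; rewrite ltnNge leq_eqVlt negb_or; apply/andP; split.
  apply: contraTneq lex => /(entry_inj hT yC xC) ->.
  by rewrite /lexlt ltnn eqxx ltnn.
apply/negP => lt.
have rxy := rows_monoP mono (proj1 (andP (entry_range hT yC))) (ltnW lt) xm.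
rewrite !row_entry // in rxy.
case/orP: lex => [lt1|/andP[/eqP e lt2]]; first by rewrite ltnNge rxy in lt1.
by have := ltn_trans lt (entry_row hT xC yC e lt2); rewrite ltnn.
Qed.

(** A superstandard tableau is one whose rows, read from bottom to top by [flatten], give
    [1, 2, ...] in order. Positions in [flatten] follow [lexlt], which compares rows first, and
    within a row entries increase anyway. *)
Lemma superP r : r <= nruns T -> reflect (rows_mono (b r)) (~~ not_super T r).
Proof.
move=> rn; rewrite /not_super negbK; have bn := brk_le_n hT rn; rewrite -/b in bn.
apply: (iffP eqP) => [e|mono].
  have ef : [seq x <- flatten T | x <= b r] = iota 1 (sumn (shape (first_runs T r))).
    by rewrite -flatten_restr -/(first_runs T r) {1}e reshapeKr // size_iota.
  move=> v v0 vb; rewrite leqNgt; apply/negP => lt.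
  have vn : 0 < v <= n by rewrite v0 (leq_trans (ltnW vb)).
  have vn1 : 0 < v.+1 <= n by rewrite (leq_trans vb).
  have inF u : 0 < u <= n -> u <= b r -> u \in [seq x <- flatten T | x <= b r].
    by move=> un ub; rewrite mem_filter ub -(perm_mem (rw_perm T)) (syt_mem hT).
  have : index v [seq x <- flatten T | x <= b r] < index v.+1 [seq x <- flatten T | x <= b r].
    move: (inF v vn (ltnW vb)) (inF _ vn1 vb); rewrite ef => h1 h2.
    rewrite ltnNge leq_eqVlt negb_or; apply/andP; split.
      apply/eqP => /(index_inj 0 h2 h1) /eqP; by rewrite eqn_leq ltnn.
    apply/negP => lt'.
    by have := sorted_ltn_index ltn_trans (iota_ltn_sorted _ _) _ _ h2 h1 lt';
       rewrite /= ltnNge leqnSn.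
  rewrite index_filter_lt //; last exact: ltnW.
  set L := [seq (i, c) | i <- iota 1 (size (shape T)), c <- iota 1 (nth 0 (shape T) i.-1)].
  have idx u : 0 < u <= n -> index u (flatten T) = index (cellof T u) L.
    move=> un; rewrite flatten_entry -{1}(entry_cellof hT un) index_map_in //.
      by move=> x y; rewrite !lex_cell => xC yC; exact: (entry_inj hT).
    by rewrite lex_cell (cellof_in hT).
  rewrite !idx // => ltL.
  have sL : sorted lexlt L by rewrite (sorted_pairwise lexlt_trans); exact: lex_cells_sorted.
  have := sorted_ltn_index lexlt_trans sL _ _ _ _ ltL.
  rewrite !lex_cell !(cellof_in hT) // => /(_ isT isT) /orP[lt'|/andP[/eqP e' _]].
    by have := ltn_trans lt lt'; rewrite ltnn.
  by move: lt; rewrite /row /rowof e' ltnn.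
have ef : flatten (first_runs T r) = iota 1 (b r).
  rewrite flatten_restr -/b; apply: (irr_sorted_eq ltn_trans ltnn).
  - exact: filter_sorted.
  - exact: iota_ltn_sorted.
  - move=> v; rewrite mem_filter -(perm_mem (rw_perm T)) (syt_mem hT) mem_iota add1n ltnS.
    by rewrite andbC -andbA [(v <= n) && _]andb_idl // => /leq_trans; apply.
rewrite -[LHS]flattenK /superstandard -size_flatten ef size_iota.
by [].
Qed.

End Super.

(** * Position of the first runs, and relinking *)

Section Relink.

Variables (n : nat) (T : tableau) (j : nat).
Hypothesis hT : is_syt n T.
Hypothesis j_range : 1 < j <= nruns T.

Let C := cells (shape T).
Let w := rw T.
Let b := brk T.
Let row := rowof T.

Hypothesis mono : rows_mono T (b j.-1).

Let jn : j <= nruns T. Proof. by case/andP: j_range. Qed.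
Let j1 : 1 < j. Proof. by case/andP: j_range. Qed.
Let j0 : 0 < j. Proof. exact: ltnW. Qed.

Let early_range r : 0 < r < j -> 0 < r <= nruns T.
Proof. by case/andP=> -> rj; rewrite (leq_trans (ltnW rj)). Qed.

Let last_range : 0 < j <= nruns T. Proof. by rewrite j0. Qed.

Lemma brk_early r : r < j -> b r <= b j.-1.
Proof. by move=> rj; apply: brk_leq; [rewrite -ltnS prednK | exact: leq_trans (leq_pred _) jn]. Qed.

(** Inside a run the rows weakly decrease, and in the superstandard part they weakly increase. *)
Lemma row_const r v : r.+1 < j -> b r < v <= b r.+1 -> row v = row (b r).+1.
Proof.
move=> rj; elim: v => [|v IH] /andP[v1 v2] //; move: v1; rewrite ltnS leq_eqVlt.
case/orP=> [/eqP->//|v1]; rewrite -IH ?v1 ?(ltnW v2) //.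
have bn := brk_le_n hT (leq_trans (ltnW rj) jn).
have rn : r < nruns T by exact: leq_trans (ltnW rj) jn.
apply/eqP; rewrite eqn_leq; apply/andP; split.
  apply: (rowof_nondes hT); first by rewrite (leq_ltn_trans _ v1) //= (leq_trans v2).
  by apply: (run_nondes hT) rn _; rewrite v1.
apply: mono; first by rewrite (leq_ltn_trans _ v1).
exact: leq_trans v2 (brk_early rj).
Qed.

(** A descent leads to a strictly higher row. The cell below the new one holds a smaller entry,
    which by monotonicity is no higher than the last entry of the previous run; so exactly one row
    is gained. *)
Lemma row_start r : r.+1 < j -> row (b r).+1 = r.+1.
Proof.
elim: r => [|r IH] rj.
  apply: (rowof1 hT); have /andP[b0 bn] := brk_range hT last_range.
  exact: leq_trans b0 bn.
have rn : 0 < r.+1 < nruns T by rewrite /= (leq_trans (ltnW rj) jn).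
have lb : b r < b r.+1 by apply: (brk_ltn (ltnSn r)); exact: ltnW.
have rj' : r.+1 < j := ltnW rj.
have e : row (b r.+1) = r.+1 by rewrite (row_const rj') ?lb ?leqnn // IH.
have vn : 0 < b r.+1 < n.
  rewrite (leq_ltn_trans _ lb) //.
  exact: leq_trans (brk_ltn (ltnSn r.+1) (proj2 (andP rn))) (brk_le_n hT (proj2 (andP rn))).
have := rowof_des hT vn (brk_des hT rn); rewrite -/row e => lt.
have vn1 : 0 < (b r.+1).+1 <= n by case/andP: vn.
have [|u /andP[u0 uv] eu] := rowof_below hT vn1; first exact: leq_ltn_trans lt.
have : row u <= r.+1.
  by rewrite -e; apply: (rows_monoP mono) => //; apply: brk_early; exact: ltnW.
rewrite -/row in eu; rewrite -eu ltnS in lt *.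
by move=> h2; apply/eqP; rewrite eqSS eqn_leq h2.
Qed.

Lemma row_run r v : 0 < r < j -> in_run T r v -> row v = r.
Proof.
by case: r => // r /= rj vr; rewrite (row_const rj vr) row_start.
Qed.

Lemma row_early v : 0 < v <= b j.-1 -> 0 < row v < j /\ in_run T (row v) v.
Proof.
move=> vb; have [|r /andP[r0 rj] vr] := in_run_exists (k := j.-1) _ vb.
  exact: leq_trans (leq_pred _) jn.
have rj' : 0 < r < j by rewrite r0 -ltnS prednK in rj *.
by rewrite (row_run rj' vr).
Qed.

Lemma row_last u v : in_run T j u -> in_run T j v -> u <= v -> row v <= row u.
Proof.
move=> uj; elim: v => [|v IH] vj; first by rewrite leqn0 => /eqP->.
rewrite leq_eqVlt => /orP[/eqP->//|uv].
have [u1 u2] := andP uj; have [v1 v2] := andP vj.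
have bv : b j.-1 < v by exact: leq_trans u1 uv.
have vj' : in_run T j v by rewrite /in_run bv (ltnW v2).
apply: leq_trans (IH vj' uv); apply: (rowof_nondes hT).
  by rewrite (leq_ltn_trans _ bv) //= (leq_trans v2) // (brk_le_n hT).
apply: (run_nondes hT (r := j.-1)); rewrite prednK //.
by rewrite bv.
Qed.

(** Below a cell in a row above [j] there is a smaller entry in a row at least [j]. This is too high
    for an earlier run, and in run [j], where rows weakly decrease, an earlier entry cannot be
    lower. *)
Lemma row_le_last v : in_run T j v -> row v <= j.
Proof.
move=> vj; rewrite leqNgt; apply/negP => lt.
have [|u /andP[u0 uv] eu] := rowof_below hT (in_run_range hT last_range vj).
  exact: ltn_trans lt.
have ju : j <= row u by rewrite -ltnS eu.
have [le|gt] := leqP u (b j.-1).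
  have [/andP[_ h] _] := row_early (introT andP (conj u0 le)).
  by rewrite ltnNge ju in h.
have uj : in_run T j u by rewrite /in_run gt (leq_trans (ltnW uv)) //; case/andP: vj.
by have := row_last uj vj (ltnW uv); rewrite /row -eu ltnn.
Qed.

Lemma run_early_row r x : 0 < r < j -> x \in run T r -> x.1 = r.
Proof.
by move=> rj /(runP hT (early_range rj))[v vr ->]; exact: row_run rj vr.
Qed.

Lemma run_last_row x : x \in run T j -> x.1 <= j.
Proof. by move=> /(runP hT last_range)[v vj ->]; exact: row_le_last. Qed.

Lemma mem_row_of_last r x : (x \in row_of_last (run T) j r) = (x.1 == r) && (x \in run T j).
Proof. exact: mem_filter. Qed.

Lemma mem_lower i x : (x \in lower (run T) j i) = (x.1 <= i) && (x \in run T j).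
Proof. exact: mem_filter. Qed.

Lemma mem_upper i x : (x \in upper (run T) j i) = (i < x.1) && (x \in run T j).
Proof. exact: mem_filter. Qed.

Lemma run_early_before r x y : 0 < r < j -> x \in run T r -> y \in row_of_last (run T) j r ->
  reading_lt x y.
Proof.
move=> rj xr; rewrite mem_row_of_last => /andP[/eqP y1 yj].
have x1 := run_early_row rj xr.
move: xr yj; rewrite !run_mem => /andP[xC /andP[_ xr]] /andP[yC /andP[yj _]].
have rb : b r <= b j.-1 by apply: brk_early; case/andP: rj.
have lt : entry T x < entry T y by exact: leq_ltn_trans xr (leq_ltn_trans rb yj).
rewrite /reading_lt x1 y1 ltnn eqxx /=; case: ltngtP => // [gt|e].
  have := entry_row hT yC xC _ gt; rewrite x1 y1 => /(_ erefl) lt'.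
  by have := ltn_trans lt lt'; rewrite ltnn.
have exy : x = y by rewrite (surjective_pairing x) (surjective_pairing y) x1 y1 e.
by rewrite exy ltnn in lt.
Qed.

(** Run [j] is a horizontal strip: its rows weakly decrease as entries grow, so none of its cells
    rests on another. The cell below thus belongs to an earlier run, whose number is its row. *)
Lemma below_in_run r x : 0 < r < j -> x \in C -> x.1 = r.+1 -> entry T x <= b j ->
  (r, x.2) \in run T r.
Proof.
move=> rj xC x1 xb; have [|yC lt] := entry_below hT xC; first by rewrite x1 ltnS; case/andP: rj.
rewrite x1 /= in yC lt; set y := (r, x.2) in yC lt *.
have yn := entry_range hT yC; have ry := row_entry hT yC; have rx := row_entry hT xC.
rewrite -/row in ry rx; rewrite run_mem yC /=.
have [le|gt] := leqP (entry T y) (b j.-1).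
  by have [_] := row_early (introT andP (conj (proj1 (andP yn)) le)); rewrite ry.
have yj : in_run T j (entry T y) by rewrite /in_run gt (leq_trans (ltnW lt)).
have xj : in_run T j (entry T x) by rewrite /in_run xb (ltn_trans gt).
by have := row_last yj xj (ltnW lt); rewrite ry rx x1 ltnn.
Qed.

Definition low_row r := (if r < j then run T r else [::]) ++ row_of_last (run T) j r.

Lemma size_low_row r : size (low_row r) = width (run T) j r.
Proof. by rewrite /low_row size_cat /width; case: ifP. Qed.

Lemma low_row_uniq r : 0 < r -> uniq (low_row r).
Proof.
move=> r0; apply: (sorted_uniq reading_lt_trans reading_lt_irr).
rewrite (sorted_pairwise reading_lt_trans).
rewrite /low_row; case: ifP => rj; last exact/pairwise_filter/run_pairwise.
apply: row_sorted; rewrite ?r0 //.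
- exact: run_pairwise.
- exact: run_early_before.
Qed.

Lemma mem_low_row r x : 0 < r <= j ->
  (x \in low_row r) = [&& x \in C, x.1 == r & entry T x <= b j].
Proof.
move=> /andP[r0 rj]; rewrite mem_cat mem_row_of_last.
apply/orP/and3P => [[|/andP[xr]]|[xC xr xb]].
- case: ifP => // rj' xr; have := xr; rewrite run_mem => /andP[xC /andP[_ xb]].
  rewrite (run_early_row _ xr) ?r0 // eqxx; split=> //.
  by apply: leq_trans xb _; exact: brk_leq.
- by rewrite run_mem xr => /andP[xC /andP[_ xb]].
- have [le|gt] := leqP (entry T x) (b j.-1).
    have [h1 h2] := row_early (introT andP (conj (proj1 (andP (entry_range hT xC))) le)).
    move: h1 h2; rewrite /row (row_entry hT xC) (eqP xr) => /andP[_ ->] h2; left.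
    by rewrite run_mem xC.
  by right; rewrite xr run_mem xC /= /in_run gt.
Qed.

(** Moving the cells of row [r+1] one step down is injective and lands in run [r]. *)
Lemma width_early r : 0 < r < j -> width (run T) j r.+1 <= size (run T r).
Proof.
move=> rj; rewrite -size_low_row.
have r1j : 0 < r.+1 <= j by case/andP: rj.
rewrite -(size_map (fun x : cell => (x.1.-1, x.2))); apply: uniq_leq_size.
  rewrite map_inj_in_uniq ?low_row_uniq // => -[x1 x2] [y1 y2].
  rewrite !mem_low_row //= => /and3P[_ /eqP-> _] /and3P[_ /eqP-> _] [->].
  by [].
move=> y /mapP[x]; rewrite mem_low_row // => /and3P[xC /eqP x1 xb] ->.
by rewrite x1; exact: below_in_run.
Qed.

Lemma width_shape r : 0 < r <= j ->
  nth 0 (shape (first_runs T j)) r.-1 = width (run T) j r.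
Proof.
move=> rj; rewrite -size_low_row /first_runs /restr -/b.
set L := [seq [seq x <- R | x <= b j] | R <- T].
have nL k : nth [::] L k = [seq x <- nth [::] T k | x <= b j].
  have [kT|kT] := ltnP k (size T); first by rewrite (nth_map [::]).
  by rewrite !nth_default ?size_map.
have inT k c : c < size (nth [::] T k) -> (k.+1, c.+1) \in C.
  move=> ck; have kT : k < size T by rewrite ltnNge; apply: contraL ck => kT; rewrite nth_default.
  by rewrite mem_cells /= size_map kT (nth_map [::]).
(* Columns increase, so above a row without small entries there are none either, and [restr] drops
   only top rows. *)
have pre k : nth [::] L k = [::] -> nth [::] L k.+1 = [::].
  rewrite !nL => e; apply/eqP; rewrite -(negbK (_ == _)) -has_filter; apply/hasPn.
  move=> v /(nthP 0)[c ck ev]; apply/negP => vb.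
  have [//|yC lt] := entry_below hT (inT _ _ ck); rewrite /= in yC lt.
  have : entry T (k.+1, c.+1) \in [::].
    rewrite -e mem_filter (leq_trans (ltnW lt)) //=; last by rewrite /entry /= ev.
    move: yC; rewrite mem_cells /= size_map => /andP[k1]; rewrite (nth_map [::]) // => ck1.
    by rewrite /entry /=; exact: mem_nth.
  by [].
transitivity (size (nth [::] L r.-1)).
  rewrite -(nth_filter_prefix _ pre).
  have [h|h] := ltnP r.-1 (size [seq R <- L | R != [::]]); first by rewrite (nth_map [::]).
  by rewrite !nth_default ?size_map.
rewrite nL -(size_map (entry T) (low_row r)); apply/perm_size/uniq_perm.
- apply: filter_uniq; have [rT|rT] := ltnP r.-1 (size T); last by rewrite nth_default.
  case/and5P: hT => _ _ _ /allP sR _.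
  exact: (sorted_uniq ltn_trans ltnn (sR _ (mem_nth [::] rT))).
- rewrite map_inj_in_uniq ?low_row_uniq; [by []|by case/andP: rj|].
  move=> x y; rewrite !mem_low_row // => /and3P[xC _ _] /and3P[yC _ _].
  exact: (entry_inj hT).
have r0 : 0 < r by case/andP: rj.
move=> v; rewrite mem_filter; apply/andP/mapP => [[vb /(nthP 0)[c cr ev]]|[x]].
  exists (r, c.+1); last by rewrite /entry.
  by rewrite mem_low_row //= -{1}(prednK r0) inT //= eqxx /entry /= ev.
rewrite mem_low_row // => /and3P[xC /eqP x1 xb] ->; split=> //.
move: xC; rewrite mem_cells x1 => /and4P[_ rT x20]; rewrite size_map in rT.
rewrite (nth_map [::]); last by rewrite prednK.
by move=> xr; rewrite /entry x1; apply: mem_nth; rewrite prednK.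
Qed.

(** Serves both maps: their conditions [r == j], with [i = j-1], and [i+1 <= r] both amount to
    [i < r] on the rows met by run [j], whence the hypothesis on [up]. *)
Lemma relink_equiv i q up : 0 < i < j -> width (run T) j i.+1 <= q ->
  q + j = beta T j + i -> (forall x, x \in run T j -> up x.1 = (i < x.1)) ->
  dR_equiv n (rw T) (rw (relink T i j i.+1 q up)).
Proof.
move=> ij wq eq upE; have [i0 lij] := andP ij.
rewrite rw_of_runs {1}(rw_runs hT) -(syt_size hT).
have sC : sorted reading_lt (cells (shape T)).
  by rewrite (sorted_pairwise reading_lt_trans) cells_sorted.
apply: (slides_dR_equiv (0, 0) (cells_uniq _) reading_lt_trans sC reading_lt_irr (runs_perm hT)).
have ei : iota 1 (nruns T) =
    iota 1 i.-1 ++ i :: iota i.+1 (j.-1 - i) ++ j :: iota j.+1 (nruns T - j).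
  have H a m k : iota 1 (a + (1 + (m + (1 + k)))) =
      iota 1 a ++ a.+1 :: iota a.+2 m ++ (a + m).+2 :: iota (a + m).+3 k.
    by rewrite !iotaD /= !add1n !addn1 !addSn.
  have := H i.-1 (j.-1 - i) (nruns T - j).
  have -> : i.-1 + (1 + (j.-1 - i + (1 + (nruns T - j)))) = nruns T.
    by move: lij i0 jn; clear; lia.
  have -> : (i.-1 + (j.-1 - i)).+3 = j.+1 by move: lij i0; clear; lia.
  have -> : (i.-1 + (j.-1 - i)).+2 = j by move: lij i0; clear; lia.
  by rewrite !prednK.
have low : [seq x <- cells (shape T) | ((x \in run T i) || (x \in run T j)) && (x.1 < i.+1)] =
    run T i ++ lower (run T) j i.
  apply: reading_sorted_eq; first exact/pairwise_filter/cells_sorted.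
    apply: (@run_lower_sorted (run T) j) => //.
    - exact: run_pairwise.
    - exact: run_early_row.
    - exact: run_early_before.
  move=> x; rewrite mem_cat mem_lower mem_filter -/C ltnS.
  have H r : x \in run T r -> x \in C by rewrite run_mem => /andP[].
  apply/idP/idP => [/andP[/andP[/orP[->//|xj] xi] _]|/orP[xi|/andP[xi xj]]].
  - by rewrite xi xj orbT.
  - by rewrite xi (run_early_row ij xi) leqnn (H _ xi).
  - by rewrite xi xj orbT (H _ xj).
rewrite /relink low; set X := run T i ++ lower (run T) j i.
have runj : [seq x <- cells (shape T) | (x \in drop q X) || ((x \in run T j) && up x.1)] =
    upper (run T) j i ++ drop q X.
  have sX : pairwise reading_lt X.
    apply: (@run_lower_sorted (run T) j) => //.
    - exact: run_pairwise.
    - exact: run_early_row.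
    - exact: run_early_before.
  have dX : {subset drop q X <= X} by move=> x; exact: mem_drop.
  have Xi x : x \in X -> x \in C /\ x.1 <= i.
    rewrite mem_cat mem_lower => /orP[xi|/andP[xi]]; last by rewrite run_mem => /andP[].
    by rewrite (run_early_row ij xi); split=> //; move: xi; rewrite run_mem => /andP[].
  apply: reading_sorted_eq; first exact/pairwise_filter/cells_sorted.
    rewrite pairwise_cat (pairwise_filter _ (run_pairwise T j)).
    have -> : pairwise reading_lt (drop q X).
      by move: sX; rewrite -{1}(cat_take_drop q X) pairwise_cat => /and3P[].
    rewrite !andbT; apply/allrelP => x y; rewrite mem_upper => /andP[xi _] /dX /Xi[_ yi].
    by rewrite /reading_lt (leq_ltn_trans yi xi).
  move=> x; rewrite mem_cat mem_upper mem_filter -/C.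
  have [xX|xX] /= := boolP (x \in drop q X).
    by rewrite orbT; case: (Xi x (dX x xX)).
  rewrite orbF; have [xj|xj] := boolP (x \in run T j); last by rewrite andbF.
  by rewrite (upE _ xj) /= andbT; move: xj; rewrite run_mem => /andP[-> _]; rewrite andbT.
rewrite runj.
have nij : (j == i) = false by rewrite gtn_eqF.
rewrite ei !map_cat !flatten_cat /= !map_cat !flatten_cat /= !eqxx nij.
have keep s : i \notin s -> j \notin s ->
    [seq if r == i then take q X else if r == j then upper (run T) j i ++ drop q X
      else run T r | r <- s]
    = [seq run T r | r <- s].
  move=> is_ js; apply/eq_in_map => r rs; rewrite ifN; last by apply: contraNneq is_ => <-.
  by rewrite ifN //; apply: contraNneq js => <-.
rewrite !keep ?mem_iota; try by move: lij i0; clear; lia.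
have := slides_ctx (flatten [seq run T r | r <- iota 1 i.-1])
  (flatten [seq run T r | r <- iota j.+1 (nruns T - j)])
  (@runs_slide (run T) j (run_pairwise T) run_early_row run_last_row run_early_before
     width_early i q ij wq _).
by rewrite (size_run hT last_range) -!catA; apply.
Qed.

End Relink.

(** * Slinks *)

Section Slink.

Variables (n : nat) (T : tableau).
Hypothesis hT : is_syt n T.
Let j := bad_run T.
Hypothesis jn : j <= nruns T.

Lemma bad_runP : not_super T j /\ forall r, 0 < r < j -> ~~ not_super T r.
Proof.
have fs : find (not_super T) (iota 1 (nruns T)) < nruns T by exact: jn.
have hs : has (not_super T) (iota 1 (nruns T)) by rewrite has_find size_iota.
split; first by have := nth_find 0 hs; rewrite nth_iota.
case=> // r /= rj; have rj' : r < find (not_super T) (iota 1 (nruns T)) := rj.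
by have := before_find 0 rj'; rewrite nth_iota ?add1n => [->|]; last exact: ltn_trans rj' fs.
Qed.

(** The first run starts in row 1 and never rises, so it is superstandard by itself. *)
Lemma bad_run_gt1 : 1 < j.
Proof.
rewrite ltn_neqAle eq_sym; apply/andP; split=> //; apply/eqP => j1.
have n1 : 1 <= nruns T by rewrite -j1.
have [bad _] := bad_runP; rewrite j1 in bad.
suff /(superP hT n1) : rows_mono T (brk T 1) by rewrite bad.
have bn := brk_le_n hT n1.
have row_ge1 v : 0 < v <= n -> 0 < rowof T v.
  by move=> vn; have := cellof_in hT vn; rewrite mem_cells => /and4P[].
have row1 v : 0 < v <= brk T 1 -> rowof T v = 1.
  elim: v => // v IH /= v1; case: (posnP v) => [->|v0].
    by apply: (rowof1 hT); exact: leq_ltn_trans (leq0n v) (leq_trans v1 bn).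
  have vn : 0 < v < n by rewrite v0 (leq_trans v1).
  apply/eqP; rewrite eqn_leq row_ge1 /=; last by rewrite (leq_trans v1).
  rewrite andbT; apply: leq_trans (rowof_nondes hT vn _) _; last by rewrite IH ?v0 ?(ltnW v1).
  by apply: (run_nondes hT (r := 0)) => //; rewrite v0.
by move=> v v0 vb; rewrite !row1 ?v0 ?(ltnW vb).
Qed.

Lemma bad_run_mono : rows_mono T (brk T j.-1).
Proof.
have j1 := bad_run_gt1; apply/(superP hT); first exact: leq_trans (leq_pred _) jn.
by apply: (proj2 bad_runP); move: j1; case: (j) => [|[|]] //= k _; rewrite leqnn.
Qed.

Lemma bad_run_range : 1 < j <= nruns T.
Proof. by rewrite bad_run_gt1. Qed.

(** A run [j] contained in row [j] would extend the superstandard tableau by one row, against the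
    choice of [j]. The strict inequality makes [beta_j - 1] an admissible position for [slink] and
    bounds the row found by [slink_star] by [j-1]. *)
Lemma width_bad_run : width (run T) j j < beta T j.
Proof.
have j1 := bad_run_gt1; have jr : 0 < j <= nruns T by rewrite (ltnW j1).
rewrite -(size_run hT jr) /width ltnn add0n size_filter ltn_neqAle count_size andbT -all_count.
apply/negP => /allP allj; have [bad _] := bad_runP.
suff /(superP hT jn) : rows_mono T (brk T j) by rewrite bad.
have rowj v : brk T j.-1 < v <= brk T j -> rowof T v = j.
  by move=> vj; apply/eqP/allj; exact: (run_cellof hT jr vj).
move=> v v0 vb; case: (ltngtP v (brk T j.-1)) => [lt|gt|e].
- exact: bad_run_mono.
- by rewrite !rowj ?gt ?(ltnW vb) ?(ltnW gt) //= ltnW.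
- have rj : 0 < j.-1 < nruns T by rewrite -ltnS prednK ?(ltnW j1) // j1.
  rewrite e; apply/ltnW/(rowof_des hT); last exact: (brk_des hT rj).
  by rewrite -e v0 (leq_trans vb) // (brk_le_n hT).
Qed.

Lemma slink_equiv : dR_equiv n (rw T) (rw (slink T)).
Proof.
have j1 := bad_run_gt1; have wj := width_bad_run; have j0 := ltnW j1.
rewrite /slink -/j jn.
have := @relink_equiv n T j hT bad_run_range bad_run_mono j.-1 (beta T j - 1) (fun r => r == j).
rewrite prednK //; apply.
- by move: j1; clear; lia.
- by move: wj; clear; lia.
- by move: wj j1; clear; lia.
move=> x /(run_last_row hT bad_run_range bad_run_mono) xj.
by rewrite eqn_leq xj.
Qed.

Lemma slink_star_equiv : dR_equiv n (rw T) (rw (slink_star T)).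
Proof.
have j1 := bad_run_gt1; have wj := width_bad_run; have j0 := ltnW j1.
rewrite /slink_star -/j jn.
have wE i : i < j -> nth 0 (shape (first_runs T j)) i = width (run T) j i.+1.
  by move=> ij; rewrite -(width_shape hT bad_run_range bad_run_mono).
set i := slink_star_row T j.
pose P i := nth 0 (shape (first_runs T j)) i + j <= beta T j + i.
pose N := size (shape (first_runs T j)) + j.
have Pj : P j.-1 by rewrite /P wE ?prednK //; move: wj j1; clear; lia.
have sN : size (iota 1 N) = N := size_iota 1 N.
(* The candidates start at 1, so [j-1] stands at position [j-2] of the list that is searched. *)
have jN : j.-2 < N by rewrite /N; move: j1; clear; lia.
have nj : nth 0 (iota 1 N) j.-2 = j.-1 by rewrite nth_iota //; move: j1; clear; lia.
have ij : i <= j.-1.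
  rewrite -[i]/((find P (iota 1 N)).+1).
  suff : find P (iota 1 N) <= j.-2 by case: (j) j1 => [|[|j']].
  by rewrite leqNgt; apply/negP => /(before_find 0); rewrite nj Pj.
have Pi : P i.
  have hs : has P (iota 1 N).
    by apply/hasP; exists j.-1 => //; rewrite -nj mem_nth ?sN.
  have := nth_find 0 hs; rewrite nth_iota ?add1n //.
  by move: hs; rewrite has_find sN.
have lij : i < j by move: ij j1; clear; lia.
rewrite /P wE // in Pi.
apply: (relink_equiv hT bad_run_range bad_run_mono) => //.
- by move: Pi; clear; lia.
- by move: Pi; clear; lia.
Qed.

End Slink.

Lemma tab_step_equiv (k : 'I_3) n T T' : tab_step k n T T' -> dR_equiv n (rw T) (rw T').
Proof.
case=> hT hT'; case: k => -[|[|k]] _ /=.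
- move=> ->; have [le|gt] := leqP (bad_run T) (nruns T); first exact: slink_star_equiv.
  by rewrite /slink_star leqNgt gt; exact: rst_refl.
- move=> ->; have [le|gt] := leqP (bad_run T) (nruns T); first exact: slink_equiv.
  by rewrite /slink leqNgt gt; exact: rst_refl.
move=> [i [i2 iN ->]]; apply: rst_step; split; first exact: syt_perm_word.
exists i; split=> //; rewrite /dR /dR_word /d_word -rw_map -/(d i T).
by case: ifP.
Qed.

(** * Equivalence classes of permutations *)

Lemma is_tabP T : reflect (forall i, i < size T ->
  [/\ nth [::] T i != [::], sorted ltn (nth [::] T i) & dominates (nth [::] T i) (nth [::] T i.+1)])
  (is_tab T).
Proof.
elim: T => [|R T IH]; first by constructor.
apply: (iffP and4P) => [[R0 sR dR /IH H] [|i] //= iT|H].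
  exact: H.
have [R0 sR dR] := H 0 isT; split=> //.
by apply/IH => i iT; exact: (H i.+1).
Qed.

Lemma is_sytE n T : is_syt n T = perm_eq (flatten T) (iota 1 n) && is_tab T.
Proof.
congr (_ && _); apply/and4P/is_tabP => [[nT sT /allP rT /allP cT] i iT|H].
  have iT' := mem_nth [::] iT; split; first by apply: contraNneq nT => <-.
    exact: rT.
  apply/dominatesP => c c2; have i1T : i.+1 < size T.
    by rewrite ltnNge; apply: contraL c2 => le; rewrite nth_default.
  have ii : i \in iota 0 (size T).-1 by rewrite mem_iota add0n; move: i1T; case: (size T).
  have gtr : transitive geq by move=> a b c' ab bc; exact: leq_trans bc ab.
  have le : nth 0 (shape T) i.+1 <= nth 0 (shape T) i.
    by apply: (sorted_leq_nth gtr leqnn 0 sT); rewrite ?inE ?size_map.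
  rewrite !(nth_map [::]) // in le; split; first exact: leq_trans c2 le.
  by have /allP := cT i ii; apply; rewrite mem_iota.
split.
- by apply/negP => /(nthP [::])[i iT ei]; have [] := H i iT; rewrite ei.
- apply/(sortedP 0) => i; rewrite size_map => iT.
  have [_ _ /andP[le _]] := H i (ltnW iT); rewrite !(nth_map [::]) //; exact: ltnW.
- by apply/allP => R /(nthP [::])[i iT <-]; have [] := H i iT.
apply/allP => i; rewrite mem_iota add0n => /andP[_ iT].
have iT' : i < size T by exact: leq_trans iT (leq_pred _).
by have [_ _ /andP[_]] := H i iT'.
Qed.

Lemma is_syt_is_tab n T : is_syt n T -> is_tab T.
Proof. by rewrite is_sytE => /andP[]. Qed.

Lemma is_syt_tab n w : perm_word n w -> is_syt n (tab w).
Proof.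
move=> pw; rewrite is_sytE (perm_trans (tab_perm w) pw) /=.
exact/is_tab_tab/perm_word_uniq/pw.
Qed.

Lemma tab_equiv_syt (k : 'I_3) n T T' : tab_equiv k n T T' -> is_syt n T -> is_syt n T'.
Proof.
move=> e hT; suff [H _] : is_syt n T <-> is_syt n T' by exact: H.
elim: e {hT} => {T T'} [T T' []|T|T T' _ i|T1 T2 T3 _ i1 _ i2] //; first exact: iff_sym.
exact: iff_trans i1 i2.
Qed.

Lemma tab_equiv_rw (k : 'I_3) n T T' : tab_equiv k n T T' -> dR_equiv n (rw T) (rw T').
Proof. by apply: rst_map => U V; exact: tab_step_equiv. Qed.

(** The lifted chain ends in a word that is Knuth equivalent to the reading word of [T], and such a
    word inserts to [T]. *)
Lemma tab_equiv_lift (k : 'I_3) n w T : perm_word n w -> tab_equiv k n (tab w) T ->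
  exists w', [/\ perm_word n w', tab w' = T, (RSK w').2 = (RSK w).2 & dR_equiv n w w'].
Proof.
move=> pw e; have uw := perm_word_uniq pw.
have hT := tab_equiv_syt e (is_syt_tab pw).
have kw : knuth (rw (tab w)) w by apply/rst_sym/knuth_tab_rw.
have [w' [pw' kw' e' eQ]] := dR_equiv_lift (tab_equiv_rw e) pw kw.
exists w'; split=> //; rewrite -(tab_rw (is_syt_is_tab hT)); apply/esym/knuth_tab => //.
by rewrite (perm_uniq (knuth_perm kw')); exact: perm_word_uniq pw'.
Qed.

Lemma RSK_eq w w' : (RSK w).1 = (RSK w').1 -> (RSK w).2 = (RSK w').2 -> RSK w = RSK w'.
Proof. by case: (RSK w) (RSK w') => [P Q] [P' Q'] /= -> ->. Qed.

Section Words.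

Variable n : nat.

Lemma word_perm (p : 'S_n) : perm_word n (word p).
Proof.
apply: uniq_perm; rewrite ?iota_uniq //.
  by rewrite map_inj_uniq ?enum_uniq // => i j [/val_inj/perm_inj].
move=> v; rewrite mem_iota add1n ltnS; apply/mapP/idP => [[i _ ->]|]; first exact: ltn_ord.
case: v => // v /= vn; exists ((p^-1)%g (Ordinal vn)); rewrite ?mem_enum //.
by rewrite permKV.
Qed.

Lemma word_inj : injective (@word n).
Proof.
move=> p q /eq_in_map e; apply/permP => i; apply: val_inj.
by have [] := e i (mem_enum _ _).
Qed.

Lemma word_surj w : perm_word n w -> exists p : 'S_n, word p = w.
Proof.
move=> pw; have sw : size w = n by rewrite (perm_size pw) size_iota.
have wn (i : 'I_n) : (nth 0 w i).-1 < n.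
  have : nth 0 w i \in w by rewrite mem_nth // sw.
  by rewrite (perm_word_mem _ pw) => /andP[h1 h2]; rewrite prednK.
have fi : injective (fun i => Ordinal (wn i)).
  move=> i j [] e; apply/val_inj/eqP.
  rewrite -(nth_uniq 0 _ _ (perm_word_uniq pw)) ?sw ?ltn_ord //.
  have gt0 (i' : 'I_n) : 0 < nth 0 w i'.
    have : nth 0 w i' \in w by rewrite mem_nth // sw.
    by rewrite (perm_word_mem _ pw) => /andP[].
  by rewrite -(prednK (gt0 i)) -(prednK (gt0 j)) e.
exists (perm fi); apply: (@eq_from_nth _ 0); rewrite size_map size_enum_ord ?sw // => i ni.
rewrite (nth_map (Ordinal ni)) ?size_enum_ord // permE /= nth_enum_ord // prednK //.
have : nth 0 w i \in w by rewrite mem_nth // sw.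
by rewrite (perm_word_mem _ pw) => /andP[].
Qed.

Lemma index_rev_lt (w : seq nat) a b : uniq w -> a \in w -> b \in w ->
  (index a (rev w) < index b (rev w)) = (index b w < index a w).
Proof.
move=> uw; have H c : c \in w -> index c (rev w) = size w - (index c w).+1.
  move=> cw; have ic : index c w < size w by rewrite index_mem.
  have lt : size w - (index c w).+1 < size w by move: ic; clear; lia.
  have ek : size w - (size w - (index c w).+1).+1 = index c w by move: ic; clear; lia.
  have ec : c = nth 0 (rev w) (size w - (index c w).+1) by rewrite nth_rev // ek nth_index.
  by rewrite {1}ec index_uniq ?rev_uniq // size_rev.
move=> aw bw; rewrite !H //.
have ia : index a w < size w by rewrite index_mem.
have ib : index b w < size w by rewrite index_mem.
by move: ia ib; clear; lia.
Qed.

Lemma ID_rev w : perm_word n w -> ID n (rev w) = (~: ID n w)%SET.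
Proof.
move=> pw; apply/setP => i; rewrite !inE /inv_des.
have iw : i.+1 \in w by rewrite (perm_word_mem _ pw) /= (leq_trans (ltn_ord i)) ?leq_pred.
have iw1 : i.+2 \in w.
  by rewrite (perm_word_mem _ pw) /=; case: (n) i {iw pw} => [|m] [] // i; rewrite /= ltnS.
rewrite index_rev_lt //; last exact: perm_word_uniq pw.
rewrite -leqNgt [RHS]leq_eqVlt orb_idl // => /eqP /(index_inj 0 iw iw1) /eqP.
by rewrite eqn_leq ltnn andbF.
Qed.

Lemma ID_tab w : perm_word n w -> ID n (rw (tab w)) = ID n w.
Proof.
move=> pw; apply/setP => i; rewrite !inE.
by rewrite (knuth_inv_des _ (perm_word_uniq pw) (knuth_tab_rw (perm_word_uniq pw))).
Qed.

Definition rev_perm (p : 'S_n) : 'S_n := (perm rev_ord_inj * p)%g.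

Lemma nth_word (p : 'S_n) k (kn : k < n) : nth 0 (word p) k = (val (p (Ordinal kn))).+1.
Proof.
rewrite (nth_map (Ordinal kn)) ?size_enum_ord //; congr (val (p _)).+1; apply: val_inj.
exact: nth_enum_ord.
Qed.

Lemma word_rev p : word (rev_perm p) = rev (word p).
Proof.
have sw (q : 'S_n) : size (word q) = n by rewrite size_map size_enum_ord.
apply: (@eq_from_nth _ 0); rewrite ?size_rev !sw // => i ni.
have ri : n - i.+1 < n by move: ni; clear; lia.
rewrite nth_rev sw // (nth_word _ ni) (nth_word _ ri) permM permE.
by congr (val (p _)).+1; apply: val_inj.
Qed.

Lemma rev_permK : involutive rev_perm.
Proof. by move=> p; apply: word_inj; rewrite !word_rev revK. Qed.

(** The value of [omega] is computed on series of the form [Fcomb c], so the sum is grouped by the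
    sets [D q], with multiplicities as coefficients, and ungrouped again after complementation. *)
Lemma omega_sum (I : finType) (B : {set I}) (D : I -> {set 'I_n.-1}) :
  omega n (\sum_(q in B) F (D q))%R = (\sum_(q in B) F (~: D q)%SET)%R.
Proof.
have H (G : {set 'I_n.-1} -> qseries) :
    (\sum_(q in B) G (D q) =
     \sum_E G E *~ (\sum_(q in B) (D q == E)%:R))%R.
  under [RHS]eq_bigr => E _ do rewrite mulrz_sumr.
  rewrite exchange_big /=; apply: eq_bigr => q _.
  rewrite (bigD1 (D q)) //= eqxx mulr1z big1 ?addr0 // => E /negPf.
  by rewrite eq_sym => ->; rewrite mulr0z.
rewrite (H (fun E => F E)) -/(Fcomb (fun E => \sum_(q in B) (D q == E)%:R)%R) omega_Fcomb.
by rewrite -(H (fun E => F (~: E)%SET)).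
Qed.

End Words.

(** The lifted word has the insertion and recording tableaux of [word q], hence equals it by
    injectivity of RSK. *)
Lemma perm_equiv_dR (k : 'I_3) n (p q : 'S_n) :
  perm_equiv k p q -> dR_equiv n (word p) (word q).
Proof.
rewrite /perm_equiv !RSK_tab => -[eP eQ].
have [w [pw tw qw e]] := tab_equiv_lift (word_perm p) eP.
suff -> : word q = w by [].
apply: RSK_inj; [exact: perm_word_uniq (word_perm q) | exact: perm_word_uniq pw |].
by apply: RSK_eq; rewrite ?RSK_tab ?tw ?qw.
Qed.

Lemma perm_equiv_refl (k : 'I_3) n (p : 'S_n) : perm_equiv k p p.
Proof. by split=> //; exact: rst_refl. Qed.

Lemma perm_equiv_sym (k : 'I_3) n (p q : 'S_n) : perm_equiv k p q -> perm_equiv k q p.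
Proof. by case=> eP eQ; split=> //; exact: rst_sym. Qed.

Lemma perm_equiv_trans (k : 'I_3) n (p q r : 'S_n) :
  perm_equiv k p q -> perm_equiv k q r -> perm_equiv k p r.
Proof. by case=> eP eQ [eP' eQ']; split; [exact: rst_trans eP eP' | rewrite eQ]. Qed.

(** Insertion is a bijection from the class of [p] onto the class of its tableau: injective because
    the recording tableau is constant on the class, surjective by lifting. It keeps [ID]. *)
Lemma fk_class (k : 'I_3) n (p : 'S_n) (B : {set 'S_n}) :
  (forall q, q \in B <-> perm_equiv k p q) ->
  fk k n (\sum_(q in B) F (ID n (word q)))%R.
Proof.
move=> HB; exists (tab (word p)), [seq tab (word q) | q <- enum B]; split.
- exact/is_syt_tab/word_perm.
- rewrite map_inj_in_uniq ?enum_uniq // => q q'.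
  rewrite !mem_enum => /HB[_ eQ] /HB[_ eQ'] eP; apply: word_inj.
  apply: RSK_inj; try exact: perm_word_uniq (word_perm _).
  by apply: RSK_eq; rewrite ?RSK_tab // -eQ.
- move=> T; split=> [/mapP[q]|e].
    by rewrite mem_enum => /HB[eP _] ->; rewrite -!RSK_tab.
  have [w [pw tw qw _]] := tab_equiv_lift (word_perm p) e.
  have [q eq] := word_surj pw; apply/mapP; exists q; last by rewrite eq.
  by rewrite mem_enum; apply/HB; split; rewrite ?RSK_tab eq ?tw.
- rewrite big_map big_enum /=; apply: eq_bigr => q _.
  by rewrite ID_tab //; exact: word_perm.
Qed.

(** The reverses of the elements of [C] form a union [D] of classes of [perm_equiv], and each class
    contributes one summand with coefficient 1. Reindexing by reversal turns every [ID] into its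
    complement, as [omega] does. *)
Lemma fh_nat_comb (k : 'I_3) n (f : qseries) :
  fh n f -> nat_comb (omega n @` fk k n)%classic f.
Proof.
case=> p [C [HC ->]]; pose D := [set q | rev_perm q \in C]%SET.
pose R := [rel q q' : 'S_n | `[< perm_equiv k q q' >]].
have eqR : {in D & &, equivalence_rel R}.
  move=> x y z _ _ _; split; first exact/asboolP/perm_equiv_refl.
  move=> /asboolP xy; apply/asboolP/asboolP; last exact: perm_equiv_trans.
  by apply: perm_equiv_trans; exact: perm_equiv_sym.
have closedD q q' : q \in D -> perm_equiv k q q' -> q' \in D.
  rewrite !inE => /HC h e; apply/HC; apply: rst_trans h _; rewrite !word_rev.
  exact: (proj1 (dR_equiv_sde (perm_equiv_dR e))).
pose P := equivalence_partition R D.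
exists #|P|, (fun i : 'I_#|P| => \sum_(q in enum_val i) F (~: ID n (word q))%SET)%R, (fun=> 1).
split.
  move=> i; have := enum_valP i; case/imsetP => q qD eB.
  exists (\sum_(q in enum_val i) F (ID n (word q)))%R; last exact: omega_sum.
  apply: (fk_class (p := q)) => q'; rewrite eB !inE; split; first by case/andP=> _ /asboolP.
  by move=> e; apply/andP; split; [have := closedD _ _ qD e; rewrite inE | exact/asboolP].
under [RHS]eq_bigr => i _ do rewrite mulr1n.
rewrite -(big_enum_val (A := mem P)
  (fun B : {set 'S_n} => \sum_(q in B) F (~: ID n (word q))%SET)%R) /=.
rewrite -(set_partition_big _ (equivalence_partitionP eqR)).
rewrite (reindex_inj (inv_inj (@rev_permK n))) /=.
apply: eq_big => [q|q _]; first by rewrite inE.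
by rewrite word_rev ID_rev //; exact: word_perm.
Qed.

Theorem theorem4p5 (k : 'I_3) (n : nat) :
  ((forall p q : 'S_n, perm_equiv k p q ->
      shifted_dual_equiv n (rev (word p)) (rev (word q))) /\
   (forall f : qseries, fh n f -> nat_comb (omega n @` fk k n)%classic f)) /\
  (forall p q : 'S_n, perm_equiv k p q ->
      shifted_dual_equiv n (flip n (word p)) (flip n (word q))).
Proof.
split; first split.
- by move=> p q /perm_equiv_dR /dR_equiv_sde[].
- exact: fh_nat_comb.
- by move=> p q /perm_equiv_dR /dR_equiv_sde[].
Qed.
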